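(* If $\operatorname{Re}(\nu_j)>0$, $a_j>0$, $j\in\mathbb{N}$, and $f(t)$ is a given function defined on $\mathbb{R}_+$, then the equation $$N(t)-N_0f(t)=-\sum_{j=1}^n a_j\;{}_0D_t^{-\nu_j}N(t)$$ is solvable and its particular solution is given by $$N(t)=N_0\sum_{l=0}^\infty(-1)^l\sum_{r_1+\cdots+r_{n-1}=l}\frac{l!}{r_1!\cdots r_{n-1}!}\left\{\prod_{\mu=1}^{n-1}(a_{\mu+1})^{r_\mu}\right\}\int_0^t f(u)\,(t-u)^{\sum_{\mu=1}^{n-1}\nu_{\mu+1}-1}\,E^{(l+1)}_{\nu_1,\;\sum_{\mu=1}^{n-1}\nu_{\mu+1}}\left[-a_1(t-u)^{\nu_1}\right]du,$$ where the inner summation is taken over all nonnegative integers $r_1,\dots,r_{n-1}$ such that $r_1+\cdots+r_{n-1}=l$, and provided that the series and integral in this formula are convergent.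
   Context: $N_0$ is a constant and $N(t)$ is the unknown function. For $\operatorname{Re}(\nu)>0$, ${}_0D_t^{-\nu}$ denotes the Riemann-Liouville fractional integral $${}_0D_t^{-\nu}f(t)=\frac{1}{\Gamma(\nu)}\int_0^t(t-u)^{\nu-1}f(u)\,du,$$ with ${}_0D_t^0f(t)=f(t)$. The generalized Mittag-Leffler function is defined by the series $$E^\delta_{\beta,\gamma}(z)=\sum_{\tau=0}^\infty\frac{(\delta)_\tau z^\tau}{\Gamma(\beta\tau+\gamma)\,\tau!},\qquad \beta,\gamma,\delta\in\mathbb{C},\ \operatorname{Re}(\beta)>0,\ \operatorname{Re}(\gamma)>0,$$ where $(\delta)_\tau=\delta(\delta+1)\cdots(\delta+\tau-1)$ and $(\delta)_0=1$. The superscript $(l+1)$ in $E^{(l+1)}_{\beta,\gamma}$ is the parameter value $\delta=l+1$.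
   Formalization: The printed formula is false; the exponent and the Mittag-Leffler parameter, printed as the sum of ν_{μ+1}, are corrected to the sum of r_μ ν_{μ+1}, and in the term l=0, where this sum is 0, the summand f(t) is added to the integral. *)

(* Defs.v *)
(* MathComp-Analysis, with complex numbers R[i] over R : realType. *)
From mathcomp Require Import all_boot all_order all_algebra.
From mathcomp Require Import all_classical all_reals all_analysis.
From mathcomp Require Export complex.

Set Implicit Arguments.
Unset Strict Implicit.
Unset Printing Implicit Defensive.

Import Order.TTheory GRing.Theory Num.Theory.
Import numFieldNormedType.Exports.

Local Open Scope classical_set_scope.
Local Open Scope ring_scope.
Local Open Scope complex_scope.

Section ComplexAnalysis.
Context {R : realType}.

(* Convergence and integrals of complex-valued objects are taken componentwise;
   integrals are Lebesgue integrals, so "convergent" means integrable. *)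
Definition ccvg (u : nat -> R[i]) : Prop :=
  cvgn (fun n => complex.Re (u n)) /\ cvgn (fun n => complex.Im (u n)).

Definition clim (u : nat -> R[i]) : R[i] :=
  limn (fun n => complex.Re (u n)) +i* limn (fun n => complex.Im (u n)).

Definition cintegrable (D : set R) (g : R -> R[i]) : Prop :=
  lebesgue_measure.-integrable D (fun u => (complex.Re (g u))%:E) /\
  lebesgue_measure.-integrable D (fun u => (complex.Im (g u))%:E).

Definition cintegral (D : set R) (g : R -> R[i]) : R[i] :=
  Rintegral lebesgue_measure D (fun u => complex.Re (g u)) +i*
  Rintegral lebesgue_measure D (fun u => complex.Im (g u)).

(* s ^ z = s ^ Re z * exp (i Im z ln s), the principal power; only used for
   s > 0, up to a null set of s. *)
Definition cpow (s : R) (z : R[i]) : R[i] :=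
  (s `^ complex.Re z)%:C *
  (cos (complex.Im z * ln s) +i* sin (complex.Im z * ln s)).

(* Euler's integral, meaningful for Re z > 0. *)
Definition cGamma (z : R[i]) : R[i] :=
  cintegral `]0, +oo[ (fun s => (expR (- s))%:C * cpow s (z - 1)).

(* The entire function 1 / Gamma on {Re z > 0} and at its zero z = 0. *)
Definition crGamma (z : R[i]) : R[i] := if z == 0 then 0 else (cGamma z)^-1.

Definition pochhammer (d : R[i]) (k : nat) : R[i] := \prod_(i < k) (d + i%:R).

Definition mittag_leffler (d b c z : R[i]) : R[i] :=
  clim (series (fun k =>
    pochhammer d k * z ^+ k * crGamma (b * k%:R + c) / (k`!)%:R)).

Definition RL_integrand (nu : R[i]) (f : R -> R[i]) (t u : R) : R[i] :=
  cpow (t - u) (nu - 1) * f u.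

(* RL_integral nu f is {}_0 D_t^{-nu} f *)
Definition RL_integral (nu : R[i]) (f : R -> R[i]) (t : R) : R[i] :=
  if nu == 0 then f t
  else (cGamma nu)^-1 * cintegral `[0, t] (RL_integrand nu f t).

(* {}_0 D_t^{-nu} f exists at t *)
Definition RL_defined (nu : R[i]) (f : R -> R[i]) (t : R) : Prop :=
  nu == 0 \/ cintegrable `[0, t] (RL_integrand nu f t).

Definition ML_integrand (d b c w : R[i]) (f : R -> R[i]) (t u : R) : R[i] :=
  f u * cpow (t - u) (c - 1) * mittag_leffler d b c (w * cpow (t - u) b).

(* The convolution of f with s ^ (c - 1) E^d_{b,c}(w s ^ b).  The leading term
   s ^ (c - 1) / Gamma(c) of this kernel contributes {}_0 D_t^{-c} f, which for
   c = 0 is f itself and is not seen by the Lebesgue integral (there the leading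
   coefficient 1 / Gamma(0) is 0); it is therefore added separately. *)
Definition ML_integral (d b c w : R[i]) (f : R -> R[i]) (t : R) : R[i] :=
  (if c == 0 then f t else 0) + cintegral `[0, t] (ML_integrand d b c w f t).

End ComplexAnalysis.

Section KineticEquation.
Context {R : realType}.
Variables (n : nat) (a : nat -> R) (nu : nat -> R[i]).
Variables (N0 : R[i]) (f : R -> R[i]).

(* Only a_1, ..., a_n and nu_1, ..., nu_n are used. *)
Definition kinetic_solution (N : R -> R[i]) : Prop :=
  forall t : R, 0 <= t ->
    (forall j : nat, (1 <= j <= n)%N -> RL_defined (nu j) N t) /\
    N t - N0 * f t = - \sum_(1 <= j < n.+1) (a j)%:C * RL_integral (nu j) N t.

(* An index tuple (r_1, ..., r_{n-1}) of sum l has entries at most l; the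
   ordinal m stands for the index mu = m + 1, so that nu_{mu+1} = nu m.+2. *)
Definition multi_exponent (l : nat) := {ffun 'I_n.-1 -> 'I_l.+1}.

Definition weight (l : nat) (r : multi_exponent l) : nat := (\sum_(m < n.-1) r m)%N.

Definition multinomial_coef (l : nat) (r : multi_exponent l) : R[i] :=
  (l`!)%:R / \prod_(m < n.-1) ((r m)`!)%:R.

Definition coef_prod (l : nat) (r : multi_exponent l) : R[i] :=
  \prod_(m < n.-1) (a m.+2)%:C ^+ r m.

(* Each nu_{mu+1} is counted with its multiplicity r_mu, as it is in the
   Laplace transform prod_mu (a_{mu+1} p^{-nu_{mu+1}})^{r_mu} of the
   corresponding term. *)
Definition order_sum (l : nat) (r : multi_exponent l) : R[i] :=
  \sum_(m < n.-1) (r m)%:R * nu m.+2.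

Definition solution_term (t : R) (l : nat) : R[i] :=
  (-1) ^+ l * \sum_(r : multi_exponent l | weight r == l)
    multinomial_coef r * coef_prod r *
    ML_integral (l.+1)%:R (nu 1%N) (order_sum r) (- (a 1%N)%:C) f t.

Definition solution_integrals_converge : Prop :=
  forall (t : R) (l : nat) (r : multi_exponent l), 0 <= t -> weight r = l ->
    cintegrable `[0, t]
      (ML_integrand (l.+1)%:R (nu 1%N) (order_sum r) (- (a 1%N)%:C) f t).

Definition solution_series_converges : Prop :=
  forall t : R, 0 <= t -> ccvg (series (solution_term t)).

End KineticEquation.

(* Main.v *)
(* Write I^z for the fractional integral of order z and f0 for the source
   extended by zero to negative times. A Mittag-Leffler kernel behaves near 0 like a
   nonzero multiple of a power, so the integrability of its convolutions with f0
   already forces f0 to be locally integrable and I^(Re nu_j) |f0| to be finite at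
   every time.

   The equation says N = N0 f0 + A N with A = - sum_j a_j I^(nu_j), so the solution
   is N0 times the Neumann series sum_m A^m f0. Splitting A into its j = 1 part and
   the rest, A^m f0 = sum_(l + k = m) C(m, k) x(l, k) with
   x(l, k) = (-1)^l (- a_1)^k I^(k nu_1) (sum_(j >= 2) a_j I^(nu_j))^l f0. Summing the
   same double series over k first gives the Mittag-Leffler convolutions, by
   (l+1)_k / k! = C(l + k, k), and the multinomial expansion in the other orders.

   Absolute convergence, uniform domination and the exchange with I^(nu_j) all come
   from one estimate: if z is a sum of m of the orders, then on (0, T] the kernel
   s^(z-1) / Gamma(z) is at most C th^m sum_j s^(Re nu_j - 1), for any th > 0. It
   rests on Gamma(z) Gamma(w) = Gamma(z + w) B(z, w) and |B(z, w)| <= 2 B(Re z, Re w),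
   together with the superexponential growth of Gamma on the positive reals. *)

(* The obstacle is that Gamma is given only by Euler's integral. Recovering f0 from its convolutions
   requires 1/Gamma(nu_j) to be nonzero, and the kernel estimate requires 1/|Gamma(z)| to be small
   off the real axis as well. Nonvanishing takes two moves: a zero at z would propagate to every z +
   n, because B(1, w) is never 0; and once Re z is large compared with the square of Im z, the
   integral, rotated so that its phase vanishes near the peak of e^(-s) s^(x-1), has positive real
   part. Size is controlled through the quotient Gamma(Re z)/|Gamma(z)|, which grows at most
   geometrically in the number of orders added up and is therefore beaten by the real Gamma. The
   freedom in th pays for the rest: powers of the a_j, binomials, factors 2. The rates 1/8, 1/4, 1/2
   in the rearrangement come from a binomial of at most 2^(l+k) and from the L incomplete rows of a
   triangle, with L <= 2^L. The operator of order 0 is the identity, which no integrable kernel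
   represents; it is carried beside the kernels as a separate case. *)
Require Import Defs.
From HB Require Import structures.
From mathcomp Require Import all_boot all_order all_algebra.
From mathcomp Require Import all_classical all_reals all_analysis measurable_realfun.
From mathcomp Require Import ring lra.
Set Implicit Arguments.
Unset Strict Implicit.
Unset Printing Implicit Defensive.
Import Order.TTheory GRing.Theory Num.Theory.
Import numFieldNormedType.Exports.
Import Normc.
Local Open Scope classical_set_scope.
Local Open Scope ring_scope.
Local Open Scope complex_scope.

(** * Modulus and components of complex numbers *)

Section ComplexNorm.
Context {R : realType}.
Implicit Types z w : R[i].

Lemma normc_ge0 z : 0 <= normc z.
Proof. by case: z => a b; exact: sqrtr_ge0. Qed.

Lemma normcD z w : normc (z + w) <= normc z + normc w.
Proof. exact: le_normcD. Qed.

Lemma Re_le_normc z : `|complex.Re z| <= normc z.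
Proof. by case: z => a b /=; rewrite -sqrtr_sqr ler_wsqrtr // lerDl sqr_ge0. Qed.

Lemma Im_le_normc z : `|complex.Im z| <= normc z.
Proof. by case: z => a b /=; rewrite -sqrtr_sqr ler_wsqrtr // lerDr sqr_ge0. Qed.

Lemma normc_le_ReIm z : normc z <= `|complex.Re z| + `|complex.Im z|.
Proof.
case: z => a b /=; rewrite -(ger0_norm (addr_ge0 (normr_ge0 a) (normr_ge0 b))).
rewrite -sqrtr_sqr ler_wsqrtr// sqrrD !real_normK ?num_real//.
by rewrite lerD2r lerDl mulrn_wge0// mulr_ge0.
Qed.

Lemma normc_real (x : R) : normc x%:C = `|x|.
Proof. by rewrite /= expr0n addr0 sqrtr_sqr. Qed.

Lemma normc_nat (n : nat) : normc (n%:R : R[i]) = n%:R.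
Proof. by rewrite -(rmorph_nat (real_complex R)) normc_real ger0_norm. Qed.

Lemma normcX z n : normc (z ^+ n) = normc z ^+ n.
Proof.
elim: n => [|n IH]; first by rewrite !expr0 normc1.
by rewrite !exprS normcM IH.
Qed.

Lemma normc_sum I (s : seq I) (P : pred I) (F : I -> R[i]) :
  normc (\sum_(i <- s | P i) F i) <= \sum_(i <- s | P i) normc (F i).
Proof.
elim/big_rec2: _ => [|i x y _ IH]; first by rewrite normc0.
by rewrite (le_trans (normcD _ _))// lerD2l.
Qed.

Lemma normc_eq0 z : (normc z == 0) = (z == 0).
Proof. by apply/eqP/eqP => [/eq0_normc|->]; rewrite ?normc0. Qed.

Lemma normc_gt0 z : (0 < normc z) = (z != 0).
Proof. by rewrite lt0r normc_ge0 normc_eq0 andbT. Qed.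

Lemma Re_rM (x : R) z : complex.Re (x%:C * z) = x * complex.Re z.
Proof. by case: z => a b; simpc. Qed.

Lemma Im_rM (x : R) z : complex.Im (x%:C * z) = x * complex.Im z.
Proof. by case: z => a b; simpc. Qed.

Lemma ReM z w : complex.Re (z * w) =
  complex.Re z * complex.Re w - complex.Im z * complex.Im w.
Proof. by case: z w => a b [c d]; simpc. Qed.

Lemma ImM z w : complex.Im (z * w) =
  complex.Re z * complex.Im w + complex.Im z * complex.Re w.
Proof. by case: z w => a b [c d]; simpc. Qed.

Lemma ReIm_eq z w : complex.Re z = complex.Re w -> complex.Im z = complex.Im w ->
  z = w.
Proof. by case: z w => a b [c d] /= -> ->. Qed.

End ComplexNorm.

(** * Limits and geometric domination of complex series *)

Section ComplexLimits.
Context {R : realType}.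
Implicit Types u v : nat -> R[i].

(** [clim] has a value for every sequence; this relation asserts convergence and names the limit at
    once, so that limits can be combined before they are identified with [clim]. *)
Definition cto u (l : R[i]) :=
  complex.Re (u n) @[n --> \oo] --> complex.Re l /\
  complex.Im (u n) @[n --> \oo] --> complex.Im l.

Lemma cto_clim u l : cto u l -> clim u = l.
Proof.
by case=> hR hI; rewrite /clim (cvg_lim _ hR)// (cvg_lim _ hI)//; case: (l).
Qed.

Lemma ccvg_cto u : ccvg u -> cto u (clim u).
Proof. by case=> hR hI. Qed.

Lemma cto_unique u l l' : cto u l -> cto u l' -> l = l'.
Proof. by move=> /cto_clim <- /cto_clim. Qed.

Lemma cto_normcP u l : cto u l <-> normc (u n - l) @[n --> \oo] --> 0.
Proof.
split=> [[hR hI]|h].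
  apply: (@squeeze_cvgr _ _ _ _ (fun=> 0)
    (fun n => `|complex.Re (u n) - complex.Re l| + `|complex.Im (u n) - complex.Im l|)).
  - near=> n; rewrite normc_ge0/=.
    by apply: le_trans (normc_le_ReIm _) _; case: (u n) => a b; case: (l).
  - exact: cvg_cst.
  - rewrite -[X in _ --> X](addr0 (0:R)).
    apply: cvgD; apply/norm_cvg0P; apply/subr_cvg0; first exact: hR.
    exact: hI.
have sq g : (forall n, `|g n| <= normc (u n - l)) -> g n @[n --> \oo] --> (0:R).
  move=> gn; apply/norm_cvg0P; apply: squeeze_cvgr h; last exact: cvg_cst.
  by near=> n; rewrite normr_ge0/= gn.
split; apply/subr_cvg0; apply: sq => n.
  by apply: le_trans (Re_le_normc _); case: (u n) => a b; case: (l).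
by apply: le_trans (Im_le_normc _); case: (u n) => a b; case: (l).
Unshelve. all: by end_near. Qed.

Lemma cto_ext u v l : u =1 v -> cto u l -> cto v l.
Proof. by move=> /funext ->. Qed.

Lemma cto_cst l : cto (fun=> l) l.
Proof. by split; exact: cvg_cst. Qed.

Lemma ctoD u v l m : cto u l -> cto v m -> cto (fun n => u n + v n) (l + m).
Proof.
move=> [a b] [c d]; split.
  have -> : (fun n => complex.Re (u n + v n)) =
    (fun n => complex.Re (u n)) \+ (fun n => complex.Re (v n)).
    by apply/funext => n /=; rewrite raddfD.
  by rewrite raddfD; exact: cvgD.
have -> : (fun n => complex.Im (u n + v n)) =
  (fun n => complex.Im (u n)) \+ (fun n => complex.Im (v n)).
  by apply/funext => n /=; rewrite raddfD.
by rewrite raddfD; exact: cvgD.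
Qed.

Lemma ctoZ u l c : cto u l -> cto (fun n => c * u n) (c * l).
Proof.
move=> /cto_normcP h; apply/cto_normcP.
under eq_fun do rewrite -mulrBr normcM.
by rewrite -(mulr0 (normc c)); apply: cvgM h; exact: cvg_cst.
Qed.

Lemma ctoB u v l m : cto u l -> cto v m -> cto (fun n => u n - v n) (l - m).
Proof.
move=> a b; rewrite -(mulN1r m).
by apply: (cto_ext _ (ctoD a (ctoZ (-1) b))) => n; rewrite mulN1r.
Qed.

Lemma cto_sum (I : Type) (r : seq I) (P : pred I) (u : I -> nat -> R[i]) (l : I -> R[i]) :
  (forall i, P i -> cto (u i) (l i)) ->
  cto (fun n => \sum_(i <- r | P i) u i n) (\sum_(i <- r | P i) l i).
Proof.
move=> h; elim: r => [|i r IH].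
  by apply: (cto_ext _ (cto_cst _)) => n; rewrite !big_nil.
rewrite big_cons; case: ifPn => Pi.
  by apply: (cto_ext _ (ctoD (h i Pi) IH)) => n; rewrite big_cons Pi.
by apply: (cto_ext _ IH) => n; rewrite big_cons (negbTE Pi).
Qed.

Lemma cto_shiftS u l : cto (fun n => u n.+1) l <-> cto u l.
Proof.
by split=> -[a b]; split;
  [rewrite -cvg_shiftS|rewrite -cvg_shiftS|rewrite -cvg_shiftS in a|rewrite -cvg_shiftS in b].
Qed.

Lemma cto_near0 u v l : cto u l -> normc (u n - v n) @[n --> \oo] --> 0 -> cto v l.
Proof.
move=> ul uv.
have d0 : cto (fun n => u n - v n) 0.
  by apply/cto_normcP; under eq_fun do rewrite subr0.
rewrite -(subr0 l); apply: (cto_ext _ (ctoB ul d0)) => n.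
by rewrite opprB addrC subrK.
Qed.

Lemma normc_cto_le u l (B : R) : cto u l -> (forall n, normc (u n) <= B) -> normc l <= B.
Proof.
move=> /cto_normcP h ub; apply/ler_addgt0Pr => e e0.
have /cvgr0_norm_le /(_ e e0) [n _ /(_ n (leqnn n))] := h.
rewrite /= ger0_norm ?normc_ge0// => hn.
have -> : l = u n - (u n - l) by rewrite opprB addrC subrK.
by rewrite (le_trans (normcD _ _))// normcN lerD// ub.
Qed.

(** For q <= 1/2 a geometric tail is at most twice its first term, since C q^m + 2 C q^(m+1) <= 2 C
    q^m. This inequality is the induction step, and the bound is uniform in n. *)
Lemma geometric_sum_le (C q : R) m n : 0 <= C -> 0 <= q -> q <= 2^-1 ->
  \sum_(m <= k < n) C * q ^+ k <= 2 * C * q ^+ m.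
Proof.
move=> C0 q0 q2; have [nm|/ltnW mn] := leqP n m.
  by rewrite big_geq// mulr_ge0 ?exprn_ge0// mulr_ge0.
rewrite -(subnKC mn); move: (n - m)%N => d {n mn}; elim: d m => [|d IH] m.
  by rewrite addn0 big_geq// mulr_ge0 ?exprn_ge0// mulr_ge0.
rewrite -addSnnS big_ltn ?leq_addr// (le_trans (lerD (lexx _) (IH _)))// exprS.
have := mulr_ge0 C0 (exprn_ge0 m q0); move: (q ^+ m) => p; nra.
Qed.

Lemma Re_sum I (s : seq I) (P : pred I) (F : I -> R[i]) :
  complex.Re (\sum_(i <- s | P i) F i) = \sum_(i <- s | P i) complex.Re (F i).
Proof. exact: raddf_sum. Qed.

Lemma Im_sum I (s : seq I) (P : pred I) (F : I -> R[i]) :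
  complex.Im (\sum_(i <- s | P i) F i) = \sum_(i <- s | P i) complex.Im (F i).
Proof. exact: raddf_sum. Qed.

Lemma geometric_ccvg (u : nat -> R[i]) (C q : R) : 0 <= q -> q <= 2^-1 ->
  (forall k, normc (u k) <= C * q ^+ k) -> ccvg (series u).
Proof.
move=> q0 q2 uC.
have q1 : `|q| < 1 by rewrite ger0_norm// (le_lt_trans q2)// invf_lt1 ?ltr1n.
have cg : cvgn (series (geometric C q)) by exact: is_cvg_geometric_series.
have aux (g : nat -> R) : (forall k, `|g k| <= C * q ^+ k) -> cvgn (series g).
  move=> gC; apply: normed_cvg; apply: series_le_cvg cg => k //=.
  exact: le_trans (gC k).
split.
  under eq_fun do rewrite Re_sum.
  by apply: aux => k; exact: le_trans (Re_le_normc _) (uC k).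
under eq_fun do rewrite Im_sum.
by apply: aux => k; exact: le_trans (Im_le_normc _) (uC k).
Qed.

Lemma geometric_tail_le (u : nat -> R[i]) (l : R[i]) (C q : R) m :
  0 <= C -> 0 <= q -> q <= 2^-1 ->
  (forall k, normc (u k) <= C * q ^+ k) -> cto (series u) l ->
  normc (l - series u m) <= 2 * C * q ^+ m.
Proof.
move=> C0 q0 q2 uC ul.
have h : cto (fun n => series u (m + n)%N - series u m) (l - series u m).
  apply: ctoB; last exact: cto_cst.
  elim: m => [|m IH]; first by apply: (cto_ext _ ul) => n; rewrite add0n.
  have := (cto_shiftS (fun n => series u (m + n)%N) l).2 IH.
  by apply: cto_ext => n; rewrite addSnnS.
apply: (normc_cto_le h) => n.
rewrite sub_series_geq ?leq_addr// (le_trans (normc_sum _ _ _))//.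
by rewrite (le_trans _ (geometric_sum_le m (m + n) C0 q0 q2))// ler_sum.
Qed.

End ComplexLimits.

(** * Measurability and integration of complex-valued functions *)

Section ComplexMeasurability.
Context {R : realType} {d : measure_display} {T : measurableType d}.
Implicit Types (D : set T) (g h : T -> R[i]).

Definition cmeas D g :=
  measurable_fun D (fun x => complex.Re (g x)) /\
  measurable_fun D (fun x => complex.Im (g x)).

Lemma cmeas_cst D (c : R[i]) : cmeas D (fun=> c).
Proof. by split; exact: measurable_cst. Qed.

Lemma cmeas_real D (g : T -> R) : measurable_fun D g -> cmeas D (fun x => (g x)%:C).
Proof. by move=> mg; split => //=; exact: measurable_cst. Qed.

Lemma cmeasS D E g : measurable E -> D `<=` E -> cmeas E g -> cmeas D g.
Proof. by move=> mE DE [mR mI]; split; [exact: measurable_funS mR|exact: measurable_funS mI]. Qed.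

Lemma cmeas_eq D g h : {in D, g =1 h} -> cmeas D g -> cmeas D h.
Proof.
move=> gh [mR mI]; split.
  by apply: eq_measurable_fun mR => x xD; rewrite gh.
by apply: eq_measurable_fun mI => x xD; rewrite gh.
Qed.

Lemma cmeasD D g h : cmeas D g -> cmeas D h -> cmeas D (fun x => g x + h x).
Proof.
move=> [gR gI] [hR hI]; split.
  by under eq_fun do rewrite raddfD; exact: measurable_funD.
by under eq_fun do rewrite raddfD; exact: measurable_funD.
Qed.

Lemma cmeasM D g h : cmeas D g -> cmeas D h -> cmeas D (fun x => g x * h x).
Proof.
move=> [gR gI] [hR hI]; split.
  by under eq_fun do rewrite ReM; apply: measurable_funB; exact: measurable_funM.
by under eq_fun do rewrite ImM; apply: measurable_funD; exact: measurable_funM.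
Qed.

Lemma cmeas_sum D (I : Type) (s : seq I) (P : pred I) (g : I -> T -> R[i]) :
  (forall i, P i -> cmeas D (g i)) -> cmeas D (fun x => \sum_(i <- s | P i) g i x).
Proof.
move=> mg; elim: s => [|i s IH].
  by under eq_fun do rewrite big_nil; exact: cmeas_cst.
under eq_fun do rewrite big_cons.
by case Pi: (P i) => //; apply: cmeasD => //; exact: mg.
Qed.

Lemma cmeas_cvg D (g : nat -> T -> R[i]) h : (forall n, cmeas D (g n)) ->
  (forall x, D x -> cto (g ^~ x) (h x)) -> cmeas D h.
Proof.
move=> mg gh; split.
  apply: (measurable_fun_cvg (h := fun n x => complex.Re (g n x))) => [m|x Dx].
    by case: (mg m).
  by case: (gh x Dx).
apply: (measurable_fun_cvg (h := fun n x => complex.Im (g n x))) => [m|x Dx].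
  by case: (mg m).
by case: (gh x Dx).
Qed.

Lemma measurable_normc D g : cmeas D g -> measurable_fun D (fun x => normc (g x)).
Proof.
move=> [gR gI].
have -> : (fun x => normc (g x)) =
  (@Num.sqrt R) \o (fun x => complex.Re (g x) ^+ 2 + complex.Im (g x) ^+ 2).
  by apply/funext => x /=; case: (g x).
apply: measurableT_comp; first by apply: continuous_measurable_fun; exact: sqrt_continuous.
by apply: measurable_funD; exact: measurable_funX.
Qed.

Lemma cmeasV D g : cmeas D g -> cmeas D (fun x => (g x)^-1).
Proof.
move=> mg; have mn := measurable_normc mg; case: mg => gR gI.
(* The inverse is the conjugate over the squared modulus. The real reciprocal is written as the
   power -1, whose measurability is known; both sides are 0 where g vanishes. *)
have -> : (fun x => (g x)^-1) = (fun x => ((normc (g x) ^+ 2) `^ (-1))%:C *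
   (complex.Re (g x) -i* complex.Im (g x))).
  apply/funext => x; rewrite powR_inv1 ?exprn_ge0 ?normc_ge0//.
  case: (g x) => a b; rewrite /= sqr_sqrtr ?addr_ge0 ?sqr_ge0//.
  by apply: ReIm_eq; rewrite ?Re_rM ?Im_rM /= ?mulrN mulrC.
apply: cmeasM.
  apply: cmeas_real.
  exact: (measurableT_comp (@measurable_powR R (-1)) (measurable_funX 2 mn)).
by split => //=; exact: measurableT_comp.
Qed.

Lemma cmeas_if D (b : T -> bool) g h : measurable D -> measurable_fun D b ->
  cmeas D g -> cmeas D h -> cmeas D (fun x => if b x then g x else h x).
Proof.
move=> mD mb [gR gI] [hR hI]; split.
  rewrite (_ : (fun x => _) = (fun x => if b x then complex.Re (g x) else complex.Re (h x))).
    by apply: measurable_fun_if => //; [exact: (measurable_funS mD (@subIsetl _ _ _) gR)|exact: (measurable_funS mD (@subIsetl _ _ _) hR)].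
  by apply/funext => x; case: ifP.
rewrite (_ : (fun x => _) = (fun x => if b x then complex.Im (g x) else complex.Im (h x))).
  by apply: measurable_fun_if => //; [exact: (measurable_funS mD (@subIsetl _ _ _) gI)|exact: (measurable_funS mD (@subIsetl _ _ _) hI)].
by apply/funext => x; case: ifP.
Qed.

End ComplexMeasurability.

Lemma cmeasT_comp {R : realType} {d d' : measure_display} {T : measurableType d}
    {U : measurableType d'} (D : set T) (g : U -> R[i]) (h : T -> U) :
  cmeas setT g -> measurable_fun D h -> cmeas D (g \o h).
Proof.
move=> [gR gI] mh; split.
  exact: (measurableT_comp gR mh).
exact: (measurableT_comp gI mh).
Qed.

Section ComplexIntegral.
Context {R : realType}.
Local Notation mu := (@lebesgue_measure R).
Implicit Types (D : set R) (g h : R -> R[i]).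

Lemma cintegrableP D g : measurable D -> cintegrable D g <->
  cmeas D g /\ (\int[mu]_(x in D) (normc (g x))%:E < +oo)%E.
Proof.
move=> mD; split=> [[iR iI]|[mg fg]].
  have mg : cmeas D g.
    by split; apply/measurable_EFinP; [exact: measurable_int iR|exact: measurable_int iI].
  split => //.
  have iRI : mu.-integrable D (EFin \o (fun x => `|complex.Re (g x)| + `|complex.Im (g x)|)).
    have iR' := @integrable_norm _ _ _ mu D (fun x => complex.Re (g x)) iR.
    have iI' := @integrable_norm _ _ _ mu D (fun x => complex.Im (g x)) iI.
    by apply: (eq_integrable _ _ _ _ (integrableD _ iR' iI')) => // x _.
  have /integrableP[_] := iRI; apply: le_lt_trans; apply: ge0_le_integral => //.
  - by move=> x _; rewrite lee_fin normc_ge0.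
  - by apply/measurable_EFinP; exact: measurable_normc.
  - by apply: measurableT_comp => //; exact: measurable_int iRI.
  - by move=> x _; rewrite lee_fin (le_trans (normc_le_ReIm _))// ler_norm.
have iN : mu.-integrable D (EFin \o (fun x => normc (g x))).
  apply/integrableP; split; first by apply/measurable_EFinP; exact: measurable_normc.
  by under eq_integral do rewrite /= ger0_norm ?normc_ge0//.
case: mg => mR mI; split.
  apply: (le_integrable _ _ _ iN) => //; first exact/measurable_EFinP.
  by move=> x _; rewrite /= lee_fin [leRHS]ger0_norm ?normc_ge0// Re_le_normc.
apply: (le_integrable _ _ _ iN) => //; first exact/measurable_EFinP.
by move=> x _; rewrite /= lee_fin [leRHS]ger0_norm ?normc_ge0// Im_le_normc.
Qed.

Lemma cintegrable_le D g (h : R -> R) : measurable D -> cmeas D g ->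
  mu.-integrable D (EFin \o h) -> (forall x, D x -> normc (g x) <= h x) ->
  cintegrable D g.
Proof.
move=> mD mg ih gh; apply/cintegrableP => //; split => //.
have /integrableP[_] := ih; apply: le_lt_trans; apply: ge0_le_integral => //.
- by move=> x _; rewrite lee_fin normc_ge0.
- by apply/measurable_EFinP; exact: measurable_normc.
- by apply: measurableT_comp => //; exact: measurable_int ih.
- by move=> x Dx; rewrite lee_fin (le_trans (gh _ Dx))// ler_norm.
Qed.

Lemma eq_cintegral D g h : {in D, g =1 h} -> cintegral D g = cintegral D h.
Proof.
move=> gh; rewrite /cintegral; congr (_ +i* _); apply: eq_Rintegral => x xD;
  by rewrite gh.
Qed.

Lemma eq_cintegrable D g h : measurable D -> {in D, g =1 h} -> cintegrable D g ->
  cintegrable D h.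
Proof.
move=> mD gh [iR iI]; split.
  by apply: eq_integrable iR => // x xD; rewrite gh.
by apply: eq_integrable iI => // x xD; rewrite gh.
Qed.

Lemma cintegrableZ D c g : measurable D -> cintegrable D g ->
  cintegrable D (fun x => c * g x).
Proof.
move=> mD [iR iI]; split.
  under eq_fun do rewrite ReM EFinB !EFinM.
  by apply: integrableB => //; exact: integrableZl.
under eq_fun do rewrite ImM EFinD !EFinM.
by apply: integrableD => //; exact: integrableZl.
Qed.

Lemma cintegralZ D c g : measurable D -> cintegrable D g ->
  cintegral D (fun x => c * g x) = c * cintegral D g.
Proof.
move=> mD [iR iI]; rewrite /cintegral.
have iZ r (k : R -> R) : mu.-integrable D (EFin \o k) ->
    mu.-integrable D (EFin \o (fun x => r * k x)).
  by move=> ik; apply: (@integrableZl _ _ _ _ _ _ r _ ik).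
have e1 : (\int[mu]_(x in D) complex.Re (c * g x))%R =
   complex.Re c * (\int[mu]_(x in D) complex.Re (g x))%R -
   complex.Im c * (\int[mu]_(x in D) complex.Im (g x))%R.
  rewrite -!RintegralZl// -RintegralB//; [|exact: iZ|exact: iZ].
  by apply: eq_Rintegral => x _; rewrite ReM.
have e2 : (\int[mu]_(x in D) complex.Im (c * g x))%R =
   complex.Re c * (\int[mu]_(x in D) complex.Im (g x))%R +
   complex.Im c * (\int[mu]_(x in D) complex.Re (g x))%R.
  rewrite -!RintegralZl// -RintegralD//; [|exact: iZ|exact: iZ].
  by apply: eq_Rintegral => x _; rewrite ImM.
by apply: ReIm_eq; rewrite ?ReM ?ImM /= ?e1 ?e2.
Qed.

Lemma cintegrableD D g h : measurable D -> cintegrable D g -> cintegrable D h ->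
  cintegrable D (fun x => g x + h x).
Proof.
move=> mD [gR gI] [hR hI]; split.
  by under eq_fun do rewrite raddfD/= EFinD; exact: integrableD.
by under eq_fun do rewrite raddfD/= EFinD; exact: integrableD.
Qed.

Lemma cintegralD D g h : measurable D -> cintegrable D g -> cintegrable D h ->
  cintegral D (fun x => g x + h x) = cintegral D g + cintegral D h.
Proof.
move=> mD [gR gI] [hR hI].
apply: ReIm_eq; rewrite raddfD /= -RintegralD//; apply: eq_Rintegral => x _;
  by rewrite raddfD.
Qed.

Lemma cintegral0 D : cintegral D (fun=> 0) = 0.
Proof. by rewrite /cintegral /Rintegral integral0. Qed.

Lemma cintegrable0 D : measurable D -> cintegrable D (fun=> 0).
Proof. by move=> mD; split; exact: integrable0. Qed.

Lemma cintegrable_sum D (I : Type) (s : seq I) (P : pred I) (g : I -> R -> R[i]) :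
  measurable D -> (forall i, P i -> cintegrable D (g i)) ->
  cintegrable D (fun x => \sum_(i <- s | P i) g i x).
Proof.
move=> mD ig; elim: s => [|i s IH].
  by under eq_fun do rewrite big_nil; exact: cintegrable0.
under eq_fun do rewrite big_cons.
by case Pi: (P i) => //; apply: cintegrableD => //; exact: ig.
Qed.

Lemma cintegral_sum D (I : Type) (s : seq I) (P : pred I) (g : I -> R -> R[i]) :
  measurable D -> (forall i, P i -> cintegrable D (g i)) ->
  cintegral D (fun x => \sum_(i <- s | P i) g i x) =
  \sum_(i <- s | P i) cintegral D (g i).
Proof.
move=> mD ig; elim: s => [|i s IH].
  by under eq_fun do rewrite big_nil; rewrite big_nil cintegral0.
under eq_fun do rewrite big_cons.
rewrite big_cons; case Pi: (P i) => //.
by rewrite cintegralD ?IH//; [exact: ig|exact: cintegrable_sum].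
Qed.

(** Each component is at most the integral of the modulus, and adding the two gives the factor 2. It
    reappears in the bounds for Beta, for [rho] and for [frac]. *)
Lemma normc_cintegral D g : measurable D -> cintegrable D g ->
  normc (cintegral D g) <= 2 * fine (\int[mu]_(x in D) (normc (g x))%:E).
Proof.
move=> mD ig; have [mg fg] := (cintegrableP g mD).1 ig.
have iN : mu.-integrable D (EFin \o (fun x => normc (g x))).
  apply/integrableP; split; first by apply/measurable_EFinP; exact: measurable_normc.
  by under eq_integral do rewrite /= ger0_norm ?normc_ge0//.
case: ig => iR iI.
rewrite (le_trans (normc_le_ReIm _))//= mulr_natl mulr2n lerD//.
  rewrite (le_trans (le_normr_Rintegral _ iR))//.
  apply: le_Rintegral => // [|x _]; last exact: Re_le_normc.
  exact: integrable_norm.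
rewrite (le_trans (le_normr_Rintegral _ iI))//.
apply: le_Rintegral => // [|x _]; last exact: Im_le_normc.
exact: integrable_norm.
Qed.

Lemma cdominated D (u : nat -> R -> R[i]) g (h : R -> R) : measurable D ->
  (forall n, cmeas D (u n)) -> (forall x, D x -> cto (u ^~ x) (g x)) ->
  mu.-integrable D (EFin \o h) ->
  (forall n x, D x -> normc (u n x) <= h x) ->
  cintegrable D g /\ cto (fun n => cintegral D (u n)) (cintegral D g).
Proof.
move=> mD mu_ ug ih uh.
have mg : cmeas D g := cmeas_cvg mu_ ug.
have key (p : R[i] -> R) : (forall n, measurable_fun D (fun x => p (u n x))) ->
    measurable_fun D (fun x => p (g x)) ->
    (forall x, D x -> p (u n x) @[n --> \oo] --> p (g x)) ->
    (forall z, `|p z| <= normc z) ->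
    mu.-integrable D (fun x => (p (g x))%:E) /\
    (\int[mu]_(x in D) p (u n x))%R @[n --> \oo] --> (\int[mu]_(x in D) p (g x))%R.
  move=> mpu mpg pug pn.
  have p1 n : measurable_fun D (fun x => (p (u n x))%:E) by exact/measurable_EFinP.
  have p2 : measurable_fun D (fun x => (p (g x))%:E) by exact/measurable_EFinP.
  have p3 : {ae mu, forall x, D x -> (p (u n x))%:E @[n --> \oo] --> (p (g x))%:E}.
    by apply: aeW => x Dx; apply: cvg_EFin; [exact: nearW|exact: pug].
  have p4 : {ae mu, forall x n, D x -> `|(p (u n x))%:E| <= (h x)%:E}%E.
    by apply: aeW => x n Dx; rewrite /= lee_fin (le_trans (pn _))// uh.
  have [i1 _ i2] := @dominated_convergence _ _ _ mu D mD _ _ (EFin \o h) p1 p2 p3 ih p4.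
  by split => //; apply: fine_cvg; rewrite fineK//; exact: integrable_fin_num.
have [i1 c1] := key (@complex.Re R) (fun n => (mu_ n).1) mg.1
  (fun x Dx => (ug x Dx).1) (@Re_le_normc R).
have [i2 c2] := key (@complex.Im R) (fun n => (mu_ n).2) mg.2
  (fun x Dx => (ug x Dx).2) (@Im_le_normc R).
by split.
Qed.

Lemma cintegral_mkcond D g :
  cintegral D g = cintegral setT (fun x => if x \in D then g x else 0).
Proof.
rewrite /cintegral; congr (_ +i* _); rewrite [LHS]Rintegral_mkcond;
  by apply: eq_Rintegral => x _; rewrite /patch; case: ifP.
Qed.

Lemma cintegrable_mkcond D g : measurable D ->
  cintegrable D g <-> cintegrable setT (fun x => if x \in D then g x else 0).
Proof.
move=> mD; rewrite /cintegrable.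
have h (p : R[i] -> R) : p 0 = 0 ->
    (fun u => (p (if u \in D then g u else 0))%:E) = (fun u => (p (g u))%:E) \_ D.
  by move=> p0; apply/funext => x; rewrite /patch; case: ifP => //; rewrite p0.
have k (f : R -> \bar R) : mu.-integrable D f <-> mu.-integrable setT (f \_ D).
  exact: integrable_mkcond.
rewrite !h//; split => -[h1 h2]; split.
- exact: (k _).1 h1.
- exact: (k _).1 h2.
- exact: (k _).2 h1.
- exact: (k _).2 h2.
Qed.

Lemma cintegrableS D E g : measurable D -> measurable E -> D `<=` E ->
  cintegrable E g -> cintegrable D g.
Proof.
move=> mD mE DE [h1 h2]; split.
  by apply: integrableS h1.
by apply: integrableS h2.
Qed.

End ComplexIntegral.

(** * Affine substitution and Fubini's theorem on the line *)

Section AffineChange.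
Context {R : realType}.
Local Notation mu := (@lebesgue_measure R).
Variables (a b : R).
Hypothesis a0 : 0 < a.

Let phi (x : measurableTypeR R) : measurableTypeR R := a * (x : R) + b.

Let mphi : measurable_fun [set: measurableTypeR R] phi.
Proof. by apply: measurable_funD => //; exact: measurable_funM. Qed.

Let pf : {measure set (measurableTypeR R) -> \bar R} :=
  measure_function_pushforward__canonical__measure_function_Measure mu mphi.

Let nu : {measure set (measurableTypeR R) -> \bar R} := mscale (NngNum (ltW a0)) pf.

(** The image of Lebesgue measure under x -> a x + b, scaled by a, gives every half-open interval
    its length, and only Lebesgue measure does so. *)
Lemma lebesgue_affine (A : set (measurableTypeR R)) : measurable A -> mu A = nu A.
Proof.
apply: lebesgue_measure_unique => _ [[x y] _ <-] /=.
rewrite /nu /mscale /= /pushforward.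
rewrite (_ : _ @^-1` _ = `](x - b) / a, (y - b) / a]%classic); last first.
  apply/seteqP; split => z /=; rewrite /phi !in_itv/=;
    by rewrite ltr_pdivrMr// ler_pdivlMr// ltrBlDr lerBrDr (mulrC z).
rewrite !lebesgue_measure_itv/= !lte_fin ltr_pM2r ?invr_gt0// ltrD2r.
case: ifPn => _; last by rewrite mule0.
rewrite -EFinB -EFinM; congr EFin; field; exact: lt0r_neq0.
Qed.

Lemma ge0_integral_affine (f : R -> \bar R) : measurable_fun setT f ->
  (forall x, 0 <= f x)%E ->
  (\int[mu]_x f x = a%:E * \int[mu]_x f (a * x + b)%R)%E.
Proof.
move=> mf f0; rewrite (eq_measure_integral nu); last first.
  by move=> A mA _; exact: lebesgue_affine.
rewrite ge0_integral_mscale//=; congr (_ * _)%E.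
apply: (@ge0_integral_pushforward _ _ _ _ _ _ mphi mu setT f) => //.
Qed.

Lemma integral_affine (f : R -> \bar R) : measurable_fun setT f ->
  (\int[mu]_x f x = a%:E * \int[mu]_x f (a * x + b)%R)%E.
Proof.
move=> mf; rewrite integralE [in RHS]integralE.
have mp : measurable_fun setT (f^\+)%E by exact: measurable_funepos.
have mn : measurable_fun setT (f^\-)%E by exact: measurable_funeneg.
rewrite (ge0_integral_affine mp)// (ge0_integral_affine mn)//.
have ep : (\int[mu]_x f^\+ (a * x + b)%R =
    \int[mu]_x (fun x => f (a * x + b)%R)^\+ x)%E by rewrite unlock.
have en : (\int[mu]_x f^\- (a * x + b)%R =
    \int[mu]_x (fun x => f (a * x + b)%R)^\- x)%E by rewrite unlock.
(* Both parts may be infinite: distributivity over the difference survives in the extended reals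
   because a is finite and positive. *)
have aux (p q : \bar R) : (0 <= p -> 0 <= q ->
    a%:E * p - a%:E * q = a%:E * (p - q))%E.
  move: p q => [p| |] [q| |] // _ _.
  - exact: (congr1 EFin (esym (mulrBr a p q))).
  - by rewrite gt0_muley ?lte_fin//= gt0_muleNy ?lte_fin.
  - by rewrite gt0_muley ?lte_fin.
  - by rewrite gt0_muley ?lte_fin//= gt0_muleNy ?lte_fin.
by rewrite ep en; apply: aux; exact: integral_ge0.
Qed.

End AffineChange.

Section ComplexAffineChange.
Context {R : realType}.
Variables (a b : R).
Hypothesis a0 : 0 < a.

Lemma cintegral_affine (g : R -> R[i]) : cmeas setT g ->
  cintegral setT g = a%:C * cintegral setT (fun x => g (a * x + b)).
Proof.
move=> [mR mI]; have aE (p : R -> R) : measurable_fun setT p ->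
    (\int[lebesgue_measure]_x p x)%R = a * (\int[lebesgue_measure]_x p (a * x + b))%R.
  move=> mp; have mp' : measurable_fun setT (EFin \o p) by exact/measurable_EFinP.
  rewrite /Rintegral [in LHS](integral_affine b a0 mp').
  (* [fine] sends an infinite integral to 0 on both sides alike, so the identity covers the
     divergent case. *)
  case: (integral _ _ _) => //= [|]; first by rewrite gt0_muley ?lte_fin//= mulr0.
  by rewrite gt0_muleNy ?lte_fin//= mulr0.
apply: ReIm_eq; rewrite ?Re_rM ?Im_rM /=; exact: aE.
Qed.

Lemma cintegrable_affine (g : R -> R[i]) : cintegrable setT g <->
  cintegrable setT (fun x => g (a * x + b)).
Proof.
have lin (a' b' : R) : measurable_fun setT (fun x : R => a' * x + b').
  by apply: measurable_funD => //; exact: measurable_funM.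
have mE : cmeas setT g <-> cmeas setT (fun x => g (a * x + b)).
  split=> mg; first exact: (cmeasT_comp mg (lin a b)).
  have := cmeasT_comp mg (lin a^-1 (- b / a)).
  apply: cmeas_eq => x _ /=; congr g; field; exact: lt0r_neq0.
have aE : cmeas setT g ->
   (\int[lebesgue_measure]_x (normc (g x))%:E =
    a%:E * \int[lebesgue_measure]_x (normc (g (a * x + b)))%:E)%E.
  move=> mg; apply: ge0_integral_affine => //.
  - by apply/measurable_EFinP; exact: measurable_normc.
  - by move=> x; rewrite lee_fin normc_ge0.
split=> /cintegrableP => /(_ measurableT) [mg fg]; apply/cintegrableP => //.
  split; first exact/mE.
  move: fg; rewrite aE//; set I := integral _ _ _; have : (0 <= I)%E.
    by apply: integral_ge0 => x _; rewrite lee_fin normc_ge0.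
  case: I => [r _ _| |]//=; first exact: ltry.
  by rewrite gt0_muley ?lte_fin.
split; first exact/mE.
rewrite aE; last exact/mE.
move: fg; set I := integral _ _ _; have : (0 <= I)%E.
  by apply: integral_ge0 => x _; rewrite lee_fin normc_ge0.
by case: I => [r _ _| |]//=; exact: ltry.
Qed.

End ComplexAffineChange.

Section ComplexFubini.
Context {R : realType}.
Local Notation mu := (@lebesgue_measure R).
Variable F : R -> R -> R[i].
Hypothesis mF : cmeas setT (fun xy : R * R => F xy.1 xy.2).
Hypothesis fin : (\int[mu]_x \int[mu]_y (normc (F x y))%:E < +oo)%E.

Let mN : measurable_fun setT (fun xy : R * R => (normc (F xy.1 xy.2))%:E).
Proof. by apply/measurable_EFinP; exact: measurable_normc mF. Qed.

Let integrable_comp (p : R[i] -> R) :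
  measurable_fun setT (fun xy : R * R => p (F xy.1 xy.2)) ->
  (forall z, `|p z| <= normc z) ->
  (mu \x mu)%E.-integrable setT (fun xy : R * R => (p (F xy.1 xy.2))%:E).
Proof.
move=> mp pn.
have mp' : measurable_fun setT (fun xy : R * R => (p (F xy.1 xy.2))%:E).
  exact/measurable_EFinP.
apply/integrable12ltyP => //.
apply: le_lt_trans fin; apply: ge0_le_integral => //.
- by move=> x _; apply: integral_ge0.
- apply: (@measurable_fun_fubini_tonelli_F _ _ _ _ _ mu
    (fun xy : R * R => `|(p (F xy.1 xy.2))%:E|%E)) => //.
  exact: measurableT_comp.
- apply: (@measurable_fun_fubini_tonelli_F _ _ _ _ _ mu (fun xy : R * R => (normc (F xy.1 xy.2))%:E)) => //.
  by move=> x; rewrite lee_fin normc_ge0.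
- move=> x _; apply: ge0_le_integral => //.
  + apply: measurableT_comp => //; exact: (measurableT_comp mp' (measurable_pair1 x)).
  + exact: (measurableT_comp mN (measurable_pair1 x)).
  + by move=> y _; rewrite /= lee_fin pn.
Qed.

(** Integrability of every slice, and not only of almost every one, lets [fine] be undone at each
    point, so the real-valued iterated integrals are those of the extended-valued theorem. *)
Lemma cFubini : (forall x, cintegrable setT (F x)) ->
  (forall y, cintegrable setT (F ^~ y)) ->
  cintegrable setT (fun x => cintegral setT (F x)) /\
  cintegral setT (fun x => cintegral setT (F x)) =
  cintegral setT (fun y => cintegral setT (F ^~ y)).
Proof.
move=> iF iF'.
have key (p : R[i] -> R) :
    (mu \x mu)%E.-integrable setT (fun xy : R * R => (p (F xy.1 xy.2))%:E) ->
    (forall x, mu.-integrable setT (fun y => (p (F x y))%:E)) ->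
    (forall y, mu.-integrable setT (fun x => (p (F x y))%:E)) ->
    mu.-integrable setT (fun x => (\int[mu]_y p (F x y))%:E) /\
    (\int[mu]_x (\int[mu]_y p (F x y)))%R = (\int[mu]_y (\int[mu]_x p (F x y)))%R.
  move=> ip i1 i2.
  have E1 x : ((\int[mu]_y p (F x y))%:E = \int[mu]_y (p (F x y))%:E)%E.
    by rewrite fineK//; exact: integrable_fin_num.
  have E2 y : ((\int[mu]_x p (F x y))%:E = \int[mu]_x (p (F x y))%:E)%E.
    by rewrite fineK//; exact: integrable_fin_num.
  split.
    under eq_fun do rewrite E1.
    exact: (integrable_fubini_F ip).
  rewrite [LHS]/Rintegral [RHS]/Rintegral; congr fine.
  under eq_integral do rewrite E1.
  under [in RHS]eq_integral do rewrite E2.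
  exact: (Fubini ip).
have [k1 k2] := key (@complex.Re R) (integrable_comp mF.1 (@Re_le_normc R))
  (fun x => (iF x).1) (fun y => (iF' y).1).
have [k3 k4] := key (@complex.Im R) (integrable_comp mF.2 (@Im_le_normc R))
  (fun x => (iF x).2) (fun y => (iF' y).2).
by split => //; rewrite /cintegral/= k2 k4.
Qed.

End ComplexFubini.

(** * Complex powers and their integrals on (0, 1] *)

Section ComplexPower.
Context {R : realType}.
Implicit Types (s t : R) (z w : R[i]).

Lemma normc_cis (x : R) : normc (cos x +i* sin x) = 1.
Proof. by rewrite /= cos2Dsin2 sqrtr1. Qed.

Lemma normc_cpow s z : normc (cpow s z) = s `^ complex.Re z.
Proof. by rewrite normcM normc_cis mulr1 normc_real ger0_norm// powR_ge0. Qed.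

Lemma cpowD s z w : 0 < s -> cpow s (z + w) = cpow s z * cpow s w.
Proof.
move=> s0; rewrite /cpow !raddfD/= mulrDl cosD sinD powRD; last by apply/implyP => _; rewrite gt_eqF.
by apply: ReIm_eq; rewrite ?ReM ?ImM/=; ring.
Qed.

Lemma cpow0 s : cpow s 0 = 1.
Proof. by rewrite /cpow /= powRr0 mul0r cos0 sin0 mul1r. Qed.

Lemma cpow1 z : cpow 1 z = 1.
Proof. by rewrite /cpow /= powR1 ln1 mulr0 cos0 sin0 mul1r. Qed.

Lemma cpowM s t z : 0 < s -> 0 < t -> cpow (s * t) z = cpow s z * cpow t z.
Proof.
move=> s0 t0; rewrite /cpow lnM ?posrE// mulrDr cosD sinD powRM ?ltW//.
by apply: ReIm_eq; rewrite ?ReM ?ImM/=; ring.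
Qed.

Lemma cpowXn s z k : 0 < s -> cpow s z ^+ k = cpow s (z * k%:R).
Proof.
move=> s0; elim: k => [|k IH]; first by rewrite expr0 mulr0 cpow0.
by rewrite exprSr IH -cpowD// -[X in _ + X]mulr1 -mulrDr -natr1.
Qed.

Lemma cpow_neq0 s z : 0 < s -> cpow s z != 0.
Proof. by move=> s0; rewrite -normc_eq0 normc_cpow gt_eqF// powR_gt0. Qed.

Lemma cpow_real1 s : 0 < s -> cpow s 1 = s%:C.
Proof. by move=> s0; rewrite /cpow /= powRr1 ?ltW// mul0r cos0 sin0 mulr1. Qed.

Lemma cmeas_cpow z : cmeas setT (fun s : R => cpow s z).
Proof.
apply: cmeasM; first by apply: cmeas_real; exact: measurable_powR.
have ml : measurable_fun setT (fun s : R => complex.Im z * ln s).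
  by apply: measurable_funM => //; exact: measurable_ln.
split => /=.
  by apply: measurableT_comp => //; apply: continuous_measurable_fun; exact: continuous_cos.
by apply: measurableT_comp => //; apply: continuous_measurable_fun; exact: continuous_sin.
Qed.

(** The truncated power s_+^(z-1): thanks to the extension by zero, a convolution over (0, t)
    becomes an integral over the whole line. *)
Definition pw z s : R[i] := if 0 < s then cpow s (z - 1) else 0.
Definition pwr (x s : R) : R := if 0 < s then s `^ (x - 1) else 0.

Lemma normc_pw z s : normc (pw z s) = pwr (complex.Re z) s.
Proof.
rewrite /pw /pwr; case: ifP => _; last by rewrite normc0.
by rewrite normc_cpow raddfB.
Qed.

Lemma pwr_ge0 x s : 0 <= pwr x s.
Proof. by rewrite /pwr; case: ifP => // _; exact: powR_ge0. Qed.

Lemma measurable_pos : measurable_fun setT (fun s : R => 0 < s).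
Proof. exact: measurable_fun_ltr. Qed.

Lemma cmeas_pw z : cmeas setT (pw z).
Proof.
exact: (cmeas_if measurableT measurable_pos (cmeas_cpow (z - 1)) (cmeas_cst setT 0)).
Qed.

Lemma measurable_pwr x : measurable_fun setT (pwr x).
Proof.
have := measurable_normc (cmeas_pw x%:C).
by apply: eq_measurable_fun => s _; rewrite normc_pw.
Qed.

Lemma cGammaE z : cGamma z = cintegral setT (fun s => (expR (- s))%:C * pw z s).
Proof.
rewrite /cGamma cintegral_mkcond; apply: eq_cintegral => s _.
by rewrite mem_setE in_itv/= andbT /pw; case: ifP; rewrite ?mulr0.
Qed.

End ComplexPower.

Section PowerPrimitive.
Context {R : realType}.
Local Notation mu := (@lebesgue_measure R).
Variable z : R[i].
Local Notation x := (complex.Re z).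
Local Notation y := (complex.Im z).

(** For s > 0, [H] is Re(s^z) and [h] is its derivative Re(z s^(z-1)), spelled out in real functions
    for the fundamental theorem of calculus. *)
Let H (s : R) := expR (x * ln s) * cos (y * ln s).
Let h (s : R) := expR ((x - 1) * ln s) * (x * cos (y * ln s) - y * sin (y * ln s)).

Let is_derive_lin (c s : R) : 0 < s -> is_derive s 1 (fun s => c * ln s) (c / s).
Proof. by move=> s0; have := is_deriveZ c (is_derive1_ln s0). Qed.

Let is_derive_exp (c s : R) : 0 < s ->
  is_derive s 1 (fun s => expR (c * ln s)) (expR (c * ln s) * (c / s)).
Proof. by move=> s0; exact: (is_derive1_comp (is_derive_expR _) (is_derive_lin c s0)). Qed.

Let is_derive_cosl (c s : R) : 0 < s ->
  is_derive s 1 (fun s => cos (c * ln s)) (- sin (c * ln s) * (c / s)).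
Proof. by move=> s0; exact: (is_derive1_comp (is_derive_cos _) (is_derive_lin c s0)). Qed.

Let is_derive_sinl (c s : R) : 0 < s ->
  is_derive s 1 (fun s => sin (c * ln s)) (cos (c * ln s) * (c / s)).
Proof. by move=> s0; exact: (is_derive1_comp (is_derive_sin _) (is_derive_lin c s0)). Qed.

Let is_derive_H (s : R) : 0 < s -> is_derive s 1 H (h s).
Proof.
move=> s0; have d := is_deriveM (is_derive_exp x s0) (is_derive_cosl y s0).
apply: (is_derive_eq d); rewrite /h /GRing.scale/= mulrBl expRB mul1r lnK ?posrE//.
by field; exact: lt0r_neq0.
Qed.

Let continuous_h (s : R) : 0 < s -> {for s, continuous h}.
Proof.
move=> s0.
have d := is_deriveM (is_derive_exp (x - 1) s0)
  (is_deriveB (is_deriveZ x (is_derive_cosl y s0)) (is_deriveZ y (is_derive_sinl y s0))).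
apply/differentiable_continuous/derivable1_diffP.
exact: (@ex_derive _ _ _ _ _ _ _ d).
Qed.

Let continuous_H (s : R) : 0 < s -> {for s, continuous H}.
Proof.
move=> s0; apply/differentiable_continuous/derivable1_diffP.
exact: (@ex_derive _ _ _ _ _ _ _ (is_derive_H s0)).
Qed.

Let integral_h (e : R) : 0 < e -> e < 1 ->
  (\int[mu]_(s in `[e, 1%R]) (h s)%:E = (1 - H e)%:E)%E.
Proof.
move=> e0 e1.
have H1 : H 1 = 1 by rewrite /H ln1 !mulr0 expR0 cos0 mul1r.
rewrite -[X in (X - _)%:E]H1 EFinB; apply: (continuous_FTC2 e1).
- apply: continuous_in_subspaceT => s; rewrite mem_setE in_itv/= => /andP[es _].
  by apply: continuous_h; exact: lt_le_trans es.
- split.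
  + move=> s; rewrite in_itv/= => /andP[es _].
    exact: (@ex_derive _ _ _ _ _ _ _ (is_derive_H (lt_trans e0 es))).
  + by apply: cvg_at_right_filter; exact: continuous_H.
  + by apply: cvg_at_left_filter; exact: continuous_H.
- move=> s; rewrite in_itv/= => /andP[es _].
  have [_ <-] := is_derive_H (lt_trans e0 es).
  by rewrite derive1E.
Qed.

Let HE s : 0 < s -> H s = complex.Re (cpow s z).
Proof. by move=> s0; rewrite /cpow Re_rM /H /powR gt_eqF. Qed.

Let hE s : 0 < s -> h s = complex.Re (z * cpow s (z - 1)).
Proof.
move=> s0; rewrite ReM /cpow Re_rM Im_rM /h /powR gt_eqF//= !raddfB/= subr0.
ring.
Qed.

Lemma integral_Re_pow (e : R) : 0 < e -> e < 1 ->
  (\int[mu]_(s in `[e, 1%R]) (complex.Re (z * cpow s (z - 1)))%:E =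
   (1 - complex.Re (cpow e z))%:E)%E.
Proof.
move=> e0 e1; rewrite -HE// -integral_h//; apply: eq_integral => s.
by rewrite mem_setE in_itv/= => /andP[es _]; rewrite hE// (lt_le_trans e0 es).
Qed.

End PowerPrimitive.

Section PowerIntegral.
Context {R : realType}.
Local Notation mu := (@lebesgue_measure R).

(** The offset 2 keeps [e_ 0] strictly below 1, as the primitive formula on [e, 1] demands. *)
Let e_ (n : nat) : R := n.+2%:R^-1.

Let e_gt0 n : 0 < e_ n. Proof. by rewrite invr_gt0. Qed.

Let e_lt1 n : e_ n < 1. Proof. by rewrite invf_lt1// ltr1n. Qed.

Let e_cvg (x : R) : 0 < x -> e_ n `^ x @[n --> \oo] --> (0 : R).
Proof.
move=> x0; have := powR_cvg0 x0.
have eh : e_ n @[n --> \oo] --> (0:R).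
  have := @cvg_harmonic R; rewrite -cvg_shiftS; exact.
move/cvg_at_rightP; apply; split => //.
Qed.

(** On [eps, 1] the integral is (1 - eps^x)/x <= 1/x; the intervals [[e_ n], 1] increase to (0, 1],
    and monotone convergence keeps the bound. *)
Lemma integral_pow_lty (x : R) : 0 < x ->
  (\int[mu]_(s in `]0%R, 1%R]) (s `^ (x - 1))%:E < +oo)%E.
Proof.
move=> x0.
pose F n := `[e_ n, 1]%classic.
have FU : \bigcup_n F n = `]0, 1]%classic.
  apply/seteqP; split=> [s [n _]|s]; rewrite /F/= !in_itv/= => /andP[s0 s1].
    by rewrite (lt_le_trans (e_gt0 n) s0) s1.
  exists (Num.trunc s^-1) => //=; rewrite in_itv/= s1 andbT /e_.
  rewrite invf_ple ?posrE// ltW// (lt_trans (truncnS_gt _))// ltr_nat.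
  by [].
have mp : measurable_fun (`]0, 1]%classic : set R) (fun s : R => (s `^ (x - 1))%:E).
  by apply/measurable_EFinP; apply: measurable_funTS; exact: measurable_powR.
have Fb n : (\int[mu]_(s in F n) (s `^ (x - 1))%:E <= (x^-1)%:E)%E.
  have mFn : measurable_fun (F n) (fun s : R => (s `^ (x - 1))%:E).
    apply: measurable_funS mp => //; rewrite -FU; exact: bigcup_sup.
  have E : (\int[mu]_(s in F n) (x%:E * (s `^ (x - 1))%:E) = (1 - e_ n `^ x)%:E)%E.
    have <- : complex.Re (cpow (e_ n) x%:C) = e_ n `^ x.
      by rewrite Re_rM /= mul0r cos0 mulr1.
    rewrite -(integral_Re_pow x%:C (e_gt0 n) (e_lt1 n)); apply: eq_integral => s _.
    by rewrite -EFinM Re_rM /cpow Re_rM /= subr0 mul0r cos0 mulr1.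
  rewrite -[(x^-1)%:E]mule1 lee_pdivlMl// -ge0_integralZl//.
  + rewrite E; change ((1 - e_ n `^ x)%:E <= 1%:E)%E.
    by rewrite lee_fin gerBl powR_ge0.
  + exact: measurable_itv.
  + by move=> s _; rewrite lee_fin powR_ge0.
  + by rewrite lee_fin ltW.
rewrite -FU; apply: (@le_lt_trans _ _ (x^-1)%:E); last exact: ltry.
have ndF : nondecreasing_seq F.
  move=> m n mn; apply/subsetPset => s; rewrite /F/= !in_itv/= => /andP[ms ->].
  by rewrite andbT (le_trans _ ms)// lef_pV2 ?posrE// ler_nat !ltnS.
have c : (\int[mu]_(s in F n) (s `^ (x - 1))%:E @[n --> \oo] -->
    \int[mu]_(s in \bigcup_n F n) (s `^ (x - 1))%:E)%E.
  apply: ge0_nondecreasing_set_cvg_integral => //.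
  - by move=> i; exact: measurable_itv.
  - by move=> i; apply: measurable_funS mp => //; rewrite -FU; exact: bigcup_sup.
  - by move=> i s _; rewrite lee_fin powR_ge0.
by apply: (cvge_le _ c); exact: nearW.
Qed.

Lemma cintegrable_pow (z : R[i]) : 0 < complex.Re z ->
  cintegrable `]0, 1] (fun s : R => cpow s (z - 1)).
Proof.
move=> z0; apply/cintegrableP => //; split.
  by apply: cmeasS (cmeas_cpow (z - 1)).
under eq_integral do rewrite normc_cpow raddfB/=.
exact: integral_pow_lty.
Qed.

(** Over [eps, 1] the real part is 1 - Re(eps^z), and |eps^z| = eps^(Re z) tends to 0. The real part
    alone already shows that B(1, z) is nonzero. *)
Lemma Re_integral_pow (z : R[i]) : 0 < complex.Re z ->
  complex.Re (z * cintegral `]0, 1] (fun s : R => cpow s (z - 1))) = 1.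
Proof.
move=> z0; have iz := cintegrable_pow z0.
have mD : measurable (`]0, 1]%classic : set R) by exact: measurable_itv.
pose u n (s : R) : R[i] := if e_ n <= s then z * cpow s (z - 1) else 0.
have iZ := cintegrableZ z mD iz.
have [mZ nZ] := (cintegrableP _ mD).1 iZ.
have nearD s : 0 < s -> \forall n \near \oo, e_ n <= s.
  move=> s0; exists (Num.trunc s^-1) => // n /= sn; rewrite /e_.
  by rewrite invf_ple ?posrE// ltW// (lt_le_trans (truncnS_gt _))// ler_nat !ltnS ltnW.
have [_ [uR _]] : cintegrable `]0, 1] (fun s : R => z * cpow s (z - 1)) /\
    cto (fun n => cintegral `]0, 1] (u n)) (cintegral `]0, 1] (fun s : R => z * cpow s (z - 1))).
  apply: (cdominated (h := fun s => normc (z * cpow s (z - 1)))) => //.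
  - move=> n; have mb : measurable_fun (`]0, 1]%classic : set R) (fun s : R => e_ n <= s).
      exact: measurable_fun_ler.
    exact: (cmeas_if mD mb mZ (cmeas_cst _ 0)).
  - move=> s /=; rewrite in_itv/= => /andP[s0 s1].
    by split; apply: cvg_near_cst; have := nearD s s0; apply: filterS => n;
      rewrite /u => ->.
  - apply/integrableP; split; first by apply/measurable_EFinP; exact: measurable_normc.
    by under eq_integral do rewrite /= ger0_norm ?normc_ge0//.
  - by move=> n s _; rewrite /u; case: ifP => // _; rewrite normc0 normc_ge0.
rewrite -cintegralZ//.
have uE n : complex.Re (cintegral `]0, 1] (u n)) = 1 - complex.Re (cpow (e_ n) z).
  rewrite /= /Rintegral -[RHS]/(fine (_%:E)) -(integral_Re_pow z (e_gt0 n) (e_lt1 n)).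
  rewrite (_ : `[e_ n, 1]%classic = `]0, 1]%classic `&` `[e_ n, 1]%classic); last first.
    apply/seteqP; split=> s /=; rewrite !in_itv/=; last by case=> _.
    by move=> /andP[es s1]; rewrite es s1 (lt_le_trans (e_gt0 n) es).
  rewrite integral_mkcondr; congr fine; apply: eq_integral => s.
  rewrite mem_setE in_itv/= => /andP[s0 s1].
  by rewrite patchE mem_setE in_itv/= s1 andbT /u; case: ifP.
have c1 : complex.Re (cintegral `]0, 1] (u n)) @[n --> \oo] --> (1 : R).
  under eq_fun do rewrite uE.
  have c0 : complex.Re (cpow (e_ n) z) @[n --> \oo] --> (0 : R).
    apply/norm_cvg0P; apply: squeeze_cvgr (e_cvg z0); last exact: cvg_cst.
    near=> n; apply/andP; split; first exact: normr_ge0.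
    by rewrite -normc_cpow; exact: Re_le_normc.
  have c := cvgB (cvg_cst (1 : R)) c0.
  rewrite subr0 in c; exact: c.
exact: (cvg_unique _ uR c1).
Unshelve. all: by end_near. Qed.

End PowerIntegral.

(** * The real Gamma integral: finiteness and growth *)

Section GammaIntegral.
Context {R : realType}.
Local Notation mu := (@lebesgue_measure R).
Implicit Types x y s t q : R.

Definition gamI x : \bar R := (\int[mu]_s (expR (- s) * pwr x s)%:E)%E.

Lemma measurable_expRN : measurable_fun setT (fun s : R => expR (- s)).
Proof. exact: measurableT_comp. Qed.

Lemma measurable_gam x : measurable_fun setT (fun s : R => expR (- s) * pwr x s).
Proof. by apply: measurable_funM; [exact: measurable_expRN|exact: measurable_pwr]. Qed.

Lemma gam_ge0 x s : 0 <= expR (- s) * pwr x s.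
Proof. by rewrite mulr_ge0 ?expR_ge0 ?pwr_ge0. Qed.

Lemma gamI_ge0 x : (0 <= gamI x)%E.
Proof. by apply: integral_ge0 => s _; rewrite lee_fin gam_ge0. Qed.

(** With n = trunc(x) + 1, s^(x-1) <= s^n <= n! 2^n e^(s/2), which leaves e^(-s/2). One further
    factor 2 offsets the 1/2 in the exponential density of rate 1/2. *)
Let expo_bound x s : 1 < s -> expR (- s) * s `^ (x - 1) <=
  ((Num.trunc x).+1`!%:R * 2 ^+ (Num.trunc x).+2) * exponential_pdf 2^-1 s.
Proof.
move=> s1; have s0 : 0 < s by apply: lt_trans s1.
set n := (Num.trunc x).+1.
have px : s `^ (x - 1) <= s ^+ n.
  rewrite -powR_mulrn ?(ltW s0)// ler_powR ?(ltW s1)//.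
  by rewrite lerBlDr ltW// (lt_le_trans (truncnS_gt _))// lerDl.
have ex : (s / 2) ^+ n / n`!%:R <= expR (s / 2).
  have := @expR_ge1Dxn R (s / 2) (Num.trunc x) _; rewrite divr_ge0 ?(ltW s0)// => /(_ isT).
  by apply: le_trans; rewrite lerDr.
rewrite exponential_pdfE ?(ltW s0)//.
have -> : expR (- s) = expR (- 2^-1 * s) * expR (- (s / 2)).
  by rewrite -expRD; congr expR; field.
have e2 : expR (- (s / 2)) * s ^+ n <= n`!%:R * 2 ^+ n.
  have f0 : n`!%:R != 0 :> R by rewrite pnatr_eq0 -lt0n fact_gt0.
  have p0 : 2 ^+ n != 0 :> R by rewrite expf_neq0// pnatr_eq0.
  rewrite expRN mulrC ler_pdivrMr ?expR_gt0//.
  rewrite [leLHS](_ : _ = n`!%:R * 2 ^+ n * ((s / 2) ^+ n / n`!%:R)); last first.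
    by rewrite expr_div_n; field; rewrite p0 f0.
  by rewrite ler_pM2l// mulr_gt0 ?ltr0n ?fact_gt0 ?exprn_gt0.
rewrite [leRHS](_ : _ = expR (- 2^-1 * s) * (n`!%:R * 2 ^+ n)); last first.
  by rewrite exprS; field.
rewrite -mulrA ler_pM2l ?expR_gt0//; apply: le_trans e2.
by rewrite ler_pM2l ?expR_gt0.
Qed.

Lemma gamI_lty x : 0 < x -> (gamI x < +oo)%E.
Proof.
move=> x0.
pose c : R := (Num.trunc x).+1`!%:R * 2 ^+ (Num.trunc x).+2.
have c0 : 0 <= c by rewrite mulr_ge0 ?exprn_ge0.
pose p := (fun s : R => s `^ (x - 1)) \_ `]0, 1]%classic.
have mp : measurable_fun setT p.
  apply: (measurable_restrictT _ _).1 => //; apply: measurable_funTS.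
  exact: (@measurable_powR R (x - 1)).
have p_ge0 s : 0 <= p s by rewrite /p patchE; case: ifP => // _; exact: powR_ge0.
apply: (@le_lt_trans _ _ (\int[mu]_s ((p s)%:E + (c * exponential_pdf 2^-1 s)%:E))%E).
  apply: ge0_le_integral => //.
  - by move=> s _; rewrite lee_fin gam_ge0.
  - by apply/measurable_EFinP; exact: measurable_gam.
  - apply: emeasurable_funD; first exact/measurable_EFinP.
    apply/measurable_EFinP; apply: measurable_funM => //.
    exact: measurable_exponential_pdf.
  - move=> s _; rewrite -EFinD lee_fin /pwr.
    have d0 : 0 <= c * exponential_pdf 2^-1 s by rewrite mulr_ge0 ?exponential_pdf_ge0.
    have p0 := p_ge0 s.
    case: ifPn => s0; last by rewrite mulr0 addr_ge0.
    rewrite /p patchE mem_setE in_itv/= s0; case: (leP s 1) => s1.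
      rewrite (@le_trans _ _ (s `^ (x - 1)))// ?lerDl//.
      by rewrite ler_piMl ?powR_ge0// -expR0 ler_expR lerNl oppr0 ltW.
    by rewrite add0r; exact: expo_bound.
rewrite ge0_integralD//; last 4 first.
- by move=> s _; rewrite lee_fin.
- exact/measurable_EFinP.
- by move=> s _; rewrite lee_fin mulr_ge0 ?exponential_pdf_ge0.
- apply/measurable_EFinP; apply: measurable_funM => //.
  exact: measurable_exponential_pdf.
apply: lte_add_pinfty.
  apply: le_lt_trans (integral_pow_lty x0); rewrite [leRHS]integral_mkcond.
  by rewrite le_eqVlt; apply/orP; left; apply/eqP; apply: eq_integral => s _;
    rewrite /p !patchE; case: ifP.
under eq_integral do rewrite EFinM.
rewrite ge0_integralZl//.
- by rewrite integral_exponential_pdf// mule1 ltry.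
- by apply/measurable_EFinP; exact: measurable_exponential_pdf.
- by move=> s _; rewrite lee_fin exponential_pdf_ge0.
Qed.

Lemma gamI_fin x : 0 < x -> gamI x \is a fin_num.
Proof. by move=> x0; rewrite ge0_fin_numE ?gamI_ge0// gamI_lty. Qed.

(** Euler's integral is restricted to [q, q+1], where e^(-s) >= e^(-(q+1)) and s^(x-1) >= q^x/(q+1).
    As q is arbitrary and the constant is independent of x, Gamma outgrows every geometric rate. *)
Lemma gamI_lower q : 1 <= q -> exists2 c : R, 0 < c &
  forall x, 0 < x -> ((c * q `^ x)%:E <= gamI x)%E.
Proof.
move=> q1; have q0 : 0 < q by apply: lt_le_trans q1.
exists (expR (- (q + 1)) / (q + 1)); first by rewrite divr_gt0 ?expR_gt0// addr_gt0.
move=> x x0.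
pose D : set R := `[q, q + 1]%classic.
pose k := expR (- (q + 1)) / (q + 1) * q `^ x.
have k0 : 0 <= k by rewrite mulr_ge0 ?powR_ge0// divr_ge0 ?expR_ge0// addr_ge0 ?ltW.
have muD : mu D = 1%E.
  by rewrite lebesgue_measure_itv/= lte_fin ltrDl ltr01 -EFinD addrC addKr.
have -> : k%:E = (\int[mu]_(s in D) k%:E)%E.
  transitivity (k%:E * mu D)%E; first by rewrite muD mule1.
  by apply/esym; apply: integral_cst; exact: measurable_itv.
apply: (@le_trans _ _ (\int[mu]_(s in D) (expR (- s) * pwr x s)%:E)%E).
  apply: ge0_le_integral => //.
  - exact: measurable_itv.
  - by apply/measurable_EFinP; apply: measurable_funTS; exact: measurable_gam.
  - move=> s; rewrite /D/= in_itv/= => /andP[qs sq].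
    have s0 : 0 < s by apply: lt_le_trans qs.
    rewrite lee_fin /pwr s0 /k -mulrA ler_pM ?expR_ge0 ?mulr_ge0 ?invr_ge0 ?powR_ge0//.
    + by rewrite addr_ge0 ?ltW.
    + by rewrite ler_expR lerN2.
    + have -> : s `^ (x - 1) = s `^ x / s.
        by rewrite powRB ?powRr1 ?(ltW s0)//; apply/implyP => _; rewrite gt_eqF.
      rewrite mulrC ler_pM ?powR_ge0 ?invr_ge0//.
      * by rewrite addr_ge0 ?ltW.
      * by apply: ge0_ler_powR; rewrite ?nnegrE ?(ltW x0) ?(ltW q0) ?(ltW s0).
      * by rewrite lef_pV2 ?posrE// addr_gt0.
apply: ge0_subset_integral => //.
- exact: measurable_itv.
- by apply/measurable_EFinP; exact: measurable_gam.
- by move=> s _; rewrite lee_fin gam_ge0.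
Qed.

Lemma gamI_gt0 x : 0 < x -> (0 < gamI x)%E.
Proof.
move=> x0; have [c c0 /(_ x x0)] := gamI_lower (lexx 1).
by apply: lt_le_trans; rewrite lte_fin mulr_gt0 ?powR_gt0.
Qed.

Definition gamr x : R := fine (gamI x).

Lemma gamrE x : 0 < x -> gamI x = (gamr x)%:E.
Proof. by move=> x0; rewrite fineK ?gamI_fin. Qed.

Lemma gamr_gt0 x : 0 < x -> 0 < gamr x.
Proof. by move=> x0; rewrite -lte_fin -gamrE// gamI_gt0. Qed.

Lemma gamr_lower q : 1 <= q -> exists2 c : R, 0 < c &
  forall x, 0 < x -> c * q `^ x <= gamr x.
Proof.
move=> /gamI_lower[c c0 h]; exists c => // x x0.
by rewrite -lee_fin -gamrE// h.
Qed.

End GammaIntegral.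

(** * The Beta function and its relation to Gamma *)

Section Tonelli.
Context {R : realType}.
Local Notation mu := (@lebesgue_measure R).

Lemma tonelliR (f : R * R -> \bar R) : measurable_fun setT f ->
  (forall p, 0 <= f p)%E ->
  (\int[mu]_x \int[mu]_y f (x, y) = \int[mu]_y \int[mu]_x f (x, y))%E.
Proof. by move=> mf f0; exact: (@fubini_tonelli _ _ _ _ _ mu mu f mf f0). Qed.

Lemma measurable_sub12 : measurable_fun setT (fun p : R * R => p.1 - p.2).
Proof. exact: measurable_funB. Qed.

Lemma integral_shift (f : R -> \bar R) (b : R) : measurable_fun setT f ->
  (forall s, 0 <= f s)%E -> (\int[mu]_s f s = \int[mu]_s f (s - b)%R)%E.
Proof.
move=> mf f0; rewrite (ge0_integral_affine (- b) ltr01 mf f0) mul1e.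
by apply: eq_integral => s _; rewrite mul1r.
Qed.

Lemma ge0_integralMl (k : R) (g : R -> R) : measurable_fun setT g ->
  (forall s, 0 <= g s) -> 0 <= k ->
  (\int[mu]_s (k * g s)%:E = k%:E * \int[mu]_s (g s)%:E)%E.
Proof.
move=> mg g0 k0; under eq_integral do rewrite EFinM.
rewrite ge0_integralZl//; first exact/measurable_EFinP.
by move=> s _; rewrite lee_fin.
Qed.

Lemma ge0_integralMe (k : \bar R) (g : R -> R) : measurable_fun setT g ->
  (forall s, 0 <= g s) -> (0 <= k)%E ->
  (\int[mu]_s (k * (g s)%:E) = k * \int[mu]_s (g s)%:E)%E.
Proof.
move=> mg g0 k0.
rewrite ge0_integralZl//; first exact/measurable_EFinP.
by move=> s _; rewrite lee_fin.
Qed.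

Lemma cintegral_shift (g : R -> R[i]) (b : R) : cmeas setT g ->
  cintegral setT g = cintegral setT (fun s => g (s - b)).
Proof.
move=> mg; rewrite (cintegral_affine (- b) ltr01 mg) mul1r.
by apply: eq_cintegral => s _; rewrite mul1r.
Qed.

End Tonelli.

Section Beta.
Context {R : realType}.
Local Notation mu := (@lebesgue_measure R).
Implicit Types (x y s t : R) (z w : R[i]).

Definition betI x y : \bar R := (\int[mu]_v (pwr x (1 - v) * pwr y v)%:E)%E.

Lemma pwr_scale x t s : 0 < t -> pwr x (t * s) = t `^ (x - 1) * pwr x s.
Proof.
move=> t0; rewrite /pwr pmulr_rgt0//; case: ifP => s0; last by rewrite mulr0.
by rewrite powRM ?ltW.
Qed.

Lemma pw_scale z t s : 0 < t -> pw z (t * s) = cpow t (z - 1) * pw z s.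
Proof.
move=> t0; rewrite /pw pmulr_rgt0//; case: ifP => s0; last by rewrite mulr0.
by rewrite cpowM.
Qed.

Lemma measurable_pwr_conv x y t :
  measurable_fun setT (fun v : R => pwr x (t - v) * pwr y v).
Proof.
apply: measurable_funM; last exact: measurable_pwr.
apply: (measurableT_comp (measurable_pwr x)).
by apply: measurable_funB.
Qed.

Lemma cmeas_pw_conv z w t : cmeas setT (fun v : R => pw z (t - v) * pw w v).
Proof.
apply: cmeasM; last exact: cmeas_pw.
apply: (cmeasT_comp (cmeas_pw z)).
by apply: measurable_funB.
Qed.

Lemma pwr_conv_ge0 x y t v : 0 <= pwr x (t - v) * pwr y v.
Proof. by rewrite mulr_ge0 ?pwr_ge0. Qed.

Let pw_sub0 z w t v : t <= 0 -> pw z (t - v) * pw w v = 0.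
Proof.
move=> t0; rewrite /pw; case: ifP; last by rewrite mul0r.
case: ifP; last by rewrite mulr0.
by move=> v0; rewrite subr_gt0 => /(lt_trans v0); rewrite ltNge t0.
Qed.

(** Homogeneity: the substitution v = t v' moves the integral to (0, 1) and releases t^(x+y-1). For
    t <= 0 the two truncated powers have disjoint supports. *)
Lemma pwr_conv x y t :
  (\int[mu]_v (pwr x (t - v) * pwr y v)%:E = (pwr (x + y) t)%:E * betI x y)%E.
Proof.
have [t0|t0] := leP t 0.
  rewrite [X in (_ = X * _)%E](_ : _ = 0%E) ?mul0e; last first.
    by rewrite /pwr ltNge t0.
  apply: integral0_eq => v _; congr EFin; have := pw_sub0 x%:C y%:C v t0.
  by move=> /(congr1 (@normc R)); rewrite normcM !normc_pw normc0.
rewrite (ge0_integral_affine 0 t0); last 2 first.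
- by apply/measurable_EFinP; exact: measurable_pwr_conv.
- by move=> v; rewrite lee_fin pwr_conv_ge0.
have mc : measurable_fun setT (fun v => pwr x (t - (t * v + 0)) * pwr y (t * v + 0)).
  apply: (measurableT_comp (measurable_pwr_conv x y t)).
  by apply: measurable_funD => //; exact: measurable_funM.
have tD r s : t `^ (r + s) = t `^ r * t `^ s.
  by rewrite powRD//; apply/implyP => _; rewrite gt_eqF.
transitivity (\int[mu]_v (t * (pwr x (t - (t * v + 0)) * pwr y (t * v + 0)))%:E)%E.
  apply/esym; apply: (ge0_integralMl mc); last exact: ltW.
  by move=> v; exact: pwr_conv_ge0.
transitivity (\int[mu]_v (pwr (x + y) t * (pwr x (1 - v) * pwr y v))%:E)%E; last first.
  apply: (ge0_integralMl (measurable_pwr_conv x y 1)); last exact: pwr_ge0.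
  by move=> v; exact: pwr_conv_ge0.
apply: eq_integral => v _; rewrite addr0; congr EFin.
have -> : t - t * v = t * (1 - v) by ring.
rewrite !pwr_scale// /pwr t0.
have -> : x + y - 1 = 1 + (x - 1) + (y - 1) by ring.
by rewrite !tD powRr1 ?(ltW t0)//; ring.
Qed.

Lemma betI_ge0 x y : (0 <= betI x y)%E.
Proof. by apply: integral_ge0 => v _; rewrite lee_fin pwr_conv_ge0. Qed.

Lemma gam_shift x b :
  (\int[mu]_s (expR (- s) * pwr x (s - b))%:E = (expR (- b))%:E * gamI x)%E.
Proof.
transitivity (\int[mu]_s (expR (- b) * (expR (- s) * pwr x s))%:E)%E; last first.
  exact: (ge0_integralMl (measurable_gam x) (@gam_ge0 _ x) (expR_ge0 _)).
rewrite [RHS](integral_shift b).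
- apply: eq_integral => s _; rewrite mulrA -expRD; congr (expR _ * _)%:E; ring.
- by apply/measurable_EFinP; apply: measurable_funM => //; exact: measurable_gam.
- by move=> s; rewrite lee_fin mulr_ge0 ?expR_ge0// gam_ge0.
Qed.

Let measurable_F x y : measurable_fun setT
  (fun p : R * R => (expR (- p.1) * (pwr x (p.1 - p.2) * pwr y p.2))%:E).
Proof.
apply/measurable_EFinP; apply: measurable_funM.
  by apply: (measurableT_comp measurable_expRN).
apply: measurable_funM.
  by apply: (measurableT_comp (measurable_pwr x)); exact: measurable_sub12.
by apply: (measurableT_comp (measurable_pwr y)).
Qed.

(** Integrate e^(-t) (t-v)_+^(x-1) v_+^(y-1) in both orders: v first gives Gamma(x+y) B(x, y), t
    first gives Gamma(x) Gamma(y). The identity lives in the extended reals, so the finiteness of B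
    can be deduced from it. *)
Lemma gamI_betI x y : (gamI x * gamI y = gamI (x + y) * betI x y)%E.
Proof.
have F0 p : (0 <= (expR (- p.1) * (pwr x (p.1 - p.2) * pwr y p.2))%:E)%E.
  by rewrite lee_fin mulr_ge0 ?expR_ge0// mulr_ge0 ?pwr_ge0.
have T := tonelliR (measurable_F x y) F0.
have E1 : (\int[mu]_t \int[mu]_v (expR (- t) * (pwr x (t - v) * pwr y v))%:E =
    gamI (x + y) * betI x y)%E.
  transitivity (\int[mu]_t (betI x y * (expR (- t) * pwr (x + y) t)%:E))%E; last first.
    rewrite muleC; exact: (ge0_integralMe (measurable_gam _) (@gam_ge0 _ _) (betI_ge0 _ _)).
  apply: eq_integral => t _.
  transitivity ((expR (- t))%:E * \int[mu]_v (pwr x (t - v) * pwr y v)%:E)%E.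
    exact: (ge0_integralMl (measurable_pwr_conv x y t) (pwr_conv_ge0 x y t) (expR_ge0 _)).
  apply: etrans (congr1 (fun k => (expR (- t))%:E * k)%E (pwr_conv x y t)) _.
  by rewrite EFinM muleA muleC.
apply/esym; apply: etrans (etrans (esym E1) T) _; apply/esym.
transitivity (\int[mu]_v (gamI x * (expR (- v) * pwr y v)%:E))%E.
  apply/esym; exact: (ge0_integralMe (measurable_gam _) (@gam_ge0 _ _) (gamI_ge0 _)).
apply: eq_integral => v _.
transitivity (\int[mu]_t (pwr y v * (expR (- t) * pwr x (t - v)))%:E)%E; last first.
  by apply: eq_integral => t _; congr EFin; ring.
have mg : measurable_fun setT (fun t => expR (- t) * pwr x (t - v)).
  apply: measurable_funM; first exact: measurable_expRN.
  by apply: (measurableT_comp (measurable_pwr x)); exact: measurable_funB.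
have g0 t : 0 <= expR (- t) * pwr x (t - v) by rewrite mulr_ge0 ?expR_ge0 ?pwr_ge0.
apply: etrans (esym (ge0_integralMl mg g0 (pwr_ge0 y v))).
by rewrite gam_shift muleA -EFinM (mulrC (pwr y v)) muleC.
Qed.

Lemma betI_lty x y : 0 < x -> 0 < y -> (betI x y < +oo)%E.
Proof.
move=> x0 y0; have := gamI_betI x y; have := betI_ge0 x y.
rewrite !gamrE ?addr_gt0//; case: (betI x y) => [r _ _| _|]//=; first exact: ltry.
by rewrite gt0_muley ?lte_fin ?gamr_gt0 ?addr_gt0.
Qed.

Definition betr x y : R := fine (betI x y).

Lemma betrE x y : 0 < x -> 0 < y -> betI x y = (betr x y)%:E.
Proof. by move=> x0 y0; rewrite fineK// ge0_fin_numE ?betI_ge0 ?betI_lty. Qed.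

Lemma betr_ge0 x y : 0 <= betr x y.
Proof. by rewrite fine_ge0// betI_ge0. Qed.

Lemma gamr_betr x y : 0 < x -> 0 < y -> gamr x * gamr y = gamr (x + y) * betr x y.
Proof.
move=> x0 y0; have := gamI_betI x y.
by rewrite betrE// !gamrE ?addr_gt0// -!EFinM => -[].
Qed.

Definition bet z w := cintegral setT (fun v => pw z (1 - v) * pw w v).

Lemma cintegrable_pw_conv z w t : 0 < complex.Re z -> 0 < complex.Re w ->
  cintegrable setT (fun v => pw z (t - v) * pw w v).
Proof.
move=> z0 w0; apply/cintegrableP => //; split; first exact: cmeas_pw_conv.
under eq_integral do rewrite normcM !normc_pw.
apply: (@le_lt_trans _ _ ((pwr (complex.Re z + complex.Re w) t)%:E *
   betI (complex.Re z) (complex.Re w))%E).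
  by rewrite -pwr_conv.
by rewrite betrE// -EFinM ltry.
Qed.

Lemma pw_conv z w t : 0 < complex.Re z -> 0 < complex.Re w ->
  cintegral setT (fun v => pw z (t - v) * pw w v) = pw (z + w) t * bet z w.
Proof.
move=> z0 w0; have [t0|t0] := leP t 0.
  rewrite [X in _ = X * _](_ : _ = 0) ?mul0r; last by rewrite /pw ltNge t0.
  by rewrite -[RHS](cintegral0 setT); apply: eq_cintegral => v _; exact: pw_sub0.
rewrite (cintegral_affine 0 t0); last exact: cmeas_pw_conv.
have -> : cintegral setT (fun v => pw z (t - (t * v + 0)) * pw w (t * v + 0)) =
   cintegral setT (fun v => cpow t (z - 1) * cpow t (w - 1) * (pw z (1 - v) * pw w v)).
  apply: eq_cintegral => v _; rewrite addr0.
  have -> : t - t * v = t * (1 - v) by ring.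
  rewrite !pw_scale//.
  by rewrite mulrACA.
rewrite cintegralZ//; last exact: cintegrable_pw_conv.
rewrite mulrA; congr (_ * _); rewrite /pw t0 -cpow_real1// -!cpowD//; congr cpow.
ring.
Qed.

Lemma normc_bet z w : 0 < complex.Re z -> 0 < complex.Re w ->
  normc (bet z w) <= 2 * betr (complex.Re z) (complex.Re w).
Proof.
move=> z0 w0; apply: le_trans (normc_cintegral _ _) _ => //.
  exact: cintegrable_pw_conv.
by under eq_integral do rewrite normcM !normc_pw.
Qed.

Lemma cintegrable_gam z b : 0 < complex.Re z ->
  cintegrable setT (fun s => (expR (- s))%:C * pw z (s - b)).
Proof.
move=> z0; apply/cintegrableP => //; split.
  apply: cmeasM; first by apply: cmeas_real; exact: measurable_expRN.
  by apply: (cmeasT_comp (cmeas_pw z)); exact: measurable_funB.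
under eq_integral do rewrite normcM normc_pw normc_real (ger0_norm (expR_ge0 _)).
by rewrite gam_shift gamrE// -EFinM ltry.
Qed.

Lemma cintegrable_gam0 z : 0 < complex.Re z ->
  cintegrable setT (fun s : R => (expR (- s))%:C * pw z s).
Proof.
move=> z0; have := cintegrable_gam 0 z0; apply: eq_cintegrable => // s _.
by rewrite subr0.
Qed.

Lemma cgam_shift z b : 0 < complex.Re z ->
  cintegral setT (fun s => (expR (- s))%:C * pw z (s - b)) = (expR (- b))%:C * cGamma z.
Proof.
move=> z0; have i0 := cintegrable_gam0 z0.
have [m0 _] := (cintegrableP _ measurableT).1 i0.
rewrite cGammaE -cintegralZ// [RHS](cintegral_shift b); last first.
  exact: cmeasM (cmeas_cst _ _) m0.
apply: eq_cintegral => s _; rewrite mulrA -rmorphM -expRD; congr ((expR _)%:C * _).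
ring.
Qed.

(** The same double integral with complex exponents; its absolute version is the real one at Re z
    and Re w, which provides the finiteness for Fubini. *)
Lemma cGamma_bet z w : 0 < complex.Re z -> 0 < complex.Re w ->
  cGamma z * cGamma w = cGamma (z + w) * bet z w.
Proof.
move=> z0 w0; have zw0 : 0 < complex.Re (z + w) by rewrite raddfD addr_gt0.
pose F (t v : R) : R[i] := (expR (- t))%:C * (pw z (t - v) * pw w v).
have mF : cmeas setT (fun p : R * R => F p.1 p.2).
  apply: cmeasM.
    apply: cmeas_real; exact: (measurableT_comp measurable_expRN).
  apply: cmeasM; last exact: (cmeasT_comp (cmeas_pw w)).
  by apply: (cmeasT_comp (cmeas_pw z)); exact: measurable_sub12.
have i1 t : cintegrable setT (F t).
  by apply: cintegrableZ => //; exact: cintegrable_pw_conv.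
have i2 v : cintegrable setT (F ^~ v).
  have := cintegrableZ (pw w v) measurableT (cintegrable_gam v z0).
  by apply: eq_cintegrable => // t _; rewrite /F; ring.
have fin : (\int[mu]_t \int[mu]_v (normc (F t v))%:E < +oo)%E.
  set x := complex.Re z; set y := complex.Re w.
  suff -> : (\int[mu]_t \int[mu]_v (normc (F t v))%:E = gamI (x + y) * betI x y)%E.
    by rewrite gamrE ?addr_gt0// betrE// -EFinM ltry.
  transitivity (\int[mu]_t (betI x y * (expR (- t) * pwr (x + y) t)%:E))%E; last first.
    rewrite muleC; exact: (ge0_integralMe (measurable_gam _) (@gam_ge0 _ _) (betI_ge0 _ _)).
  apply: eq_integral => t _.
  transitivity (\int[mu]_v (expR (- t) * (pwr x (t - v) * pwr y v))%:E)%E.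
    apply: eq_integral => v _.
    by rewrite !normcM !normc_pw normc_real (ger0_norm (expR_ge0 _)).
  transitivity ((expR (- t))%:E * \int[mu]_v (pwr x (t - v) * pwr y v)%:E)%E.
    exact: (ge0_integralMl (measurable_pwr_conv x y t) (pwr_conv_ge0 x y t) (expR_ge0 _)).
  apply: etrans (congr1 (fun k => (expR (- t))%:E * k)%E (pwr_conv x y t)) _.
  by rewrite EFinM muleA muleC.
have [_ T] := cFubini mF fin i1 i2.
have E1 : cintegral setT (fun t => cintegral setT (F t)) = cGamma (z + w) * bet z w.
  transitivity (cintegral setT (fun t : R => bet z w * ((expR (- t))%:C * pw (z + w) t))).
    apply: eq_cintegral => t _.
    apply: etrans (cintegralZ (expR (- t))%:C measurableT (cintegrable_pw_conv t z0 w0)) _.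
    by rewrite (pw_conv t z0 w0) mulrA mulrC.
  apply: etrans (cintegralZ (bet z w) measurableT (cintegrable_gam0 zw0)) _.
  by rewrite -cGammaE mulrC.
have E2 : cintegral setT (fun v => cintegral setT (F ^~ v)) = cGamma z * cGamma w.
  transitivity (cintegral setT (fun v : R => cGamma z * ((expR (- v))%:C * pw w v))).
    apply: eq_cintegral => v _.
    transitivity (cintegral setT (fun t => pw w v * ((expR (- t))%:C * pw z (t - v)))).
      by apply: eq_cintegral => t _; rewrite /F; ring.
    apply: etrans (cintegralZ (pw w v) measurableT (cintegrable_gam v z0)) _.
    rewrite (cgam_shift v z0); move: (cGamma z) (pw w v) (expR (- v))%:C => G p e.
    by rewrite mulrC mulrAC mulrC.
  apply: etrans (cintegralZ (cGamma z) measurableT (cintegrable_gam0 w0)) _.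
  by rewrite -cGammaE.
exact: etrans (esym E2) (etrans (esym T) E1).
Qed.

End Beta.

Opaque gamr gamI cGamma.

(** * Nonvanishing of Gamma in the right half-plane *)

Section GammaNonzero.
Context {R : realType}.
Local Notation mu := (@lebesgue_measure R).
Implicit Types (x y s t : R) (z w : R[i]).

Lemma bet1E z : 0 < complex.Re z ->
  bet 1 z = cintegral `]0, 1] (fun s : R => cpow s (z - 1)).
Proof.
move=> z0; have [iR iI] := cintegrable_pow z0.
have E : cintegral `]0, 1] (fun s : R => cpow s (z - 1)) =
    cintegral `]0, 1[ (fun s : R => cpow s (z - 1)).
  rewrite /cintegral; congr (_ +i* _); apply/esym; apply: Rintegral_itv_bndo_bndc.
    by apply: integrableS iR => //; apply: subset_itvl; rewrite bnd_simp.
  by apply: integrableS iI => //; apply: subset_itvl; rewrite bnd_simp.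
rewrite E cintegral_mkcond; apply: eq_cintegral => s _.
rewrite mem_setE in_itv/= /pw subr_gt0 subrr cpow0.
by case: ifP => s1; case: ifP => s0; rewrite ?andbF ?mul0r ?mulr0 ?mul1r.
Qed.

Lemma Re_bet1 z : 0 < complex.Re z -> complex.Re (z * bet 1 z) = 1.
Proof. by move=> z0; rewrite bet1E//; exact: Re_integral_pow. Qed.

Lemma pw_real x s : pw x%:C s = (pwr x s)%:C.
Proof.
rewrite /pw /pwr; case: ifP => // _.
by rewrite /cpow /= subr0 mul0r cos0 sin0 mulr1.
Qed.

Lemma betr1 x : 0 < x -> x * betr 1 x = 1.
Proof.
move=> x0; apply: etrans (@Re_bet1 x%:C x0); rewrite Re_rM; congr (_ * _).
rewrite /betr /betI /bet /= /Rintegral; congr fine; apply: eq_integral => s _.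
have -> : pw 1 (1 - s) = (pwr 1 (1 - s))%:C by exact: (pw_real 1).
by rewrite pw_real -rmorphM.
Qed.

(** From Gamma(1) Gamma(x) = Gamma(1+x) B(1, x) and x B(1, x) = 1. The constant Gamma(1) is carried
    along unevaluated and enters the point [M] of [cGamma_large]. *)
Lemma gamrS x : 0 < x -> gamr (x + 1) = gamr 1 * x * gamr x.
Proof.
move=> x0; have h := gamr_betr ltr01 x0; rewrite (addrC 1 x) in h.
by rewrite mulrAC h -mulrA (mulrC (betr _ _)) betr1// mulr1.
Qed.

Lemma cos_lower (t : R) : 1 - t ^+ 2 <= cos t.
Proof.
wlog t0 : t / 0 <= t.
  move=> h; have [/h//|/ltW t0] := leP 0 t.
  by rewrite -cosN -sqrrN; apply: h; rewrite oppr_ge0.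
have sin_le (u : R) : 0 <= u -> sin u <= u.
  move=> u0; have cs : {within `[0, u], continuous (@sin R)}.
    by apply: continuous_subspaceT => v; exact: continuous_sin.
  have [c _] := MVT_segment u0 (fun v _ => is_derive_sin v) cs.
  by rewrite sin0 !subr0 => ->; rewrite ler_piMl// cos_le1.
have cc : {within `[0, t], continuous (@cos R)}.
  by apply: continuous_subspaceT => v; exact: continuous_cos.
have [c] := MVT_segment t0 (fun v _ => is_derive_cos v) cc.
rewrite in_itv/= => /andP[c0 ct]; rewrite cos0 subr0 => e.
have := sin_le c c0; move: (sin c) e => sc e h.
have : sc * t <= t * t by rewrite ler_wpM2r// (le_trans h).
rewrite expr2; lra.
Qed.

(** With u = e^(2h) the right side is 4 (e^h - e^(-h))^2, so the claim is h <= e^h - e^(-h) for h >=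
    0. It trades a squared logarithm for powers of u, which Euler's integral turns into Gamma at
    neighbouring points. *)
Lemma sqr_ln_le (u : R) : 0 < u -> ln u ^+ 2 <= 4 * (u - 2 + u^-1).
Proof.
wlog u1 : u / 1 <= u => [h u0|u0].
  have [/h/(_ u0)//|/ltW u1] := leP 1 u.
  have := h u^-1; rewrite invf_ge1// => /(_ u1); rewrite invr_gt0 => /(_ u0).
  by rewrite lnV ?posrE// sqrrN invrK; lra.
have [h [h0 ->]] : exists h : R, 0 <= h /\ u = expR h ^+ 2.
  exists (ln u / 2); split; first by rewrite divr_ge0// ln_ge0.
  by rewrite -expRM_natl mulrC divfK// lnK ?posrE.
rewrite -expRM_natl expRK expRM_natl.
have e1 : 1 + h <= expR h by exact: expR_ge1Dx.
have e0 := expR_gt0 h.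
set e := expR h in e0 e1 *.
have ei : e^-1 <= 1 by rewrite invf_le1//; lra.
have -> : e ^+ 2 - 2 + (e ^+ 2)^-1 = (e - e^-1) ^+ 2.
  by field; exact: lt0r_neq0.
have d : h <= e - e^-1 by lra.
have -> : (2 * h) ^+ 2 = 4 * h ^+ 2 by ring.
by rewrite ler_pM2l// ler_sqr ?nnegrE// (le_trans h0).
Qed.

Lemma integrable_gam x : 0 < x ->
  mu.-integrable setT (EFin \o (fun s => expR (- s) * pwr x s)).
Proof.
move=> x0; apply/integrableP; split; first by apply/measurable_EFinP; exact: measurable_gam.
under eq_integral do rewrite /= ger0_norm ?gam_ge0//.
exact: gamI_lty.
Qed.

(** After rotation by M^(-iy) the integrand has real part e^(-s) s^(x-1) cos(y ln(s/M)), and the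
    cosine is at least 1 - k (s/M - 2 + M/s) with k = 4 y^2. The integral of this minorant combines
    Gamma at x+1, x and x-1, and equals Gamma(1) Gamma(x-1) (x - 1 - k) for the chosen M. *)
Lemma cGamma_large z : 4 * complex.Im z ^+ 2 + 1 < complex.Re z -> cGamma z != 0.
Proof.
set x := complex.Re z; set y := complex.Im z => xy.
have x1 : 1 < x by apply: le_lt_trans xy; rewrite lerDr mulr_ge0// sqr_ge0.
have x0 : 0 < x by apply: lt_trans x1.
have g0 : 0 < gamr (1 : R) := gamr_gt0 ltr01.
(* The phase is cancelled at s = x - 1, the peak of e^(-s) s^(x-1), up to the factor Gamma(1); this
   factor makes Gamma(x) = M Gamma(x-1). *)
pose M := gamr 1 * (x - 1).
have M0 : 0 < M by rewrite mulr_gt0// subr_gt0.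
pose k := 4 * y ^+ 2.
have k0 : 0 <= k by rewrite mulr_ge0// sqr_ge0.
pose kap : R[i] := cos (y * ln M) -i* sin (y * ln M).
pose G x' s := expR (- s) * pwr x' s.
pose L s := - (k / M) * G (x + 1) s + ((1 + 2 * k) * G x s + - (k * M) * G (x - 1) s).
have x10 : 0 < x - 1 by rewrite subr_gt0.
have xp : 0 < x + 1 by rewrite addr_gt0.
have iZ c x' : 0 < x' -> mu.-integrable setT (EFin \o (fun s => c * G x' s)).
  by move=> h; apply: (@integrableZl _ _ _ _ _ _ c _ (integrable_gam h)).
have iL2 : mu.-integrable setT
    (EFin \o (fun s => (1 + 2 * k) * G x s + - (k * M) * G (x - 1) s)).
  apply: (eq_integrable _ _ _ _ (integrableD _ (iZ (1 + 2 * k) _ x0) (iZ (- (k * M)) _ x10))) => //.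
have iL : mu.-integrable setT (EFin \o L).
  by apply: (eq_integrable _ _ _ _ (integrableD _ (iZ (- (k / M)) _ xp) iL2)) => // s _.
have RL : (\int[mu]_s L s)%R =
   - (k / M) * gamr (x + 1) + ((1 + 2 * k) * gamr x + - (k * M) * gamr (x - 1)).
  rewrite [LHS]RintegralD//; last exact: iZ.
  rewrite [X in _ + X]RintegralD//; try exact: iZ.
  by rewrite !RintegralZl//; exact: integrable_gam.
have Lpos : 0 < (\int[mu]_s L s)%R.
  have gx : gamr x = gamr 1 * (x - 1) * gamr (x - 1) by rewrite -gamrS// subrK.
  have -> : (\int[mu]_s L s)%R = gamr 1 * gamr (x - 1) * (x - 1 - k).
    rewrite RL gamrS// gx /M; field; rewrite gt_eqF//= gt_eqF//.
  rewrite !mulr_gt0// ?gamr_gt0// subr_gt0.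
  by move: xy; rewrite /k; lra.
have iC : cintegrable setT (fun s => kap * ((expR (- s))%:C * pw z s)).
  by apply: cintegrableZ => //; exact: cintegrable_gam0.
apply: contraTneq Lpos => z0; rewrite -leNgt.
have <- : complex.Re (kap * cGamma z) = 0 by rewrite z0 mulr0.
rewrite cGammaE -(cintegralZ kap measurableT (cintegrable_gam0 x0)).
rewrite [leRHS]/=; apply: le_Rintegral => //; first exact: iC.1.
move=> s _; rewrite /L /G /pw /pwr; case: ifP => s0; last first.
  by rewrite !mulr0 !addr0.
have -> : complex.Re (kap * ((expR (- s))%:C * cpow s (z - 1))) =
    expR (- s) * s `^ (x - 1) * cos (y * ln s - y * ln M).
  have -> : cpow s (z - 1) = (s `^ (x - 1))%:C * (cos (y * ln s) +i* sin (y * ln s)).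
    by rewrite /cpow !raddfB/= subr0.
  rewrite /kap ReM !Re_rM !Im_rM cosB/=; ring.
have pd (r : R) : s `^ (r + 1) = s `^ r * s.
  by rewrite powRD ?powRr1 ?(ltW s0)//; apply/implyP => _; rewrite gt_eqF.
have -> : x + 1 - 1 = x - 1 + 1 by ring.
have e1 : s `^ (x - 1) = s `^ (x - 1 - 1) * s by rewrite -pd subrK.
rewrite [s `^ (x - 1 + 1)]pd.
have p0 := powR_ge0 s (x - 1 - 1).
have c := cos_lower (y * ln s - y * ln M).
have l : ln (s / M) ^+ 2 <= 4 * (s / M - 2 + (s / M)^-1) by apply: sqr_ln_le; exact: divr_gt0.
have c2 : 1 - k * (s / M - 2 + M / s) <= cos (y * ln s - y * ln M).
  apply: le_trans c; rewrite -mulrBr -ln_div ?posrE// exprMn lerD2l lerN2 /k.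
  rewrite invf_div in l.
  rewrite [leRHS](_ : _ = y ^+ 2 * (4 * (s / M - 2 + M / s))); last by ring.
  by rewrite ler_wpM2l// sqr_ge0.
apply: (@le_trans _ _ (expR (- s) * s `^ (x - 1) * (1 - k * (s / M - 2 + M / s)))); last first.
  by rewrite ler_wpM2l// mulr_ge0 ?expR_ge0 ?powR_ge0.
rewrite e1 le_eqVlt; apply/orP; left; apply/eqP; field.
by rewrite !gt_eqF.
Qed.

(** A zero at z spreads to every z + n through Gamma(1) Gamma(w) = Gamma(1+w) B(1, w) with B(1, w)
    nonzero. The imaginary part stays fixed while the real part grows, against [cGamma_large]. *)
Lemma cGamma_neq0 z : 0 < complex.Re z -> cGamma z != 0.
Proof.
move=> z0; apply/negP => /eqP gz.
have step n : cGamma (z + n%:R) = 0.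
  elim: n => [|n IH]; first by rewrite addr0.
  have zn : 0 < complex.Re (z + n%:R).
    rewrite raddfD/= ltr_pwDl// -(rmorph_nat (real_complex R)) /=; exact: ler0n.
  have r1 : 0 < complex.Re (1 : R[i]) by rewrite /=.
  have := cGamma_bet r1 zn; rewrite IH mulr0 => /esym/eqP.
  rewrite mulf_eq0 => /orP[/eqP g1|/eqP b0].
    by rewrite -natr1 addrA addrC.
  by have := Re_bet1 zn; rewrite b0 mulr0/= => /eqP; rewrite eq_sym oner_eq0.
pose n := (Num.trunc (4 * complex.Im z ^+ 2 + 1)).+1.
have := @cGamma_large (z + n%:R); rewrite step eqxx.
have -> : complex.Im (z + n%:R) = complex.Im z.
  by rewrite raddfD/= -(rmorph_nat (real_complex R))/= addr0.
have -> : complex.Re (z + n%:R) = complex.Re z + n%:R.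
  by rewrite raddfD/= -(rmorph_nat (real_complex R)).
suff h : 4 * complex.Im z ^+ 2 + 1 < complex.Re z + n%:R by move=> /(_ h).
by rewrite (lt_le_trans (truncnS_gt _))// lerDr ltW.
Qed.

End GammaNonzero.

Opaque bet betr betI.

(** * Kernels of fractional integrals *)

Section FractionalKernel.
Context {R : realType}.
Implicit Types (x y s t : R) (z w : R[i]).

(* The kernel s^(z-1) / Gamma(z) of the fractional integral of order z. It is 0
   for z = 0, where the operator is the identity. *)
Definition gk z s : R[i] := crGamma z * pw z s.

Lemma crGammaE z : 0 < complex.Re z -> crGamma z = (cGamma z)^-1.
Proof. by move=> z0; rewrite /crGamma; case: eqP z0 => // ->; rewrite /= ltxx. Qed.

Lemma gk0 s : gk 0 s = 0.
Proof. by rewrite /gk /crGamma eqxx mul0r. Qed.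

Lemma cmeas_gk z : cmeas setT (gk z).
Proof. by apply: cmeasM; [exact: cmeas_cst|exact: cmeas_pw]. Qed.

Lemma normc_gk z s : normc (gk z s) = normc (crGamma z) * pwr (complex.Re z) s.
Proof. by rewrite normcM normc_pw. Qed.

Lemma crGamma_neq0 z : 0 < complex.Re z -> crGamma z != 0.
Proof. by move=> z0; rewrite crGammaE// invr_eq0 cGamma_neq0. Qed.

Lemma crGammaD z w : 0 < complex.Re z -> 0 < complex.Re w ->
  crGamma z * crGamma w * bet z w = crGamma (z + w).
Proof.
move=> z0 w0; have zw0 : 0 < complex.Re (z + w) by rewrite raddfD addr_gt0.
rewrite !crGammaE// -invfM cGamma_bet//.
(* Cancelling B(z, w) is legitimate: its product with Gamma(z+w) is Gamma(z) Gamma(w), which is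
   nonzero. *)
have := cGamma_neq0 zw0; have : cGamma (z + w) * bet z w != 0.
  by rewrite -cGamma_bet// mulf_neq0 ?cGamma_neq0.
move: (cGamma _) (bet _ _) => G B; rewrite mulf_eq0 negb_or => /andP[G0 B0] _.
by rewrite invfM -mulrA mulVf// mulr1.
Qed.

Lemma cintegrable_gk_conv z w t : 0 < complex.Re z -> 0 < complex.Re w ->
  cintegrable setT (fun v => gk z (t - v) * gk w v).
Proof.
move=> z0 w0.
have := cintegrableZ (crGamma z * crGamma w) measurableT (cintegrable_pw_conv t z0 w0).
by apply: eq_cintegrable => // v _; rewrite /gk mulrACA.
Qed.

Lemma gk_conv z w t : 0 < complex.Re z -> 0 < complex.Re w ->
  cintegral setT (fun v => gk z (t - v) * gk w v) = gk (z + w) t.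
Proof.
move=> z0 w0.
transitivity (cintegral setT (fun v =>
    crGamma z * crGamma w * (pw z (t - v) * pw w v))).
  by apply: eq_cintegral => v _; rewrite /gk mulrACA.
apply: etrans (cintegralZ _ measurableT (cintegrable_pw_conv t z0 w0)) _.
rewrite (pw_conv t z0 w0) /gk -crGammaD//.
by move: (pw _ _) => p; rewrite mulrCA mulrC.
Qed.

(* Gamma(Re z) / |Gamma(z)|, which is submultiplicative up to a factor 2 by the
   Beta integral; this controls Gamma off the real axis. *)
Definition rho z : R := gamr (complex.Re z) * normc (crGamma z).

Lemma rho_ge0 z : 0 < complex.Re z -> 0 <= rho z.
Proof. by move=> z0; rewrite mulr_ge0 ?normc_ge0// ltW// gamr_gt0. Qed.

(** 1/Gamma(z+w) is B(z, w)/(Gamma(z) Gamma(w)); after |B(z, w)| <= 2 B(Re z, Re w) the real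
    identity cancels Gamma(Re z + Re w) and leaves the product of the two quotients. *)
Lemma rhoD z w : 0 < complex.Re z -> 0 < complex.Re w ->
  rho (z + w) <= 2 * rho z * rho w.
Proof.
move=> z0 w0; rewrite /rho -(crGammaD z0 w0) !normcM raddfD/=.
have h := normc_bet z0 w0.
have g := gamr_betr z0 w0.
have h' : gamr (complex.Re z + complex.Re w) * normc (bet z w) <=
    2 * (gamr (complex.Re z) * gamr (complex.Re w)).
  by rewrite g mulrCA ler_wpM2l// ltW// gamr_gt0// addr_gt0.
set A := gamr _; set B := normc (crGamma z); set C := normc (crGamma w).
rewrite [leLHS](_ : _ = A * normc (bet z w) * (B * C)); last by ring.
set G1 := gamr (complex.Re z); set G2 := gamr (complex.Re w).
rewrite [leRHS](_ : _ = 2 * (G1 * G2) * (B * C)); last by ring.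
by rewrite ler_wpM2r// mulr_ge0 ?normc_ge0.
Qed.

End FractionalKernel.

(** * Sums of orders and the uniform kernel estimate *)

Section Ladder.
Context {R : realType}.
Variables (n : nat) (nu : nat -> R[i]).
Hypothesis nu_gt0 : forall j : nat, (1 <= j <= n)%N -> 0 < complex.Re (nu j).

(* z is a sum of m of the orders nu_1, ..., nu_n *)
Fixpoint ladder (m : nat) (z : R[i]) : Prop :=
  if m is m'.+1 then
    exists z' j, [/\ ladder m' z', (1 <= j <= n)%N & z = z' + nu j]
  else z = 0.

Definition pwsum (s : R) : R := \sum_(1 <= j < n.+1) pwr (complex.Re (nu j)) s.

Lemma le_sum_nat (F : nat -> R) j : (forall i, (1 <= i <= n)%N -> 0 <= F i) ->
  (1 <= j <= n)%N -> F j <= \sum_(1 <= i < n.+1) F i.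
Proof.
move=> F0 /andP[j1 jn].
have A0 : 0 <= \sum_(1 <= i < j) F i.
  rewrite big_nat_cond; apply: sumr_ge0 => i /andP[/andP[i1 ij] _].
  by apply: F0; rewrite i1 (leq_trans (ltnW ij)).
have B0 : 0 <= \sum_(j.+1 <= i < n.+1) F i.
  rewrite big_nat_cond; apply: sumr_ge0 => i /andP[/andP[ji iN] _].
  by apply: F0; rewrite (leq_ltn_trans _ ji).
by rewrite (@big_cat_nat _ _ _ j)//= ?leqW// [X in _ + X]big_ltn// addrCA lerDl addr_ge0.
Qed.

Lemma pwsum_ge0 s : 0 <= pwsum s.
Proof. by apply: sumr_ge0 => j _; exact: pwr_ge0. Qed.

Lemma ladder_Re m z : ladder m.+1 z -> 0 < complex.Re z.
Proof.
elim: m z => [|m IH] z [z' [j [hz' hj ->]]].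
  by rewrite hz' add0r nu_gt0.
by rewrite raddfD; apply: addr_gt0; [exact: IH|exact: nu_gt0].
Qed.

Let xmin : exists2 x : R, 0 < x & forall j, (1 <= j <= n)%N -> x <= complex.Re (nu j).
Proof.
suff [x x0 h] : exists2 x : R, 0 < x &
    forall j, (j < n.+1)%N -> (1 <= j)%N -> x <= complex.Re (nu j).
  by exists x => // j /andP[j1 jn]; exact: h.
have : (n <= n)%N by [].
elim: {-2}n => [_|k IH kn]; first by exists 1 => // -[|].
have [x x0 h] := IH (ltnW kn).
exists (Num.min x (complex.Re (nu k.+1))); first by rewrite lt_min x0 nu_gt0.
move=> j; rewrite ltnS leq_eqVlt => /predU1P[->|jk] j1.
  by rewrite ge_min lexx orbT.
by rewrite ge_min h.
Qed.

(** Write 1/|Gamma(z)| as [rho z] / Gamma(Re z). Each of the m orders costs at most a factor 2 [R0]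
    in [rho] and a factor [D] in the power of s, and gains q^(-Re nu_j) <= [e] from Gamma(x) >= c
    q^x; the choice of [e] makes the product of the three at most [th]. *)
Lemma ladder_bound (T th : R) : 0 < T -> 0 < th ->
  exists2 C : R, 0 < C & forall m z s, ladder m z -> s <= T ->
    normc (gk z s) <= C * th ^+ m * pwsum s.
Proof.
move=> T0 th0.
pose R0 : R := 1 + \sum_(1 <= j < n.+1) rho (nu j).
have rn j : (1 <= j <= n)%N -> 0 <= rho (nu j) by move=> /nu_gt0; exact: rho_ge0.
have R0_ge j : (1 <= j <= n)%N -> rho (nu j) <= R0.
  by move=> jn; rewrite (le_trans (le_sum_nat rn jn))// lerDr.
have R00 : 0 < R0.
  by rewrite ltr_pwDl// big_nat_cond sumr_ge0// => j /andP[/andP[j1 jn] _]; rewrite rn// j1.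
pose D : R := 1 + \sum_(1 <= j < n.+1) T `^ (complex.Re (nu j)).
have D_ge j : (1 <= j <= n)%N -> T `^ (complex.Re (nu j)) <= D.
  move=> jn; rewrite /D (le_trans (le_sum_nat (F := fun j => T `^ complex.Re (nu j)) _ jn))// ?lerDr//.
  by move=> i _; exact: powR_ge0.
have D1 : 1 <= D by rewrite lerDl sumr_ge0// => j _; exact: powR_ge0.
have D0 : 0 < D by exact: lt_le_trans D1.
pose e : R := Num.min 1 (th / (2 * R0 * D)).
have e0 : 0 < e by rewrite lt_min ltr01 divr_gt0// !mulr_gt0.
have e1 : e <= 1 by rewrite ge_min lexx.
have eth : 2 * R0 * e * D <= th.
  rewrite mulrAC -ler_pdivlMl ?mulr_gt0// mulrC.
  by rewrite ge_min lexx orbT.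
have [x x0 xj] := xmin.
(* Chosen so that q^(-x) = [e] for the common lower bound x of the real parts; every order then
   gains at least this factor. *)
pose q : R := e^-1 `^ x^-1.
have q1 : 1 <= q.
  rewrite -[leLHS](powRr0 e^-1); apply: ler_powR; first by rewrite invf_ge1.
  by rewrite invr_ge0 ltW.
have q0 : 0 < q by exact: lt_le_trans q1.
have qe j : (1 <= j <= n)%N -> q `^ (- complex.Re (nu j)) <= e.
  move=> jn; apply: (@le_trans _ _ (q `^ (- x))).
    by apply: ler_powR => //; rewrite lerN2 xj.
  by rewrite -powRrM mulrN mulVf ?gt_eqF// powR_inv1 ?invrK// invr_ge0 ltW.
have qD r r' : q `^ (- (r + r')) = q `^ (- r) * q `^ (- r').
  by rewrite opprD powRD//; apply/implyP => _; rewrite gt_eqF.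
have [c c0 gl] := gamr_lower q1.
have b m z : ladder m.+1 z -> rho z * q `^ (- complex.Re z) <= (2 * R0 * e) ^+ m.+1.
  elim: m z => [|m IH] z [z' [j [hz' hj ->]]].
    rewrite hz' add0r expr1; apply: (@le_trans _ _ (R0 * e)).
      by apply: ler_pM; [exact: rn|exact: powR_ge0|exact: R0_ge|exact: qe].
    by rewrite -mulrA ler_peMl ?mulr_ge0 ?(ltW R00) ?(ltW e0)// ler1n.
  have z0 := ladder_Re hz'; have j0 := nu_gt0 hj.
  rewrite raddfD qD.
  apply: (@le_trans _ _ ((rho z' * q `^ (- complex.Re z')) *
      (2 * (rho (nu j) * q `^ (- complex.Re (nu j)))))).
    rewrite [leRHS](_ : _ = (2 * rho z' * rho (nu j)) *
      (q `^ (- complex.Re z') * q `^ (- complex.Re (nu j)))); last by ring.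
    by apply: ler_wpM2r; [apply: mulr_ge0; exact: powR_ge0|exact: rhoD].
  have r1 := rho_ge0 z0; have r2 := rn _ hj.
  rewrite exprSr; apply: ler_pM; last 2 first.
  - exact: IH.
  - rewrite -mulrA ler_pM2l//; apply: ler_pM => //; [exact: powR_ge0|exact: R0_ge|exact: qe].
  - by apply: mulr_ge0 => //; exact: powR_ge0.
  - by apply: mulr_ge0 => //; apply: mulr_ge0 => //; exact: powR_ge0.
have pc m z s : ladder m.+1 z -> s <= T -> pwr (complex.Re z) s <= D ^+ m.+1 * pwsum s.
  move=> + sT; have [s0|s0] := leP s 0.
    by move=> _; rewrite /pwr ltNge s0/= mulr_ge0 ?pwsum_ge0// exprn_ge0// ltW.
  elim: m z => [|m IH] z [z' [j [hz' hj ->]]].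
    rewrite hz' add0r expr1; apply: (@le_trans _ _ (pwsum s)); last first.
      by rewrite ler_peMl// pwsum_ge0.
    by apply: (le_sum_nat (F := fun j => pwr (complex.Re (nu j)) s)) hj => i _; exact: pwr_ge0.
  rewrite raddfD/=; set r := complex.Re (nu j); set r' := complex.Re z'.
  have -> : pwr (r' + r) s = s `^ r * pwr r' s.
    rewrite /pwr s0 addrAC (@powRD _ s (r' - 1) r); first by rewrite mulrC.
    by apply/implyP => _; rewrite gt_eqF.
  rewrite exprS -mulrA ler_pM ?powR_ge0 ?pwr_ge0//; last exact: IH.
  apply: le_trans (D_ge _ hj); apply: ge0_ler_powR; rewrite ?nnegrE ?(ltW s0) ?(ltW T0)//.
  exact/ltW/nu_gt0.
exists c^-1; first by rewrite invr_gt0.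
move=> [|m] z s lz sT.
  by rewrite lz gk0 normc0 expr0 mulr1 mulr_ge0 ?pwsum_ge0// invr_ge0 ltW.
have z0 := ladder_Re lz.
have g0 : 0 < gamr (complex.Re z) by exact: gamr_gt0.
rewrite normc_gk.
have r1 : normc (crGamma z) <= c^-1 * (2 * R0 * e) ^+ m.+1.
  apply: (@le_trans _ _ (c^-1 * (rho z * q `^ (- complex.Re z)))); last first.
    by rewrite ler_wpM2l ?b// invr_ge0 ltW.
  have gq := gl _ z0.
  have Q0 : 0 < q `^ complex.Re z by exact: powR_gt0.
  rewrite /rho powRN; set N := normc _; set g := gamr _; set Q := q `^ _ in gq Q0 *.
  rewrite [leRHS](_ : _ = g / (c * Q) * N); last by field; rewrite !gt_eqF.
  by rewrite ler_peMl ?normc_ge0// ler_pdivlMr ?mulr_gt0// mul1r.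
apply: (@le_trans _ _ (c^-1 * (2 * R0 * e) ^+ m.+1 * (D ^+ m.+1 * pwsum s))).
  by rewrite ler_pM ?normc_ge0 ?pwr_ge0 ?pc.
rewrite mulrA ler_wpM2r ?pwsum_ge0// -mulrA -exprMn ler_wpM2l ?invr_ge0 ?(ltW c0)//.
by rewrite lerXn2r ?nnegrE ?(ltW th0)// !mulr_ge0 ?(ltW R00) ?(ltW e0) ?(ltW D0).
Qed.

End Ladder.

(** * The Mittag-Leffler kernel as a series of fractional kernels *)

Section MittagLefflerKernel.
Context {R : realType}.
Variables (n : nat) (a : nat -> R) (nu : nat -> R[i]).
Hypothesis n_gt0 : (0 < n)%N.
Hypothesis nu_gt0 : forall j : nat, (1 <= j <= n)%N -> 0 < complex.Re (nu j).
Hypothesis a_gt0 : forall j : nat, (1 <= j <= n)%N -> 0 < a j.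
Implicit Types (s t : R) (c : R[i]) (l k : nat).

Let ladder := ladder n nu.
Let pwsum := pwsum n nu.

Let one_n : (1 <= 1 <= n)%N. Proof. by rewrite leqnn. Qed.

Definition ml_kernel l c s : R[i] :=
  cpow s (c - 1) * mittag_leffler l.+1%:R (nu 1%N) c (- (a 1%N)%:C * cpow s (nu 1%N)).

(* s^(c-1) E^(l+1)_(nu_1, c) (- a_1 s^nu_1) extended by zero; expanding the
   Mittag-Leffler series turns it into a combination of the kernels gk. *)
Definition mlk l c s : R[i] := if 0 < s then ml_kernel l c s else 0.

Definition kt l c k s : R[i] :=
  'C(l + k, k)%:R * (- (a 1%N)%:C) ^+ k * gk (nu 1%N * k%:R + c) s.

Lemma pochhammer_bin l k : pochhammer (l.+1%:R : R[i]) k / k`!%:R = 'C(l + k, k)%:R.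
Proof.
have h : pochhammer (l.+1%:R : R[i]) k * l`!%:R = (l + k)`!%:R.
  elim: k => [|k IH]; first by rewrite /pochhammer big_ord0 mul1r addn0.
  rewrite /pochhammer big_ord_recr /= -/(pochhammer _ _) mulrAC IH.
  by rewrite addnS factS natrM mulrC -natrD addSn.
have f0 m : m`!%:R != 0 :> R[i] by rewrite pnatr_eq0 -lt0n fact_gt0.
apply: (mulIf (f0 k)); apply: (mulIf (f0 l)); rewrite divfK// h.
by rewrite -!natrM -mulnA -[in LHS](bin_fact (leq_addl l k)) addnK.
Qed.

Lemma ladder_nu1 l c k : ladder l c -> ladder (l + k) (nu 1%N * k%:R + c).
Proof.
move=> hc; elim: k => [|k IH]; first by rewrite addn0 mulr0 add0r.
rewrite addnS; exists (nu 1%N * k%:R + c), 1%N; split => //.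
by rewrite -natr1 mulrDr mulr1 addrAC.
Qed.

Lemma bin_le_exp l k : ('C(l + k, k) <= 2 ^ (l + k))%N.
Proof.
rewrite -[2%N]/(1 + 1)%N expnDn.
have kl : (k < (l + k).+1)%N by rewrite ltnS leq_addl.
rewrite (bigD1 (Ordinal kl))//= !exp1n !muln1 leq_addr//.
Qed.

Lemma kt_bound (T th : R) : 0 < T -> 0 < th ->
  exists2 C : R, 0 < C & forall l c k s, ladder l c -> s <= T ->
    normc (kt l c k s) <= C * th ^+ (l + k) * pwsum s.
Proof.
move=> T0 th0; have a0 : 0 < a 1%N := a_gt0 one_n.
(* [A]^(l+k) absorbs the binomial, at most 2^(l+k), and a_1^k <= (1 + a_1)^(l+k); the kernel bound
   is therefore taken with [th] / [A]. *)
pose A : R := 2 * (1 + a 1%N).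
have A0 : 0 < A by rewrite mulr_gt0// addr_gt0.
have [C C0 h] := ladder_bound nu_gt0 T0 (divr_gt0 th0 A0).
exists C => // l c k s hc sT.
rewrite /kt 2!normcM normcX normcN normc_nat normc_real gtr0_norm//.
apply: (@le_trans _ _ (A ^+ (l + k) * (C * (th / A) ^+ (l + k) * pwsum s))).
  apply: ler_pM; [|exact: normc_ge0| |exact: h (ladder_nu1 k hc) sT].
    by rewrite mulr_ge0// exprn_ge0// ltW.
  rewrite exprMn; apply: ler_pM => //; first by rewrite exprn_ge0// ltW.
    by rewrite -natrX ler_nat bin_le_exp.
  apply: (@le_trans _ _ ((1 + a 1%N) ^+ k)).
    by rewrite lerXn2r ?nnegrE ?addr_ge0 ?(ltW a0)// lerDr.
  by rewrite ler_weXn2l ?lerDl ?(ltW a0)// leq_addl.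
rewrite expr_div_n le_eqVlt; apply/orP; left; apply/eqP; field.
by rewrite expf_neq0 ?gt_eqF.
Qed.

Lemma kt_npos l c k s : s <= 0 -> kt l c k s = 0.
Proof. by move=> s0; rewrite /kt /gk /pw ltNge s0/= !mulr0. Qed.

Lemma kt_ccvg l c s : ladder l c -> ccvg (series (fun k => kt l c k s)).
Proof.
move=> hc; have [s0|s0] := leP s 0.
  rewrite (_ : series _ = fun=> 0); first by split; exact: is_cvg_cst.
  by apply/funext => m; rewrite /series /= big1_seq// => k _; rewrite kt_npos.
have h2 : 0 < (2^-1 : R) by rewrite invr_gt0.
have [C C0 h] := kt_bound s0 h2.
apply: (@geometric_ccvg _ _ (C * 2^-1 ^+ l * pwsum s) 2^-1) => //.
move=> k; apply: le_trans (h l c k s hc (lexx _)) _.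
rewrite exprD le_eqVlt; apply/orP; left; apply/eqP; ring.
Qed.

Lemma mlk_cto l c s : ladder l c -> cto (series (fun k => kt l c k s)) (mlk l c s).
Proof.
move=> hc; rewrite /mlk; case: ltP => s0; last first.
  apply: (cto_ext _ (cto_cst 0)) => m.
  by rewrite /series /= big1_seq// => k _; rewrite kt_npos.
pose u k := pochhammer (l.+1%:R : R[i]) k * (- (a 1%N)%:C * cpow s (nu 1%N)) ^+ k *
  crGamma (nu 1%N * k%:R + c) / (k`!)%:R.
have uE k : cpow s (c - 1) * u k = kt l c k s.
  rewrite /kt -pochhammer_bin /u /gk /pw s0 exprMn cpowXn//.
  have -> : nu 1%N * k%:R + c - 1 = nu 1%N * k%:R + (c - 1) by rewrite addrA.
  rewrite (cpowD (nu 1%N * k%:R) (c - 1) s0); move: (cpow s (c - 1)) (cpow s (nu 1%N * k%:R)) => p1 p2.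
  move: (crGamma _) (pochhammer _ _) => G P; ring.
have p0 : cpow s (c - 1) != 0 by exact: cpow_neq0.
(* The kernel series is s^(c-1) times the Mittag-Leffler series; dividing by this nonzero factor
   gives the convergence of the latter. *)
have su : ccvg (series u).
  have := ctoZ (cpow s (c - 1))^-1 (ccvg_cto (kt_ccvg s hc)).
  move=> h; suff : cto (series u) ((cpow s (c - 1))^-1 * clim (series (fun k => kt l c k s))).
    by case=> h1 h2; split; [exact: cvgP h1|exact: cvgP h2].
  apply: (cto_ext _ h) => m; rewrite /series/= mulr_sumr; apply: eq_bigr => k _.
  by rewrite -uE mulKf.
have := ctoZ (cpow s (c - 1)) (ccvg_cto su).
rewrite -/(mittag_leffler _ _ _ _) -/(ml_kernel l c s); apply: cto_ext => m.
by rewrite /series/= mulr_sumr; apply: eq_bigr => k _; rewrite uE.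
Qed.

Lemma cmeas_kt l c k : cmeas setT (kt l c k).
Proof. by apply: cmeasM; [exact: cmeas_cst|exact: cmeas_gk]. Qed.

Lemma cmeas_mlk l c : ladder l c -> cmeas setT (mlk l c).
Proof.
move=> hc; apply: (cmeas_cvg (g := fun m s => series (fun k => kt l c k s) m)).
  by move=> m; apply: cmeas_sum => k _; exact: cmeas_kt.
by move=> s _; exact: mlk_cto.
Qed.

(* Near 0 the first nonzero term, the one of index k0, dominates the others. *)
Lemma mlk_lower l c k0 : ladder l c -> 0 < complex.Re (nu 1%N * k0%:R + c) ->
  (forall k s, (k < k0)%N -> kt l c k s = 0) ->
  exists e d : R, [/\ 0 < e, 0 < d & forall s, 0 < s -> s <= e ->
    d * s `^ (complex.Re (nu 1%N * k0%:R + c) - 1) <= normc (mlk l c s)].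
Proof.
move=> hc; set z0 := _ + c => z00 kt0.
have a0 : 0 < a 1%N := a_gt0 one_n.
have x10 : 0 < complex.Re (nu 1%N) := nu_gt0 one_n.
set x := complex.Re z0; set x1 := complex.Re (nu 1%N) in x10 *.
have h2 : 0 < (2^-1 : R) by rewrite invr_gt0.
have [C C0 h] := kt_bound ltr01 h2.
pose B : R := 2 * (C * 2^-1 ^+ l * pwsum 1).
have B0 : 0 <= B by rewrite !mulr_ge0 ?exprn_ge0 ?(ltW C0) ?pwsum_ge0.
(* For s > 0 each term is a constant times a power of s, so the modulus at s = 1 is that of the
   leading coefficient. *)
pose lam : R := normc (kt l c k0 1).
have lam0 : 0 < lam.
  rewrite /lam /kt 2!normcM normcX normcN normc_nat normc_real gtr0_norm//.
  rewrite !mulr_gt0 ?exprn_gt0 ?ltr0n ?bin_gt0 ?leq_addl// normc_gt0.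
  by rewrite mulf_neq0 ?crGamma_neq0//; rewrite /pw ltr01 cpow1 oner_neq0.
have kE k s : 0 < s -> normc (kt l c k s) =
    normc (kt l c k 1) * s `^ (complex.Re (nu 1%N * k%:R + c) - 1).
  move=> s0; rewrite /kt !normcM normc_pw normc_pw.
  by rewrite /pwr s0 ltr01 powR1 mulr1; ring.
have ReE k : complex.Re (nu 1%N * k%:R + c) = x1 * k%:R + complex.Re c.
  rewrite raddfD/= -(rmorph_nat (real_complex R)) mulrC Re_rM.
  by rewrite mulrC.
(* A later term has a real exponent larger by at least [x1], and for s <= 1 any excess only makes it
   smaller. *)
have kB k s : (k0 < k)%N -> 0 < s -> s <= 1 ->
    normc (kt l c k s) <= normc (kt l c k 1) * (s `^ (x - 1) * s `^ x1).
  move=> k0k s0 s1; rewrite kE// ler_wpM2l ?normc_ge0//.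
  rewrite -powRD; last by apply/implyP => _; rewrite gt_eqF.
  apply: ger_powR; first by rewrite s0.
  rewrite addrAC lerD2r ReE /x /z0 ReE addrAC lerD2r.
  have -> : x1 * k0%:R + x1 = x1 * k0.+1%:R by rewrite -natr1 mulrDr mulr1.
  by rewrite ler_pM2l// ler_nat.
have S1 m : \sum_(0 <= k < m) normc (kt l c k 1) <= B.
  apply: (@le_trans _ _ (\sum_(0 <= k < m) (C * 2^-1 ^+ l * pwsum 1) * 2^-1 ^+ k)).
    apply: ler_sum => k _; apply: le_trans (h l c k 1 hc (lexx _)) _.
    by rewrite exprD le_eqVlt; apply/orP; left; apply/eqP; ring.
  apply: le_trans (geometric_sum_le 0 m _ _ (lexx _)) _; last by rewrite mulr1.
    by rewrite !mulr_ge0 ?exprn_ge0 ?(ltW C0) ?pwsum_ge0.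
  exact: ltW.
have rest s : 0 < s -> s <= 1 ->
    normc (mlk l c s - kt l c k0 s) <= B * (s `^ (x - 1) * s `^ x1).
  move=> s0 s1.
  have hs : cto (fun m => series (fun k => kt l c k s) (k0.+1 + m)%N - kt l c k0 s)
      (mlk l c s - kt l c k0 s).
    apply: ctoB; last exact: cto_cst.
    elim: (k0.+1) => [|p IH]; first by apply: (cto_ext _ (mlk_cto s hc)) => m; rewrite add0n.
    have := (cto_shiftS (fun m => series (fun k => kt l c k s) (p + m)%N) _).2 IH.
    by apply: cto_ext => m; rewrite addSnnS.
  apply: (normc_cto_le hs) => m.
  have -> : series (fun k => kt l c k s) (k0.+1 + m)%N =
     kt l c k0 s + \sum_(k0.+1 <= k < k0.+1 + m) kt l c k s.
    rewrite /series/= (@big_cat_nat _ _ _ k0.+1)//= ?leq_addr//; congr (_ + _).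
    rewrite big_nat_recr//= big_nat_cond big1 ?add0r// => k /andP[/andP[_ kk] _].
    exact: kt0.
  rewrite addrAC subrr add0r (le_trans (normc_sum _ _ _))//.
  apply: (@le_trans _ _ (\sum_(k0.+1 <= k < k0.+1 + m)
     normc (kt l c k 1) * (s `^ (x - 1) * s `^ x1))).
    by apply: ler_sum_nat => k /andP[kk _]; exact: kB.
  rewrite -mulr_suml ler_wpM2r ?mulr_ge0 ?powR_ge0//.
  apply: le_trans (S1 (k0.+1 + m)%N).
  rewrite [leRHS](@big_cat_nat _ _ _ k0.+1)//= ?leq_addr// lerDr.
  by apply: sumr_ge0 => k _; exact: normc_ge0.
(* Solves (B + 1) s^[x1] = [lam] / 2, so the other terms take away at most half of the leading one.
   B + 1 is positive even if B = 0. *)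
pose e0 : R := (lam / (2 * (B + 1))) `^ x1^-1.
have B10 : 0 < B + 1 by rewrite ltr_wpDl.
have q0 : 0 < lam / (2 * (B + 1)) by rewrite divr_gt0// mulr_gt0.
have e00 : 0 < e0 by exact: powR_gt0.
exists (Num.min 1 e0), (lam / 2); split.
- by rewrite lt_min ltr01.
- by rewrite divr_gt0.
move=> s s0; rewrite le_min => /andP[s1 se].
have sx : B * s `^ x1 <= lam / 2.
  have : s `^ x1 <= lam / (2 * (B + 1)).
    apply: le_trans (_ : e0 `^ x1 <= _).
      by apply: ge0_ler_powR; rewrite ?nnegrE ?(ltW s0) ?(ltW e00) ?(ltW x10).
    by rewrite /e0 -powRrM mulVf ?gt_eqF// powRr1// ltW.
  move=> hx; apply: (@le_trans _ _ ((B + 1) * (lam / (2 * (B + 1))))).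
    by apply: ler_pM => //; [exact: powR_ge0|rewrite lerDl].
  by rewrite le_eqVlt; apply/orP; left; apply/eqP; field; rewrite gt_eqF.
have := rest s s0 s1; have := kE k0 s s0; rewrite -/z0 -/x -/lam => e1 e2.
have tri : normc (kt l c k0 s) <= normc (mlk l c s) + normc (mlk l c s - kt l c k0 s).
  rewrite -[normc (mlk l c s - _)]normcN opprB.
  have := normcD (mlk l c s) (kt l c k0 s - mlk l c s).
  by rewrite addrC subrK addrC.
have p0 := powR_ge0 s (x - 1).
move: tri; rewrite e1 => tri.
have : B * (s `^ (x - 1) * s `^ x1) <= lam / 2 * s `^ (x - 1).
  by rewrite mulrCA mulrC ler_wpM2r.
move: tri e2; move: (normc _) (normc _) (B * _) => N1 N2 N3; lra.
Qed.

End MittagLefflerKernel.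

(** * Recovering the source from its convolutions *)

Section Deconvolution.
Context {R : realType}.
Local Notation mu := (@lebesgue_measure R).
Variables (f kap : R -> R[i]) (x e d : R).
Hypothesis mkap : cmeas setT kap.
Hypothesis fkap : forall t, 0 <= t -> cintegrable `[0, t[ (fun u => f u * kap (t - u)).
Hypothesis e0 : 0 < e.
Hypothesis d0 : 0 < d.
Hypothesis kap_lower : forall s, 0 < s -> s <= e -> d * s `^ (x - 1) <= normc (kap s).

Definition posext (u : R) : R[i] := if 0 <= u then f u else 0.

(** The power is monotone in a direction that depends on the sign of x - 1; the minimum and the sum
    of the end values serve both cases. *)
Let powR_between (u v s : R) : 0 < u -> u <= s -> s <= v ->
  Num.min (u `^ (x - 1)) (v `^ (x - 1)) <= s `^ (x - 1) <= u `^ (x - 1) + v `^ (x - 1).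
Proof.
move=> u0 us sv; have s0 : 0 < s by exact: lt_le_trans us.
have v0 : 0 < v by exact: lt_le_trans sv.
have [x1|x1] := leP 0 (x - 1).
  have h1 : u `^ (x - 1) <= s `^ (x - 1).
    by apply: ge0_ler_powR; rewrite ?nnegrE ?(ltW u0) ?(ltW s0).
  have h2 : s `^ (x - 1) <= v `^ (x - 1).
    by apply: ge0_ler_powR; rewrite ?nnegrE ?(ltW v0) ?(ltW s0).
  by rewrite ge_min h1/= (le_trans h2)// lerDr powR_ge0.
have nx : 0 <= - (x - 1) by rewrite oppr_ge0 ltW.
have anti (p q : R) : 0 < p -> p <= q -> q `^ (x - 1) <= p `^ (x - 1).
  move=> p0 pq; have q0 : 0 < q by exact: lt_le_trans pq.
  rewrite -[x - 1]opprK !(powRN _ (- (x - 1))) lef_pV2 ?posrE ?powR_gt0//.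
  by apply: ge0_ler_powR; rewrite ?nnegrE ?(ltW p0) ?(ltW q0).
by rewrite ge_min (anti s v)// orbT/= (le_trans (anti u s _ _))// lerDl powR_ge0.
Qed.

(** Where the kernel stays away from 0, f is an integrable function divided by it, hence measurable
    and dominated. *)
Let window (D : set R) (t m : R) : measurable D -> 0 <= t -> D `<=` `[0, t[ -> 0 < m ->
  (forall u, D u -> m <= normc (kap (t - u))) -> cintegrable D f.
Proof.
move=> mD t0 Dt m0 km.
have i1 : cintegrable D (fun u => f u * kap (t - u)).
  by apply: cintegrableS (fkap t0).
have [m1 f1] := (cintegrableP _ mD).1 i1.
have mk : cmeas D (fun u : R => kap (t - u)).
  have h : cmeas setT (fun u : R => kap (t - u)).
    by apply: (cmeasT_comp mkap); exact: measurable_funB.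
  exact: cmeasS measurableT _ h.
have k0 u : D u -> kap (t - u) != 0.
  by move=> Du; rewrite -normc_gt0 (lt_le_trans m0)// km.
have mf : cmeas D f.
  apply: (cmeas_eq _ (cmeasM m1 (cmeasV mk))) => u; rewrite inE => Du.
  by rewrite mulfK// k0.
apply: (cintegrable_le (h := fun u => m^-1 * normc (f u * kap (t - u)))) => //.
  have iN : mu.-integrable D (EFin \o (fun u : R => normc (f u * kap (t - u)))).
    apply/integrableP; split; first by apply/measurable_EFinP; exact: measurable_normc.
    by under eq_integral do rewrite /= ger0_norm ?normc_ge0//.
  by apply: (@integrableZl _ _ _ _ _ _ m^-1 _ iN).
move=> u Du; rewrite normcM mulrCA ler_peMr ?normc_ge0//.
by rewrite ler_pdivlMl// mulr1 km.
Qed.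

Let h := e / 2.

Let h0 : 0 < h. Proof. by rewrite divr_gt0. Qed.

(** On the window [kh, (k+1)h) the convolution at time t = (k+2)h has arguments t - u in (h, 2h]
    with 2h = e: away from 0 and within the range of the lower bound. *)
Let integrable_step k : cintegrable `[0, k%:R * h[ f.
Proof.
elim: k => [|k IH].
  rewrite mul0r set_itvco0; apply/cintegrable_mkcond => //.
  by under eq_fun do rewrite in_set0; exact: cintegrable0.
have i2 : cintegrable `[k%:R * h, k.+1%:R * h[ f.
  apply: (@window _ (k.+2%:R * h) (d * Num.min (h `^ (x - 1)) (e `^ (x - 1)))) => //.
  - by rewrite mulr_ge0// ltW.
  - move=> u /=; rewrite !in_itv/= => /andP[ku uk].
    apply/andP; split; first by apply: le_trans ku; rewrite mulr_ge0// ltW.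
    by apply: lt_le_trans uk _; rewrite ler_pM2r// ler_nat.
  - by rewrite mulr_gt0// lt_min !powR_gt0.
  move=> u /=; rewrite in_itv/= => /andP[ku uk].
  have hE : e = 2 * h by rewrite /h mulrC divfK.
  have s1 : h <= k.+2%:R * h - u.
    rewrite lerBrDr -lerBrDl; apply: le_trans (ltW uk) _.
    by rewrite -[k.+2%:R]natr1 mulrDl mul1r addrK.
  have s2 : k.+2%:R * h - u <= e.
    rewrite hE lerBlDr; apply: le_trans (lerD (lexx _) ku).
    by rewrite -mulrDl -natrD.
  apply: le_trans (kap_lower _ s2); last exact: lt_le_trans s1.
  by rewrite ler_pM2l//; have /andP[] := powR_between h0 s1 s2.
apply/cintegrable_mkcond => //.
have j1 := (cintegrable_mkcond f (measurable_itv _)).1 IH.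
have j2 := (cintegrable_mkcond f (measurable_itv _)).1 i2.
have := cintegrableD measurableT j1 j2.
apply: eq_cintegrable => // u _; rewrite !mem_setE !in_itv/=.
have kh : k%:R * h <= k.+1%:R * h by rewrite ler_pM2r// ler_nat.
have k0 : 0 <= k%:R * h by rewrite mulr_ge0// ltW.
case: (leP 0 u) => u0 /=; last by rewrite leNgt (lt_le_trans u0 k0)/= addr0.
case: (ltP u (k%:R * h)) => uk /=; last by rewrite add0r.
by rewrite (lt_le_trans uk kh) addr0.
Qed.

Lemma deconv_integrable T : cintegrable `[0, T[ f.
Proof.
pose k := (Num.trunc (T / h)).+1.
apply: cintegrableS (integrable_step k) => //.
move=> u /=; rewrite !in_itv/= => /andP[-> uT]/=.
by rewrite (lt_trans uT)// -ltr_pdivrMr// truncnS_gt.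
Qed.

Lemma deconv_cmeas : cmeas setT posext.
Proof.
apply: (cmeas_cvg (g := fun (k : nat) (u : R) => if u \in `[0, k%:R[%classic then f u else 0)).
  move=> k; have j := (cintegrable_mkcond f (measurable_itv _)).1 (deconv_integrable k%:R).
  by have [] := (cintegrableP _ measurableT).1 j.
move=> u _.
have ev : \forall k \near \oo, (if u \in `[0, k%:R[%classic then f u else 0) = posext u.
  exists (Num.trunc u).+1 => // k /= uk.
  rewrite mem_setE in_itv/= /posext (lt_le_trans (truncnS_gt _)) ?ler_nat//.
  by rewrite andbT.
by split; apply: cvg_near_cst; apply: filterS ev => k ->.
Qed.

(** For t - u <= e the power is at most |kap|/d, which the given convolution covers; for t - u > e
    it is bounded by [M], and f is integrable on [0, t). *)
Lemma deconv_frac_lty t :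
  (\int[mu]_u (pwr x (t - u) * normc (posext u))%:E < +oo)%E.
Proof.
have [t0|t0] := leP t 0.
  rewrite integral0_eq// => u _; congr EFin; rewrite /pwr /posext subr_gt0.
  by case: ifP => ut; rewrite ?mul0r// leNgt (lt_le_trans ut t0) normc0 mulr0.
pose M := e `^ (x - 1) + t `^ (x - 1).
have M0 : 0 <= M by rewrite addr_ge0 ?powR_ge0.
have j1 := (cintegrable_mkcond f (measurable_itv _)).1 (deconv_integrable t).
have j2 := (cintegrable_mkcond _ (measurable_itv _)).1 (fkap (ltW t0)).
have [m1 f1] := (cintegrableP _ measurableT).1 j1.
have [m2 f2] := (cintegrableP _ measurableT).1 j2.
set g1 := fun u => if u \in `[0, t[%classic then f u else 0 in m1 f1.
set g2 := fun u => if u \in `[0, t[%classic then f u * kap (t - u) else 0 in m2 f2.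
have mn1 := measurable_normc m1; have mn2 := measurable_normc m2.
apply: (@le_lt_trans _ _ (\int[mu]_u (M * normc (g1 u) + d^-1 * normc (g2 u))%:E)%E).
  apply: ge0_le_integral => //.
  - by move=> u _; rewrite lee_fin mulr_ge0 ?pwr_ge0 ?normc_ge0.
  - apply/measurable_EFinP; apply: measurable_funM.
      by apply: (measurableT_comp (measurable_pwr x)); exact: measurable_funB.
    by apply: measurable_normc; exact: deconv_cmeas.
  - by apply/measurable_EFinP; apply: measurable_funD; exact: measurable_funM.
  move=> u _; rewrite lee_fin /g1 /g2 /posext /pwr mem_setE in_itv/= subr_gt0.
  case: (ltP u t) => ut; last by rewrite mul0r andbF /= expr0n /= addr0 sqrtr0 !mulr0 addr0.
  case: (leP 0 u) => u0; last by rewrite !normc0 !mulr0 addr0.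
  rewrite andTb.
  have [se|se] := leP (t - u) e.
    rewrite (@le_trans _ _ (d^-1 * normc (f u * kap (t - u))))//; last first.
      by rewrite lerDr mulr_ge0 ?normc_ge0.
    rewrite normcM mulrCA mulrC ler_wpM2l ?normc_ge0// ler_pdivlMl//.
    by apply: kap_lower => //; rewrite subr_gt0.
  rewrite (@le_trans _ _ (M * normc (f u)))//; last first.
    by rewrite lerDl mulr_ge0 ?normc_ge0// invr_ge0 ltW.
  rewrite ler_wpM2r ?normc_ge0//.
  have ut' : t - u <= t by rewrite lerBlDr lerDl.
  by have /andP[] := powR_between e0 (ltW se) ut'.
under eq_integral do rewrite EFinD.
rewrite ge0_integralD//; last 4 first.
- by move=> u _; rewrite lee_fin mulr_ge0 ?normc_ge0.
- by apply/measurable_EFinP; exact: measurable_funM.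
- by move=> u _; rewrite lee_fin mulr_ge0 ?normc_ge0// invr_ge0 ltW.
- by apply/measurable_EFinP; exact: measurable_funM.
apply: lte_add_pinfty.
  rewrite (ge0_integralMl mn1 (fun u => normc_ge0 _) M0).
  by rewrite lte_mul_pinfty.
rewrite (ge0_integralMl mn2 (fun u => normc_ge0 _)); last by rewrite invr_ge0 ltW.
by rewrite lte_mul_pinfty// lee_fin invr_ge0 ltW.
Qed.

End Deconvolution.

(** * Fractional integrals of the source and their semigroup law *)

Section FractionalIntegral.
Context {R : realType}.
Local Notation mu := (@lebesgue_measure R).

(** The operators integrate over [0, t], whereas the truncated kernels vanish at u = t; a single
    endpoint affects neither measurability nor the integral. *)
Lemma cint_itv_co_cc (g : R -> R[i]) (t : R) : cintegrable `[0, t[ g ->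
  cintegrable `[0, t] g /\ cintegral `[0, t] g = cintegral `[0, t[ g.
Proof.
move=> [iR iI].
have key (p : R -> R) : mu.-integrable `[0%R, t[ (fun u => (p u)%:E) ->
    mu.-integrable `[0%R, t] (fun u => (p u)%:E).
  move=> /integrableP[mp fp].
  have mp' : measurable_fun `[0%R, t] (fun u => (p u)%:E).
    by apply/emeasurable_fun_itv_bndo_bndcP.
  apply/integrableP; split => //.
  by rewrite -integral_itv_bndo_bndc//; apply: measurableT_comp.
split; first by split; exact: key.
by rewrite /cintegral; congr (_ +i* _); apply/esym; exact: Rintegral_itv_bndo_bndc.
Qed.

Lemma RL_posext (nu : R[i]) (g : R -> R[i]) (t : R) : 0 < complex.Re nu ->
  cintegrable setT (fun u : R => gk nu (t - u) * posext g u) ->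
  RL_defined nu g t /\
  RL_integral nu g t = cintegral setT (fun u : R => gk nu (t - u) * posext g u).
Proof.
move=> nu0 ig.
have nu_neq0 : nu == 0 = false.
  by apply/negP => /eqP h; move: nu0; rewrite h ltxx.
have G0 := cGamma_neq0 nu0.
have E (u : R) : gk nu (t - u) * posext g u =
    if u \in `[0, t[%classic then crGamma nu * RL_integrand nu g t u else 0.
  rewrite mem_setE in_itv/= /gk /pw /posext /RL_integrand subr_gt0.
  by case: ifP => ut; case: ifP => u0; rewrite ?mulr0 ?mul0r ?mulrA.
have i1 : cintegrable `[0, t[ (fun u => crGamma nu * RL_integrand nu g t u).
  apply/cintegrable_mkcond => //; move: ig; exact: eq_cintegrable.
have i2 : cintegrable `[0, t[ (RL_integrand nu g t).
  have := cintegrableZ (cGamma nu) (measurable_itv _) i1.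
  apply: eq_cintegrable => // u _; rewrite mulrA crGammaE// mulfV// mul1r//.
have [i3 e3] := cint_itv_co_cc i2.
split; first by right.
rewrite /RL_integral nu_neq0 e3 -crGammaE//.
have <- := cintegralZ (crGamma nu) (measurable_itv _) i2.
rewrite cintegral_mkcond; apply: eq_cintegral => u _.
exact/esym/E.
Qed.

(** Associativity of convolution for nonnegative functions: t - v = (t-u) - (v-u), so the inner
    integral over v is the Beta convolution at t - u. *)
Lemma tonelli_conv (x y t : R) (N : R -> R) : measurable_fun setT N ->
  (forall u, 0 <= N u) ->
  (\int[mu]_v \int[mu]_u (pwr x (t - v) * (pwr y (v - u) * N u))%:E =
   betI x y * \int[mu]_u (pwr (x + y) (t - u) * N u)%:E)%E.
Proof.
move=> mN N0.
have mxt : measurable_fun setT (fun v : R => pwr x (t - v)).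
  by apply: (measurableT_comp (measurable_pwr x)); exact: measurable_funB.
have mF : measurable_fun setT (fun p : R * R =>
    (pwr x (t - p.1) * (pwr y (p.1 - p.2) * N p.2))%:E).
  apply/measurable_EFinP; apply: measurable_funM.
    exact: (measurableT_comp mxt measurable_fst).
  apply: measurable_funM; last exact: (measurableT_comp mN measurable_snd).
  by apply: (measurableT_comp (measurable_pwr y)); exact: measurable_sub12.
have F0 (p : R * R) : (0 <= (pwr x (t - p.1) * (pwr y (p.1 - p.2) * N p.2))%:E)%E.
  by rewrite lee_fin mulr_ge0 ?pwr_ge0// mulr_ge0 ?pwr_ge0.
apply: etrans (tonelliR mF F0) _.
have mC : measurable_fun setT (fun u : R => pwr (x + y) (t - u) * N u).
  apply: measurable_funM => //.
  by apply: (measurableT_comp (measurable_pwr (x + y))); exact: measurable_funB.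
have C0 u : 0 <= pwr (x + y) (t - u) * N u by rewrite mulr_ge0 ?pwr_ge0.
apply: etrans _ (ge0_integralMe mC C0 (betI_ge0 x y)).
apply: eq_integral => u _ /=.
transitivity (\int[mu]_v (N u * (pwr x (t - u - (v - u)) * pwr y (v - u)))%:E)%E.
  apply: eq_integral => v _; congr EFin.
  by rewrite opprB addrA subrK; ring.
have mG := measurable_pwr_conv x y (t - u).
apply: etrans (esym (integral_shift
  (f := fun v => (N u * (pwr x (t - u - v) * pwr y v))%:E) u _ _)) _.
- by apply/measurable_EFinP; apply: measurable_funM => //.
- by move=> v; rewrite lee_fin mulr_ge0// pwr_conv_ge0.
apply: etrans (ge0_integralMl mG (pwr_conv_ge0 x y (t - u)) (N0 u)) _.
by rewrite pwr_conv muleA -EFinM muleC mulrC.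
Qed.

Section WithSource.
Variables (n : nat) (nu : nat -> R[i]) (f0 : R -> R[i]).
Hypothesis nu_gt0 : forall j : nat, (1 <= j <= n)%N -> 0 < complex.Re (nu j).
Hypothesis mf0 : cmeas setT f0.
Hypothesis f0_neg : forall u, u < 0 -> f0 u = 0.
Hypothesis f0_frac : forall j t, (1 <= j <= n)%N ->
  (\int[mu]_u (pwr (complex.Re (nu j)) (t - u) * normc (f0 u))%:E < +oo)%E.

Let ladder := ladder n nu.
Let pwsum := pwsum n nu.
Let x_ j := complex.Re (nu j).

Let mN : measurable_fun setT (fun u : R => normc (f0 u)).
Proof. exact: measurable_normc. Qed.

Let measurable_shiftN x t : measurable_fun setT (fun u : R => pwr x (t - u) * normc (f0 u)).
Proof.
apply: measurable_funM => //.
by apply: (measurableT_comp (measurable_pwr x)); exact: measurable_funB.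
Qed.

Let shiftN_ge0 x t u : 0 <= pwr x (t - u) * normc (f0 u).
Proof. by rewrite mulr_ge0 ?pwr_ge0 ?normc_ge0. Qed.

(** The sum over j of I^(Re nu_j)|f0| without the factors 1/Gamma: up to constants, one majorant for
    the fractional integrals of all orders built from the nu_j. *)
Definition fracsum t : \bar R := (\int[mu]_u (pwsum (t - u) * normc (f0 u))%:E)%E.
Definition fracsumr t : R := fine (fracsum t).

Lemma fracsumE t : (fracsum t = \sum_(1 <= j < n.+1)
  \int[mu]_u (pwr (x_ j) (t - u) * normc (f0 u))%:E)%E.
Proof.
rewrite /fracsum -ge0_integral_sum//; last 2 first.
- by move=> j; apply/measurable_EFinP; exact: measurable_shiftN.
- by move=> j u _; rewrite lee_fin.
by apply: eq_integral => u _; rewrite sumEFin /pwsum mulr_suml.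
Qed.

Lemma fracsum_lty t : (fracsum t < +oo)%E.
Proof.
rewrite fracsumE big_nat_cond; apply: lte_sum_pinfty => j /andP[/andP[j1 jn] _].
by apply: f0_frac; rewrite j1.
Qed.

Lemma fracsum_ge0 t : (0 <= fracsum t)%E.
Proof. by apply: integral_ge0 => u _; rewrite lee_fin mulr_ge0 ?normc_ge0 ?pwsum_ge0. Qed.

Lemma fracsumrE t : fracsum t = (fracsumr t)%:E.
Proof. by rewrite fineK// ge0_fin_numE ?fracsum_ge0 ?fracsum_lty. Qed.

Lemma fracsumr_ge0 t : 0 <= fracsumr t.
Proof. by rewrite fine_ge0// fracsum_ge0. Qed.

Let measurable_pwsumN t : measurable_fun setT (fun u : R => pwsum (t - u) * normc (f0 u)).
Proof.
apply: measurable_funM => //.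
have m : measurable_fun setT pwsum.
  by apply: measurable_sum => j; exact: measurable_pwr.
by apply: (measurableT_comp m); exact: measurable_funB.
Qed.

Lemma integrable_pwsumN t :
  mu.-integrable setT (EFin \o (fun u : R => pwsum (t - u) * normc (f0 u))).
Proof.
apply/integrableP; split; first by apply/measurable_EFinP; exact: measurable_pwsumN.
under eq_integral do rewrite /= ger0_norm ?mulr_ge0 ?normc_ge0 ?pwsum_ge0//.
exact: fracsum_lty.
Qed.

Let cmeas_gk_shift (z : R[i]) (t : R) : cmeas setT (fun u : R => gk z (t - u)).
Proof. by apply: (cmeasT_comp (cmeas_gk z)); exact: measurable_funB. Qed.

Let cmeas_gkf (z : R[i]) (t : R) : cmeas setT (fun u : R => gk z (t - u) * f0 u).
Proof. exact: cmeasM. Qed.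

Definition frac z t : R[i] := cintegral setT (fun u : R => gk z (t - u) * f0 u).

Lemma gkf_bound (C th T : R) m z t u :
  (forall s, s <= T -> normc (gk z s) <= C * th ^+ m * pwsum s) -> t <= T ->
  normc (gk z (t - u) * f0 u) <= C * th ^+ m * (pwsum (t - u) * normc (f0 u)).
Proof.
move=> h tT; have [u0|u0] := leP 0 u; last by rewrite f0_neg// mulr0 normc0 !mulr0.
rewrite normcM mulrA ler_wpM2r ?normc_ge0// h//.
by rewrite (le_trans _ tT)// lerBlDr lerDl.
Qed.

Lemma cintegrable_frac m z t : ladder m z ->
  cintegrable setT (fun u : R => gk z (t - u) * f0 u).
Proof.
move=> lz; have T0 : 0 < `|t| + 1 by rewrite ltr_wpDl.
have [C C0 h] := ladder_bound nu_gt0 T0 ltr01.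
have iZ : mu.-integrable setT (EFin \o (fun u : R => C * 1 ^+ m * (pwsum (t - u) * normc (f0 u)))).
  by apply: (@integrableZl _ _ _ _ _ _ (C * 1 ^+ m) _ (integrable_pwsumN t)).
apply: (cintegrable_le measurableT (cmeas_gkf z t) iZ) => u _.
apply: (gkf_bound (T := `|t| + 1)); first by move=> s; exact: h.
by rewrite (le_trans (ler_norm t))// lerDl.
Qed.

Lemma frac_bound (T th : R) : 0 < T -> 0 < th -> exists2 C : R, 0 < C &
  forall m z t, ladder m z -> t <= T -> normc (frac z t) <= C * th ^+ m * fracsumr t.
Proof.
move=> T0 th0; have [C C0 h] := ladder_bound nu_gt0 T0 th0.
exists (2 * C); first by rewrite mulr_gt0.
move=> m z t lz tT; apply: le_trans (normc_cintegral _ _) _ => //.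
  exact: cintegrable_frac lz.
rewrite -!mulrA ler_pM2l//.
have c0 : 0 <= C * th ^+ m by rewrite mulr_ge0 ?exprn_ge0 ?ltW.
have [_ fz] := (cintegrableP _ measurableT).1 (cintegrable_frac t lz).
rewrite mulrA -lee_fin fineK; last first.
  by rewrite ge0_fin_numE//; apply: integral_ge0 => u _; rewrite lee_fin normc_ge0.
rewrite EFinM -fracsumrE /fracsum.
have p0 u : 0 <= pwsum (t - u) * normc (f0 u) by rewrite mulr_ge0 ?normc_ge0 ?pwsum_ge0.
have e := ge0_integralMl (measurable_pwsumN t) p0 c0; rewrite -e.
apply: ge0_le_integral => //.
- by move=> u _; rewrite lee_fin normc_ge0.
- by apply/measurable_EFinP; apply: measurable_normc; exact: cmeas_gkf.
- by apply/measurable_EFinP; apply: measurable_funM => //; exact: measurable_pwsumN.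
- by move=> u _; rewrite lee_fin; apply: (gkf_bound (T := T)) => // s; exact: h.
Qed.

Lemma frac_neg z t : t <= 0 -> frac z t = 0.
Proof.
move=> t0; rewrite -[RHS](cintegral0 setT); apply: eq_cintegral => u _.
have [u0|u0] := leP 0 u; last by rewrite f0_neg// mulr0.
by rewrite /gk /pw ltNge subr_le0 (le_trans t0 u0)/= mulr0 mul0r.
Qed.

(** The nonzero constant 1/|Gamma(z)| is divided out of the integrability of the kernel against f0.
    At least one order is required: for z = 0 the kernel is 0 and carries no information. *)
Lemma frac_pwr_lty m z t : ladder m.+1 z ->
  (\int[mu]_u (pwr (complex.Re z) (t - u) * normc (f0 u))%:E < +oo)%E.
Proof.
move=> lz; have [_] := (cintegrableP _ measurableT).1 (cintegrable_frac t lz).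
have c0 : 0 < normc (crGamma z) by rewrite normc_gt0 crGamma_neq0//; exact: ladder_Re lz.
have -> : (\int[mu]_u (normc (gk z (t - u) * f0 u))%:E =
    (normc (crGamma z))%:E * \int[mu]_u (pwr (complex.Re z) (t - u) * normc (f0 u))%:E)%E.
  apply: etrans _ (ge0_integralMl (measurable_shiftN (complex.Re z) t) (shiftN_ge0 (complex.Re z) t) (ltW c0)).
  by apply: eq_integral => u _; rewrite normcM normc_gk mulrA.
set I := integral _ _ _; have : (0 <= I)%E.
  by apply: integral_ge0 => u _; rewrite lee_fin.
by case: I => [r _ _| |]//=; [exact: ltry|rewrite gt0_muley ?lte_fin].
Qed.

(** Fubini combined with [gk_conv]. By [tonelli_conv] the absolute double integral is a multiple of
    the integral of order Re(z + nu_j) of |f0|, which is finite because z + nu_j is again a sum of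
    orders. *)
Lemma frac_semigroup m z j t : ladder m.+1 z -> (1 <= j <= n)%N ->
  cintegrable setT (fun v : R => gk (nu j) (t - v) * frac z v) /\
  cintegral setT (fun v : R => gk (nu j) (t - v) * frac z v) = frac (z + nu j) t.
Proof.
move=> lz jn; have z0 := ladder_Re nu_gt0 lz; have j0 := nu_gt0 jn.
have lzj : ladder m.+2 (z + nu j) by exists z, j.
pose G (v u : R) : R[i] := gk (nu j) (t - v) * (gk z (v - u) * f0 u).
have mG : cmeas setT (fun p : R * R => G p.1 p.2).
  apply: cmeasM; first exact: (cmeasT_comp (cmeas_gk_shift (nu j) t) measurable_fst).
  apply: cmeasM; last exact: (cmeasT_comp mf0 measurable_snd).
  by apply: (cmeasT_comp (cmeas_gk z)); exact: measurable_sub12.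
have i1 v : cintegrable setT (G v).
  by apply: (cintegrableZ (gk (nu j) (t - v)) measurableT); exact: cintegrable_frac lz.
have shiftE u : (fun v : R => gk (nu j) (t - u - (v - u)) * gk z (v - u)) =
    (fun v : R => gk (nu j) (t - v) * gk z (v - u)).
  by apply/funext => v; rewrite opprB addrA subrK.
have mc u := ((cintegrableP _ measurableT).1 (cintegrable_gk_conv (t - u) j0 z0)).1.
have i2' u : cintegrable setT (fun v : R => gk (nu j) (t - v) * gk z (v - u)).
  have := (cintegrable_affine (- u) ltr01 _).1 (cintegrable_gk_conv (t - u) j0 z0).
  by apply: eq_cintegrable => // v _; rewrite mul1r -(congr1 (@^~ v) (shiftE u)).
have i2 u : cintegrable setT (G ^~ u).
  have := cintegrableZ (f0 u) measurableT (i2' u).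
  by apply: eq_cintegrable => // v _; rewrite /G mulrC mulrA.
have fin : (\int[mu]_v \int[mu]_u (normc (G v u))%:E < +oo)%E.
  pose A := normc (crGamma (nu j)) * normc (crGamma z).
  have A0 : 0 <= A by rewrite mulr_ge0 ?normc_ge0.
  have mx v : measurable_fun setT (fun u : R => pwr (x_ j) (t - v) *
      (pwr (complex.Re z) (v - u) * normc (f0 u))) by exact: measurable_funM.
  have x0 v u : 0 <= pwr (x_ j) (t - v) * (pwr (complex.Re z) (v - u) * normc (f0 u)).
    by rewrite mulr_ge0 ?pwr_ge0.
  have E v : (\int[mu]_u (normc (G v u))%:E = A%:E * \int[mu]_u (pwr (x_ j) (t - v) *
      (pwr (complex.Re z) (v - u) * normc (f0 u)))%:E)%E.
    apply: etrans _ (ge0_integralMl (mx v) (x0 v) A0); apply: eq_integral => u _.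
    congr EFin; rewrite /G !normcM !normc_pw /A -/(x_ j).
    by rewrite -!mulrA; congr (_ * _); rewrite mulrCA.
  under eq_integral do rewrite E.
  rewrite ge0_integralZl//; last 2 first.
  - apply: (@measurable_fun_fubini_tonelli_F _ _ _ _ _ mu (fun p : R * R =>
      (pwr (x_ j) (t - p.1) * (pwr (complex.Re z) (p.1 - p.2) * normc (f0 p.2)))%:E)) => //.
    + apply/measurable_EFinP; apply: measurable_funM.
        apply: (measurableT_comp (measurable_pwr (x_ j))).
        by apply: measurable_funB => //; exact: measurable_fst.
      apply: measurable_funM; last exact: (measurableT_comp mN measurable_snd).
      by apply: (measurableT_comp (measurable_pwr _)); exact: measurable_sub12.
    + by move=> p; rewrite lee_fin.
  - by move=> v _; apply: integral_ge0 => u _; rewrite lee_fin.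
  apply: lte_mul_pinfty => //.
  rewrite (tonelli_conv (x_ j) (complex.Re z) t mN (fun u => normc_ge0 _)).
  rewrite betrE//; apply: lte_mul_pinfty => //; first by rewrite lee_fin betr_ge0.
  by have := frac_pwr_lty t lzj; rewrite raddfD/= addrC.
have [H1 H2] := cFubini mG fin i1 i2.
have E1 v : cintegral setT (G v) = gk (nu j) (t - v) * frac z v.
  exact: (cintegralZ (gk (nu j) (t - v)) measurableT (cintegrable_frac v lz)).
have E2 u : cintegral setT (G ^~ u) = gk (z + nu j) (t - u) * f0 u.
  transitivity (cintegral setT (fun v : R => f0 u * (gk (nu j) (t - v) * gk z (v - u)))).
    by apply: eq_cintegral => v _; exact: etrans (mulrA _ _ _) (mulrC _ _).
  apply: etrans (cintegralZ (f0 u) measurableT (i2' u)) _.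
  rewrite mulrC; congr (_ * _); rewrite [z + _]addrC -(gk_conv (t - u) j0 z0).
  by rewrite (cintegral_shift u (mc u)) -shiftE.
split.
  by move: H1; apply: eq_cintegrable => // v _; exact: E1.
rewrite /frac -/(frac _ _).
transitivity (cintegral setT (fun v => cintegral setT (G v))).
  by apply: eq_cintegral => v _; exact/esym/E1.
by rewrite H2; apply: eq_cintegral => u _; exact: E2.
Qed.

End WithSource.

End FractionalIntegral.

(** * Convolution of the source with Mittag-Leffler kernels *)

Section SourceConvolution.
Context {R : realType}.
Local Notation mu := (@lebesgue_measure R).
Variables (n : nat) (a : nat -> R) (nu : nat -> R[i]) (f0 : R -> R[i]).
Hypothesis n_gt0 : (0 < n)%N.
Hypothesis nu_gt0 : forall j : nat, (1 <= j <= n)%N -> 0 < complex.Re (nu j).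
Hypothesis a_gt0 : forall j : nat, (1 <= j <= n)%N -> 0 < a j.
Hypothesis mf0 : cmeas setT f0.
Hypothesis f0_neg : forall u, u < 0 -> f0 u = 0.
Hypothesis f0_frac : forall j t, (1 <= j <= n)%N ->
  (\int[mu]_u (pwr (complex.Re (nu j)) (t - u) * normc (f0 u))%:E < +oo)%E.

Let ladder := ladder n nu.
Let pwsum := pwsum n nu.
Let fracsum := fracsum n nu f0.
Let fracsumr := fracsumr n nu f0.
Let frac := frac f0.

Let one_n : (1 <= 1 <= n)%N. Proof. by rewrite leqnn. Qed.

Lemma ladder_eq0 m z : ladder m z -> (z == 0) = (m == 0)%N.
Proof.
case: m => [|m lz]; first by move=> ->; rewrite eqxx.
by apply/negbTE/eqP => z0; have := ladder_Re nu_gt0 lz; rewrite z0 /= ltxx.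
Qed.

Definition fracint (z : R[i]) (t : R) : R[i] := if z == 0 then f0 t else frac z t.

(** The summand |f0| covers order 0, where [fracint] is f0 itself. *)
Definition envelope (t : R) : R := fracsumr t + normc (f0 t).

Lemma envelope_ge0 t : 0 <= envelope t.
Proof. by rewrite addr_ge0 ?normc_ge0 ?fracsumr_ge0. Qed.

Lemma fracint_neg m z t : ladder m z -> t < 0 -> fracint z t = 0.
Proof.
by move=> lz t0; rewrite /fracint; case: ifP => _; [exact: f0_neg|exact/(frac_neg f0_neg)/ltW].
Qed.

Lemma fracint_bound (T th : R) : 0 < T -> 0 < th -> exists2 C : R, 0 < C &
  forall m z t, ladder m z -> t <= T -> normc (fracint z t) <= C * th ^+ m * envelope t.
Proof.
move=> T0 th0; have [C C0 h] := frac_bound nu_gt0 mf0 f0_neg f0_frac T0 th0.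
exists (C + 1); first by rewrite addr_gt0.
move=> m z t lz tT; rewrite /fracint (ladder_eq0 lz).
case: m lz => [|m] lz /=.
  rewrite expr0 mulr1 -[leLHS]mul1r; apply: ler_pM => //; first exact: normc_ge0.
    by rewrite lerDr ltW.
  by rewrite lerDr; exact: fracsumr_ge0.
apply: le_trans (h _ _ t lz tT) _; apply: ler_pM.
- by rewrite mulr_ge0 ?exprn_ge0 ?(ltW C0) ?(ltW th0).
- exact: fracsumr_ge0.
- by rewrite ler_wpM2r ?exprn_ge0 ?(ltW th0)// lerDl.
- by rewrite lerDl normc_ge0.
Qed.

Lemma fracint_semigroup m z j t : ladder m z -> (1 <= j <= n)%N ->
  cintegrable setT (fun v : R => gk (nu j) (t - v) * fracint z v) /\
  cintegral setT (fun v : R => gk (nu j) (t - v) * fracint z v) = fracint (z + nu j) t.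
Proof.
move=> lz jn.
have lzj : ladder m.+1 (z + nu j) by exists z, j.
have E : fracint (z + nu j) t = frac (z + nu j) t by rewrite /fracint (ladder_eq0 lzj).
rewrite E; case: m lz lzj {E} => [|m] lz lzj.
  have fz : fracint z = f0 by apply/funext => v; rewrite /fracint (ladder_eq0 lz).
  rewrite fz; move: lzj; rewrite (_ : z = 0) ?add0r// => lzj; split => //.
  exact: (cintegrable_frac nu_gt0 mf0 f0_neg f0_frac t lzj).
have fz : fracint z = frac z by apply/funext => v; rewrite /fracint (ladder_eq0 lz).
by rewrite fz; exact: (frac_semigroup nu_gt0 mf0 f0_neg f0_frac t lz jn).
Qed.

Let mN : measurable_fun setT (fun u : R => normc (f0 u)).
Proof. exact: measurable_normc. Qed.

Let measurable_conv (x t : R) (g : R -> R) : measurable_fun setT g ->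
  measurable_fun setT (fun v : R => pwr x (t - v) * g v).
Proof.
move=> mg; apply: measurable_funM => //.
by apply: (measurableT_comp (measurable_pwr x)); exact: measurable_funB.
Qed.

Let measurable_pwsum : measurable_fun setT pwsum.
Proof. by apply: measurable_sum => j; exact: measurable_pwr. Qed.

Let mconv2 : measurable_fun setT
  (fun p : R * R => (pwsum (p.1 - p.2) * normc (f0 p.2))%:E).
Proof.
apply/measurable_EFinP; apply: measurable_funM.
  by apply: (measurableT_comp measurable_pwsum); exact: measurable_sub12.
exact: (measurableT_comp mN measurable_snd).
Qed.

Let measurable_fracsum : measurable_fun setT fracsum.
Proof.
apply: (@measurable_fun_fubini_tonelli_F _ _ _ _ _ mu
  (fun p : R * R => (pwsum (p.1 - p.2) * normc (f0 p.2))%:E)) => //.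
by move=> p; rewrite lee_fin mulr_ge0 ?normc_ge0 ?pwsum_ge0.
Qed.

Let measurable_fracsumr : measurable_fun setT fracsumr.
Proof.
by apply: (measurableT_comp (f := fine) _ measurable_fracsum).
Qed.

(** The envelope dominates the Neumann partial sums, so it must admit one more integration of order
    Re nu_j. Its i-th part becomes, up to a Beta factor, the integral of order Re(nu_i + nu_j) of
    |f0|, that is, a sum of two orders. *)
Lemma integrable_envelope j t : (1 <= j <= n)%N ->
  mu.-integrable setT (EFin \o (fun v : R => pwr (complex.Re (nu j)) (t - v) * envelope v)).
Proof.
move=> jn; set x := complex.Re _.
have x0 : 0 < x := nu_gt0 jn.
have i1 : mu.-integrable setT (EFin \o (fun v : R => pwr x (t - v) * normc (f0 v))).
  apply/integrableP; split; first by apply/measurable_EFinP; exact: measurable_conv.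
  under eq_integral do rewrite /= ger0_norm ?mulr_ge0 ?normc_ge0 ?pwr_ge0//.
  exact: f0_frac.
suff i2 : mu.-integrable setT (EFin \o (fun v : R => pwr x (t - v) * fracsumr v)).
  have := integrableD measurableT i2 i1; apply: eq_integrable => // v _ /=.
  by rewrite -EFinD mulrDr.
apply/integrableP; split; first by apply/measurable_EFinP; exact: measurable_conv.
under eq_integral do rewrite /= ger0_norm ?mulr_ge0 ?pwr_ge0 ?fracsumr_ge0//.
pose G i v := (\int[mu]_u (pwr x (t - v) * (pwr (complex.Re (nu i)) (v - u) * normc (f0 u)))%:E)%E.
have EG v : ((pwr x (t - v) * fracsumr v)%:E = \sum_(1 <= i < n.+1) G i v)%E.
  rewrite EFinM -(fracsumrE mf0 f0_frac) (fracsumE n nu mf0)//.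
  rewrite ge0_sume_distrr; last first.
    by move=> i _; apply: integral_ge0 => u _; rewrite lee_fin mulr_ge0 ?pwr_ge0 ?normc_ge0.
  apply: eq_bigr => i _; apply/esym/ge0_integralMl; last exact: pwr_ge0.
    exact: measurable_conv.
  by move=> u; rewrite mulr_ge0 ?pwr_ge0 ?normc_ge0.
have G0 i v : (0 <= G i v)%E.
  by apply: integral_ge0 => u _; rewrite lee_fin !mulr_ge0 ?pwr_ge0 ?normc_ge0.
have mG i : measurable_fun setT (G i).
  apply: (@measurable_fun_fubini_tonelli_F _ _ _ _ _ mu (fun p : R * R =>
      (pwr x (t - p.1) * (pwr (complex.Re (nu i)) (p.1 - p.2) * normc (f0 p.2)))%:E)) => //.
    apply/measurable_EFinP; apply: measurable_funM.
      apply: (measurableT_comp (measurable_pwr x)).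
      by apply: measurable_funB => //; exact: measurable_fst.
    apply: measurable_funM; last exact: (measurableT_comp mN measurable_snd).
    by apply: (measurableT_comp (measurable_pwr _)); exact: measurable_sub12.
  by move=> p; rewrite lee_fin !mulr_ge0 ?pwr_ge0 ?normc_ge0.
under eq_integral do rewrite EG.
rewrite ge0_integral_sum// big_nat_cond; apply: lte_sum_pinfty => i /andP[/andP[i1' iN] _].
have in_ : (1 <= i <= n)%N by rewrite i1'.
rewrite /G (tonelli_conv x (complex.Re (nu i)) t mN (fun u => normc_ge0 _)).
have l2 : ladder 2 (nu i + nu j) by exists (nu i), j; split => //; exists 0, i; rewrite add0r.
rewrite betrE ?nu_gt0//; apply: lte_mul_pinfty => //; first by rewrite lee_fin betr_ge0.
have := @frac_pwr_lty _ n nu f0 nu_gt0 mf0 f0_neg f0_frac 1 _ t l2.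
by rewrite raddfD/= addrC.
Qed.

Definition mlconv l c t : R[i] := cintegral setT (fun u : R => mlk a nu l c (t - u) * f0 u).

Definition mlcoef l k : R[i] := 'C(l + k, k)%:R * (- (a 1%N)%:C) ^+ k.

Let integrable_ktf l c k t : ladder l c ->
  cintegrable setT (fun u : R => kt a nu l c k (t - u) * f0 u) /\
  cintegral setT (fun u : R => kt a nu l c k (t - u) * f0 u) =
  mlcoef l k * frac (nu 1%N * k%:R + c) t.
Proof.
move=> lc; have lk := ladder_nu1 n_gt0 k lc.
have i1 := cintegrable_frac nu_gt0 mf0 f0_neg f0_frac t lk.
have E (u : R) : mlcoef l k * (gk (nu 1%N * k%:R + c) (t - u) * f0 u) =
  kt a nu l c k (t - u) * f0 u by rewrite mulrA.
split.
  have := cintegrableZ (mlcoef l k) measurableT i1.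
  by apply: eq_cintegrable => // u _; exact: E.
apply: etrans _ (cintegralZ (mlcoef l k) measurableT i1).
by apply: eq_cintegral => u _; exact/esym/E.
Qed.

(** The kernel series is integrated term by term: with th = 1/2 its partial sums are at most 2 C
    [pwsum], whatever the number of terms. *)
Lemma mlconv_cto l c t : ladder l c ->
  cto (series (fun k => mlcoef l k * frac (nu 1%N * k%:R + c) t)) (mlconv l c t).
Proof.
move=> lc; pose T := `|t| + 1; have T0 : 0 < T by rewrite ltr_wpDl.
have h2 : 0 < (2^-1 : R) by rewrite invr_gt0.
have [C C0 h] := kt_bound n_gt0 nu_gt0 a_gt0 T0 h2.
pose U m (u : R) := series (fun k => kt a nu l c k (t - u) * f0 u) m.
have iU m : cintegrable setT (U m).
  by apply: cintegrable_sum => // k _; have [] := integrable_ktf k t lc.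
have ih : mu.-integrable setT
    (EFin \o (fun u : R => 2 * C * (pwsum (t - u) * normc (f0 u)))).
  by apply: (@integrableZl _ _ _ _ _ _ (2 * C) _ (integrable_pwsumN mf0 f0_frac t)).
have p1 m : cmeas setT (U m) by have [] := (cintegrableP _ measurableT).1 (iU m).
have p2 u : setT u -> cto (U ^~ u) (mlk a nu l c (t - u) * f0 u).
  move=> _; have := ctoZ (f0 u) (mlk_cto n_gt0 nu_gt0 a_gt0 (t - u) lc).
  rewrite mulrC; apply: cto_ext => m; rewrite /U /series/= mulr_sumr.
  by apply: eq_bigr => k _; rewrite mulrC.
have p3 m u : setT u -> normc (U m u) <= 2 * C * (pwsum (t - u) * normc (f0 u)).
  move=> _; have [u0|u0] := leP 0 u; last first.
    by rewrite f0_neg// normc0 !mulr0 /U /series /= big1 ?normc0// => k _; rewrite f0_neg// mulr0.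
  rewrite /U /series /= -mulr_suml normcM mulrA ler_wpM2r ?normc_ge0//.
  have tu : t - u <= T.
    by rewrite /T lerBlDr (le_trans (ler_norm t))// -addrA lerDl addr_ge0.
  apply: le_trans (normc_sum _ _ _) _.
  apply: le_trans (_ : \sum_(0 <= k < m) (C * pwsum (t - u)) * 2^-1 ^+ k <= _).
    apply: ler_sum => k _; apply: le_trans (h l c k _ lc tu) _.
    rewrite mulrAC ler_wpM2l ?mulr_ge0 ?(ltW C0) ?pwsum_ge0//.
    rewrite exprD ler_piMl ?exprn_ge0 ?(ltW h2)// exprn_ile1 ?(ltW h2)//.
    by rewrite invf_le1 ?ler1n.
  rewrite -mulrA -[leRHS]mulr1.
  by apply: le_trans (geometric_sum_le 0 m _ _ (lexx _)) _;
    rewrite ?mulr1 ?mulr_ge0 ?(ltW C0) ?pwsum_ge0 ?(ltW h2).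
have [_ lim] := cdominated measurableT p1 p2 ih p3.
move: lim; apply: cto_ext => m.
rewrite /U /series/= cintegral_sum//; last by move=> k _; have [] := integrable_ktf k t lc.
by apply: eq_bigr => k _; have [] := integrable_ktf k t lc.
Qed.

(** The expansions through [frac] and through [fracint] differ only for k = 0 and c = 0, where the
    kernel is 0 and [fracint] is f0; the separate summand makes up for it. All later orders are
    nonzero. *)
Lemma ml_expansion l c t : ladder l c ->
  cto (series (fun k => mlcoef l k * fracint (nu 1%N * k%:R + c) t))
    ((if c == 0 then f0 t else 0) + mlconv l c t).
Proof.
move=> lc.
apply/cto_shiftS.
have := ctoD (cto_cst (if c == 0 then f0 t else 0)) ((cto_shiftS _ _).2 (mlconv_cto t lc)).
apply: cto_ext => m; rewrite /series/= !big_nat_recl//= addrA; congr (_ + _); last first.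
  apply: eq_bigr => k _; rewrite /fracint (ladder_eq0 (ladder_nu1 n_gt0 k.+1 lc)).
  by rewrite addnS.
rewrite mulr0 add0r /fracint /mlcoef addn0 bin0 mulr1 mul1r.
case: ifP => [/eqP ->|_]; last by rewrite add0r mul1r.
rewrite [frac 0 t](_ : _ = 0) ?mulr0 ?addr0 ?mul1r// /frac.
rewrite -[RHS](cintegral0 setT); apply: eq_cintegral => u _.
by rewrite gk0 mul0r.
Qed.

End SourceConvolution.

(** * Multinomial expansion in the orders nu_2, ..., nu_n *)

Section MultinomialSum.
Context {R : realType}.
Variables (n : nat) (a : nat -> R) (nu : nat -> R[i]).
Implicit Types (G : R[i] -> R[i]) (l : nat).

(** For G(z) = I^z f0 this is (sum_(j >= 2) a_j I^(nu_j))^l f0 in expanded form; leaving G arbitrary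
    separates the algebra from the analysis. *)
Definition multinomial_sum l G : R[i] :=
  \sum_(r : multi_exponent n l | weight r == l)
    multinomial_coef r * coef_prod a r * G (order_sum nu r).

Let d := n.-1.

Let incr l (m : 'I_d) (r : multi_exponent n l) : multi_exponent n l.+1 :=
  [ffun x => inord (r x + (x == m))].

Let decr l (m : 'I_d) (r : multi_exponent n l.+1) : multi_exponent n l :=
  [ffun x => inord (r x - (x == m))].

Let incrE l m (r : multi_exponent n l) x : incr m r x = (r x + (x == m))%N :> nat.
Proof.
rewrite ffunE inordK// ltnS; have := ltn_ord (r x); rewrite ltnS => rx.
by rewrite (leq_trans (leq_add rx (leq_b1 (x == m))))// addn1.
Qed.

Let weight_le l (r : multi_exponent n l) x : (r x <= weight r)%N.
Proof. by rewrite /weight (bigD1 x)//= leq_addr. Qed.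

Let decrE l m (r : multi_exponent n l.+1) x : weight r = l.+1 -> (0 < r m)%N ->
  decr m r x = (r x - (x == m))%N :> nat.
Proof.
move=> wr rm; rewrite ffunE inordK// ltnS; have [->|xm] := eqVneq x m.
  by rewrite leq_subLR add1n; apply: leq_trans (weight_le r m) _; rewrite wr.
(* Any other entry is at most l, because the total is l + 1 and the entry at [m] takes at least
   one. *)
rewrite subn0 -ltnS; apply: (@leq_trans (weight r)); last by rewrite wr.
rewrite /weight (bigD1 m)//= (bigD1 x)//=.
by rewrite -[X in (X < _)%N]add0n -addSn; apply: leq_add => //; rewrite leq_addr.
Qed.

Let weight_incr l m (r : multi_exponent n l) : weight (incr m r) = (weight r).+1.
Proof.
rewrite /weight; under eq_bigr do rewrite incrE.
rewrite big_split /= [X in (_ + X)%N](_ : _ = 1%N) ?addn1//.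
by rewrite (bigD1 m)//= eqxx big1 ?addn0// => x /negbTE ->.
Qed.

Let incrK l m (r : multi_exponent n l) : weight r = l -> decr m (incr m r) = r.
Proof.
move=> wr; apply/ffunP => x; apply/val_inj => /=.
by rewrite decrE ?weight_incr ?wr// ?incrE ?eqxx ?addn1// addnK.
Qed.

Let decrK l m (r : multi_exponent n l.+1) : weight r = l.+1 -> (0 < r m)%N ->
  incr m (decr m r) = r.
Proof.
move=> wr rm; apply/ffunP => x; apply/val_inj => /=.
by rewrite incrE decrE// subnK//; have [->|] := eqVneq x m.
Qed.

Let reindex_incr l m (F : multi_exponent n l.+1 -> R[i]) :
  \sum_(r : multi_exponent n l.+1 | (weight r == l.+1) && (0 < r m)%N) F r =
  \sum_(r : multi_exponent n l | weight r == l) F (incr m r).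
Proof.
rewrite (reindex_onto (incr m) (decr m)) => [|r /andP[/eqP wr rm]]; last exact: decrK.
apply: eq_bigl => r; rewrite weight_incr eqSS incrE eqxx addn1 andbT.
by case: eqP => //= wr; rewrite incrK ?eqxx.
Qed.

Let fact_neq0 k : k`!%:R != 0 :> R[i].
Proof. by rewrite pnatr_eq0 -lt0n fact_gt0. Qed.

(** The absorption rule (r_m + 1) (l+1)!/(r_m + 1)! = (l+1) l!/r_m!, the other factorials being
    common to both sides. *)
Let coef_incr l m (r : multi_exponent n l) :
  (incr m r m)%:R * (multinomial_coef (incr m r) * coef_prod a (incr m r)) =
  l.+1%:R * ((a m.+2)%:C * (multinomial_coef r * coef_prod a r)) :> R[i].
Proof.
have P1 : \prod_(x < d) ((incr m r x)`!)%:R = (r m).+1%:R * \prod_(x < d) ((r x)`!)%:R :> R[i].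
  rewrite (bigD1 m)//= [in RHS](bigD1 m)//= incrE eqxx addn1 factS natrM -mulrA.
  congr (_ * (_ * _)); apply: eq_bigr => x /negbTE xm.
  by rewrite incrE xm addn0.
have P2 : coef_prod a (incr m r) = (a m.+2)%:C * coef_prod a r.
  rewrite /coef_prod (bigD1 m)//= [in RHS](bigD1 m)//= incrE eqxx addn1 exprS -mulrA.
  congr (_ * (_ * _)); apply: eq_bigr => x /negbTE xm.
  by rewrite incrE xm addn0.
have P0 : \prod_(x < d) ((r x)`!)%:R != 0 :> R[i].
  by apply/prodf_neq0 => x _; exact: fact_neq0.
rewrite /multinomial_coef P1 P2 incrE eqxx addn1 factS natrM.
move: P0; move: (\prod_(x < d) _) (coef_prod a r) (a _)%:C => P c e P0.
by field; rewrite P0 -[1]/1%:R -natrD pnatr_eq0.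
Qed.

Let order_incr l m (r : multi_exponent n l) :
  order_sum nu (incr m r) = order_sum nu r + nu m.+2.
Proof.
rewrite /order_sum; under eq_bigr do rewrite incrE natrD mulrDl.
rewrite big_split /=; congr (_ + _).
by rewrite (bigD1 m)//= eqxx mul1r big1 ?addr0// => x /negbTE ->; rewrite mul0r.
Qed.

(* Split l+1 = sum_m r_m in (l+1)! / prod_m r_m! and lower r_m by one. *)
Lemma multinomial_sumS l G : multinomial_sum l.+1 G =
  \sum_(2 <= j < n.+1) (a j)%:C * multinomial_sum l (fun z => G (z + nu j)).
Proof.
have l1 : l.+1%:R != 0 :> R[i] by rewrite pnatr_eq0.
apply: (mulfI l1).
transitivity (\sum_(m < d) \sum_(r : multi_exponent n l.+1 | (weight r == l.+1) && (0 < r m)%N)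
    (r m)%:R * (multinomial_coef r * coef_prod a r) * G (order_sum nu r)).
  rewrite /multinomial_sum mulr_sumr.
  transitivity (\sum_(r : multi_exponent n l.+1 | weight r == l.+1) \sum_(m < d)
      (r m)%:R * (multinomial_coef r * coef_prod a r) * G (order_sum nu r)).
    apply: eq_bigr => r /eqP wr; rewrite -!mulr_suml -natr_sum.
    have <- : (weight r)%:R = l.+1%:R :> R[i] by rewrite wr.
    by rewrite /weight !mulrA.
  rewrite exchange_big /=; apply: eq_bigr => m _.
  rewrite [LHS](bigID (fun r : multi_exponent n l.+1 => (0 < r m)%N))/=.
  rewrite [X in _ + X]big1 ?addr0// => r /andP[_].
  by rewrite -eqn0Ngt => /eqP ->; rewrite !mul0r.
rewrite mulr_sumr.
have -> : (2 = 0 + 2)%N by []. 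
rewrite big_addn subSS subn1 big_mkord; apply: eq_bigr => m _.
rewrite reindex_incr addn2 /multinomial_sum !mulr_sumr; apply: eq_bigr => r _.
by rewrite coef_incr order_incr !mulrA.
Qed.

Lemma multinomial_sum0 G : multinomial_sum 0 G = G 0.
Proof.
pose r0 : multi_exponent n 0 := [ffun=> ord0].
have r0E (x : 'I_d) : r0 x = 0%N :> nat by rewrite ffunE.
rewrite /multinomial_sum (big_pred1 r0) => [|r]; last first.
  apply/eqP/eqP => [_|->]; last by rewrite /weight big1.
  by apply/ffunP => x; apply/val_inj; rewrite /= r0E; case: (r x) => -[].
rewrite /multinomial_coef /coef_prod /order_sum.
rewrite [X in _ / X]big1; last by move=> x _; rewrite r0E.
rewrite [X in _ * X * _]big1; last by move=> x _; rewrite r0E.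
rewrite [X in G X]big1; last by move=> x _; rewrite r0E mul0r.
by rewrite divr1 mulr1 mul1r.
Qed.

Lemma order_sum_ladder l (r : multi_exponent n l) : weight r = l ->
  ladder n nu l (order_sum nu r).
Proof.
have add k m z j : (1 <= j <= n)%N -> ladder n nu m z -> ladder n nu (m + k) (z + k%:R * nu j).
  move=> jn lz; elim: k => [|k IH]; first by rewrite addn0 mul0r addr0.
  by rewrite addnS; exists (z + k%:R * nu j), j; split => //; rewrite -natr1 mulrDl mul1r addrA.
have key (s : seq 'I_d) : ladder n nu (\sum_(m <- s) r m)%N (\sum_(m <- s) (r m)%:R * nu m.+2).
  elim: s => [|m s IH]; first by rewrite !big_nil.
  rewrite !big_cons addnC addrC; apply: add => //.
  by have := ltn_ord m; rewrite ltn_predRL.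
by move=> wr; have := key (index_enum _); rewrite -/(weight r) wr.
Qed.

Lemma eq_multinomial_sum l G G' : (forall z, ladder n nu l z -> G z = G' z) ->
  multinomial_sum l G = multinomial_sum l G'.
Proof.
move=> GG'; apply: eq_bigr => r /eqP wr; congr (_ * _); apply: GG'.
exact: order_sum_ladder.
Qed.

Lemma multinomial_sum_sum l (I : Type) (s : seq I) (G : I -> R[i] -> R[i]) :
  multinomial_sum l (fun z => \sum_(i <- s) G i z) = \sum_(i <- s) multinomial_sum l (G i).
Proof.
rewrite /multinomial_sum exchange_big /=; apply: eq_bigr => r _.
by rewrite mulr_sumr.
Qed.

Lemma multinomial_sumZ l (c : R[i]) G :
  multinomial_sum l (fun z => c * G z) = c * multinomial_sum l G.
Proof.
by rewrite /multinomial_sum mulr_sumr; apply: eq_bigr => r _; rewrite mulrCA.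
Qed.

Lemma multinomial_sum_cto l (u : R[i] -> nat -> R[i]) v :
  (forall z, ladder n nu l z -> cto (u z) (v z)) ->
  cto (fun m => multinomial_sum l (u ^~ m)) (multinomial_sum l v).
Proof.
move=> uv; apply: cto_sum => r /eqP wr; apply: ctoZ; apply: uv.
exact: order_sum_ladder.
Qed.

(** Induction along the recursion: each step contributes the factor sum_(j >= 2) a_j, which takes
    the place of the multinomial theorem. *)
Lemma normc_multinomial_sum l G (B : R) :
  (forall j, (1 <= j <= n)%N -> 0 < a j) ->
  (forall z, ladder n nu l z -> normc (G z) <= B) ->
  normc (multinomial_sum l G) <= (\sum_(2 <= j < n.+1) a j) ^+ l * B.
Proof.
move=> a0; elim: l G => [|l IH] G GB.
  by rewrite multinomial_sum0 expr0 mul1r; exact: GB.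
rewrite multinomial_sumS exprS -mulrA mulr_suml.
apply: le_trans (normc_sum _ _ _) _.
rewrite big_nat_cond [leRHS]big_nat_cond; apply: ler_sum => j /andP[/andP[j2 jn] _].
have jn' : (1 <= j <= n)%N by rewrite (leq_trans _ j2).
rewrite normcM normc_real gtr0_norm ?a0// ler_wpM2l ?(ltW (a0 _ _))//.
by apply: IH => z lz; apply: GB; exists z, j.
Qed.

Lemma cintegral_multinomial_sum l (D : set R) (g : R -> R[i]) (h : R[i] -> R -> R[i]) :
  measurable D -> (forall z, ladder n nu l z -> cintegrable D (fun v => g v * h z v)) ->
  cintegrable D (fun v => g v * multinomial_sum l (h ^~ v)) /\
  cintegral D (fun v => g v * multinomial_sum l (h ^~ v)) =
  multinomial_sum l (fun z => cintegral D (fun v => g v * h z v)).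
Proof.
move=> mD ih.
have E : (fun v => g v * multinomial_sum l (h ^~ v)) = (fun v =>
    \sum_(r : multi_exponent n l | weight r == l)
    multinomial_coef r * coef_prod a r * (g v * h (order_sum nu r) v)).
  by apply/funext => v; rewrite mulr_sumr; apply: eq_bigr => r _; rewrite mulrCA.
have ir (r : multi_exponent n l) : weight r == l ->
    cintegrable D (fun v => g v * h (order_sum nu r) v).
  by move=> /eqP wr; exact/ih/order_sum_ladder.
rewrite E; split.
  by apply: cintegrable_sum => // r wr; apply: cintegrableZ => //; exact: ir.
rewrite cintegral_sum//; last by move=> r wr; apply: cintegrableZ => //; exact: ir.
by apply: eq_bigr => r wr; rewrite cintegralZ//; exact: ir.
Qed.

End MultinomialSum.

(** * Summation by diagonals *)

Section DiagonalSummation.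

(** Pascal's rule in summed form: the passage from power m to power m + 1 of a sum of two commuting
    operators. *)
Lemma pascal_sum (V : nzRingType) (g : nat -> V) m :
  \sum_(k < m.+1) 'C(m, k)%:R * (g k.+1 + g k) = \sum_(k < m.+2) 'C(m.+1, k)%:R * g k.
Proof.
rewrite [RHS]big_ord_recl /= bin0 mul1r.
under [in RHS]eq_bigr do rewrite /bump /= add1n binS natrD mulrDl.
under [in LHS]eq_bigr do rewrite mulrDr.
rewrite !big_split /= [RHS]addrA [LHS]addrC; congr (_ + _).
have -> : g 0%N = 'C(m, 0)%:R * g 0%N by rewrite bin0 mul1r.
rewrite -(big_ord_recl m.+1 (fun k => 'C(m, k)%:R * g k)) [RHS]big_ord_recr /=.
by rewrite bin_small// mul0r addr0.
Qed.

Lemma triangle_sum (V : nmodType) (x : nat -> nat -> V) L :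
  \sum_(m < L) \sum_(k < m.+1) x (m - k)%N k = \sum_(l < L) \sum_(k < L - l) x l k.
Proof.
elim: L => [|L IH]; first by rewrite !big_ord0.
rewrite big_ord_recr /= IH.
transitivity (\sum_(l < L.+1) (\sum_(k < L - l) x l k + x l (L - l)%N)); last first.
  apply: eq_bigr => l _; rewrite subSn; last by rewrite -ltnS.
  by rewrite big_ord_recr.
rewrite big_split /= [X in _ = X + _]big_ord_recr /= subnn big_ord0 addr0; congr (_ + _).
rewrite (reindex_inj rev_ord_inj) /=; apply: eq_bigr => k _.
by rewrite subSS subKn// -ltnS.
Qed.

Variable R : realType.

(** The first L diagonals fill the triangle l + k < L, so row l < L lacks its tail from L - l on, at
    most 2 C 4^(-L). The L rows together lack at most 2 C L 4^(-L) <= 2 C 2^(-L). *)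
Lemma diagonal_cto (x : nat -> nat -> R[i]) (y : nat -> R[i]) (S : R[i]) (C : R) :
  0 <= C -> (forall l k, normc (x l k) <= C * 4^-1 ^+ (l + k)) ->
  (forall l, cto (series (x l)) (y l)) ->
  cto (series (fun m => \sum_(k < m.+1) x (m - k)%N k)) S -> cto (series y) S.
Proof.
move=> C0 xC xy hS; apply: (cto_near0 hS).
have q0 : 0 <= 4^-1 :> R by rewrite invr_ge0.
have q2 : 4^-1 <= 2^-1 :> R by rewrite lef_pV2 ?posrE// ler_nat.
have B L : normc (series (fun m => \sum_(k < m.+1) x (m - k)%N k) L - series y L) <=
    2 * C * 2^-1 ^+ L.
  rewrite /series/= !big_mkord triangle_sum -sumrB.
  apply: le_trans (normc_sum _ _ _) _.
  apply: le_trans (_ : \sum_(l < L) 2 * C * 4^-1 ^+ L <= _).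
    apply: ler_sum => l _; rewrite -normcN opprB.
    have := geometric_tail_le (L - l) (C := C * 4^-1 ^+ l) _ q0 q2 _ (xy l).
    rewrite /series/= big_mkord -!mulrA -exprD subnKC; last exact: ltnW.
    by apply; [rewrite mulr_ge0// exprn_ge0|move=> k; rewrite -mulrA -exprD; exact: xC].
  rewrite sumr_const card_ord -[_ *+ L]mulr_natl mulrCA ler_wpM2l ?mulr_ge0//.
  have -> : 4^-1 = 2^-1 * 2^-1 :> R by rewrite -invfM -natrM.
  rewrite exprMn mulrA ler_piMl ?exprn_ge0 ?invr_ge0//.
  rewrite exprVn ler_pdivrMr ?exprn_gt0// mul1r -natrX ler_nat.
  exact/ltnW/ltn_expl.
apply: (@squeeze_cvgr _ _ _ _ (fun=> 0) (fun L => 2 * C * 2^-1 ^+ L)).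
- by apply: nearW => L; rewrite normc_ge0 B.
- exact: cvg_cst.
- rewrite -[X in _ --> X](mulr0 (2 * C)); apply: cvgMr; apply: cvg_expr.
  by rewrite ger0_norm ?invr_ge0// invf_lt1 ?ltr1n.
Qed.

End DiagonalSummation.

(** * The Neumann series and the kinetic equation *)

Section IteratedKinetic.
Context {R : realType}.
Local Notation mu := (@lebesgue_measure R).
Variables (n : nat) (a : nat -> R) (nu : nat -> R[i]) (f0 : R -> R[i]).
Hypothesis n_gt0 : (0 < n)%N.
Hypothesis nu_gt0 : forall j : nat, (1 <= j <= n)%N -> 0 < complex.Re (nu j).
Hypothesis a_gt0 : forall j : nat, (1 <= j <= n)%N -> 0 < a j.
Hypothesis mf0 : cmeas setT f0.
Hypothesis f0_neg : forall u, u < 0 -> f0 u = 0.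
Hypothesis f0_frac : forall j t, (1 <= j <= n)%N ->
  (\int[mu]_u (pwr (complex.Re (nu j)) (t - u) * normc (f0 u))%:E < +oo)%E.

Let ladder := ladder n nu.
Let msum := multinomial_sum n a nu.
Let env := envelope n nu f0.

(* (-1)^l (-a_1)^k (sum_(j >= 2) a_j I^{nu_j})^l I^{k nu_1} f0 *)
Definition mixed_term l k t : R[i] := (-1) ^+ l * (- (a 1%N)%:C) ^+ k *
  msum l (fun c => fracint f0 (nu 1%N * k%:R + c) t).

(* (- sum_j a_j I^{nu_j})^m f0 *)
Definition neumann_term m t : R[i] :=
  \sum_(k < m.+1) 'C(m, k)%:R * mixed_term (m - k) k t.

Lemma mixed_term_neg l k t : t < 0 -> mixed_term l k t = 0.
Proof.
move=> t0; rewrite /mixed_term [msum _ _](_ : _ = 0) ?mulr0//.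
rewrite -[RHS](mul0r (msum l (fun=> 0))) /msum -multinomial_sumZ.
apply: eq_multinomial_sum => c lc; rewrite mul0r.
exact: (fracint_neg f0_neg (ladder_nu1 n_gt0 k lc) t0).
Qed.

Lemma neumann_term0 t : neumann_term 0 t = f0 t.
Proof.
rewrite /neumann_term big_ord1 bin0 mul1r /mixed_term /msum !expr0 !mul1r multinomial_sum0.
by rewrite mulr0 addr0 /fracint eqxx.
Qed.

(** [A] exceeds both a_1 and sum_(j >= 2) a_j, so the coefficients amount to at most [A]^(l+k), and
    th = 1/(8 [A]) compensates them. The rate 1/8 leaves 1/4 after a binomial of at most 2^(l+k). *)
Lemma mixed_term_bound (T : R) : 0 < T -> exists2 C : R, 0 < C & forall l k t, t <= T ->
  normc (mixed_term l k t) <= C * 8^-1 ^+ (l + k) * env t.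
Proof.
move=> T0; have a0 : 0 < a 1%N by rewrite a_gt0// leqnn.
pose b := \sum_(2 <= j < n.+1) a j.
have b0 : 0 <= b.
  rewrite /b big_nat_cond sumr_ge0// => j /andP[/andP[j2 jn] _].
  by rewrite ltW// a_gt0// (leq_trans _ j2).
pose A := 1 + a 1%N + b.
have A0 : 0 < A by rewrite ltr_pwDl ?addr_gt0.
have th0 : 0 < 8^-1 / A by rewrite divr_gt0 ?invr_gt0.
have [C C0 h] := fracint_bound nu_gt0 mf0 f0_neg f0_frac T0 th0.
exists C => // l k t tT; rewrite /mixed_term !normcM !normcX !normcN normc1 expr1n mul1r.
rewrite normc_real gtr0_norm//.
apply: le_trans (_ : a 1%N ^+ k * (b ^+ l * (C * (8^-1 / A) ^+ (l + k) * env t)) <= _).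
  rewrite ler_wpM2l ?exprn_ge0 ?(ltW a0)//; apply: normc_multinomial_sum => // c lc.
  exact: h (ladder_nu1 n_gt0 k lc) tT.
have e0 : 0 <= env t := envelope_ge0 n nu f0 t.
have p0 : 0 <= (8^-1 / A) ^+ (l + k) by rewrite exprn_ge0// ltW.
have -> : C * 8^-1 ^+ (l + k) = A ^+ (l + k) * (C * (8^-1 / A) ^+ (l + k)).
  by rewrite mulrCA -exprMn mulrCA mulfV ?mulr1// gt_eqF.
rewrite !mulrA -!mulrA ![leRHS]mulrA -!mulrA mulrA.
apply: ler_wpM2r; first by rewrite !mulr_ge0// ltW.
rewrite exprD mulrC; apply: ler_pM; rewrite ?exprn_ge0 ?(ltW a0)//.
  by apply: lerXn2r; rewrite ?nnegrE ?(ltW A0)// lerDr addr_ge0 ?(ltW a0).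
by apply: lerXn2r; rewrite ?nnegrE ?(ltW A0) ?(ltW a0)// /A addrAC lerDr addr_ge0.
Qed.

Lemma neumann_term_bound (T : R) : 0 < T -> exists2 C : R, 0 < C & forall m t, t <= T ->
  normc (neumann_term m t) <= C * env t * 4^-1 ^+ m.
Proof.
move=> T0; have [C C0 h] := mixed_term_bound T0; exists C => // m t tT.
apply: le_trans (normc_sum _ _ _) _.
apply: le_trans (_ : \sum_(k < m.+1) 'C(m, k)%:R * (C * 8^-1 ^+ m * env t) <= _).
  apply: ler_sum => k _; rewrite normcM normc_nat ler_wpM2l//.
  by have := h (m - k)%N k t tT; rewrite subnK// -ltnS.
rewrite -mulr_suml -natr_sum.
have -> : (\sum_(k < m.+1) 'C(m, k) = 2 ^ m)%N.
  rewrite -[2%N]/(1 + 1)%N expnDn; apply: eq_bigr => k _.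
  by rewrite !exp1n !muln1.
rewrite natrX le_eqVlt; apply/orP; left; apply/eqP.
have -> : 4^-1 = 2 * 8^-1 :> R by field.
by rewrite exprMn; ring.
Qed.

Lemma mixed_term_semigroup l k j t : (1 <= j <= n)%N ->
  cintegrable setT (fun v : R => gk (nu j) (t - v) * mixed_term l k v) /\
  cintegral setT (fun v : R => gk (nu j) (t - v) * mixed_term l k v) =
  (-1) ^+ l * (- (a 1%N)%:C) ^+ k *
    msum l (fun c => fracint f0 (nu 1%N * k%:R + c + nu j) t).
Proof.
move=> jn; pose h c v : R[i] := fracint f0 (nu 1%N * k%:R + c) v.
have sg c : ladder l c -> cintegrable setT (fun v : R => gk (nu j) (t - v) * h c v) /\
    cintegral setT (fun v : R => gk (nu j) (t - v) * h c v) =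
    fracint f0 (nu 1%N * k%:R + c + nu j) t.
  by move=> lc; exact: (fracint_semigroup nu_gt0 mf0 f0_neg f0_frac t (ladder_nu1 n_gt0 k lc) jn).
have ih c (lc : ladder l c) := (sg c lc).1.
have [i1 e1] := cintegral_multinomial_sum a (g := fun v : R => gk (nu j) (t - v)) measurableT ih.
have E (v : R) : (-1) ^+ l * (- (a 1%N)%:C) ^+ k *
    (gk (nu j) (t - v) * multinomial_sum n a nu l (h ^~ v)) =
    gk (nu j) (t - v) * mixed_term l k v by rewrite mulrCA.
split.
  have := cintegrableZ ((-1) ^+ l * (- (a 1%N)%:C) ^+ k) measurableT i1.
  by apply: eq_cintegrable => // v _; exact: E.
transitivity (cintegral setT (fun v : R => (-1) ^+ l * (- (a 1%N)%:C) ^+ k *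
    (gk (nu j) (t - v) * multinomial_sum n a nu l (h ^~ v)))).
  by apply: eq_cintegral => v _; exact/esym/E.
apply: etrans (cintegralZ _ measurableT i1) _; congr (_ * _); apply: etrans e1 _.
by apply: eq_multinomial_sum => c lc; have [] := sg c lc.
Qed.

(** The order j = 1 raises k; the orders j >= 2 together raise l, by the recursion for multinomial
    sums. The additional sign in (-a_1)^(k+1) and in (-1)^(l+1) accounts for the outer minus. *)
Lemma mixed_term_step l k t :
  \sum_(1 <= j < n.+1) (a j)%:C *
     cintegral setT (fun v : R => gk (nu j) (t - v) * mixed_term l k v) =
  - (mixed_term l k.+1 t + mixed_term l.+1 k t).
Proof.
pose s : R[i] := (-1) ^+ l * (- (a 1%N)%:C) ^+ k.
transitivity (s * \sum_(1 <= j < n.+1) (a j)%:C *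
    msum l (fun c => fracint f0 (nu 1%N * k%:R + c + nu j) t)).
  rewrite mulr_sumr big_nat_cond [RHS]big_nat_cond; apply: eq_bigr => j /andP[/andP[j1 jn] _].
  have [|_ ->] := @mixed_term_semigroup l k j t; first by rewrite j1.
  by rewrite mulrCA.
rewrite big_ltn// mulrDr opprD; congr (_ + _).
  rewrite /mixed_term exprS mulrA.
  have -> : msum l (fun c => fracint f0 (nu 1%N * k%:R + c + nu 1%N) t) =
      msum l (fun c => fracint f0 (nu 1%N * k.+1%:R + c) t).
    by apply: eq_multinomial_sum => c _; rewrite -natr1 mulrDr mulr1 addrAC.
  by rewrite /s; move: (msum _ _) => M; ring.
rewrite /mixed_term /msum multinomial_sumS.
have -> : \sum_(2 <= j < n.+1) (a j)%:C * multinomial_sum n a nu l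
      (fun z => fracint f0 (nu 1%N * k%:R + (z + nu j)) t) =
    \sum_(2 <= j < n.+1) (a j)%:C * multinomial_sum n a nu l
      (fun z => fracint f0 (nu 1%N * k%:R + z + nu j) t).
  by apply: eq_bigr => j _; congr (_ * _); apply: eq_multinomial_sum => z _; rewrite addrA.
by rewrite /s exprS; move: (\sum_(2 <= j < n.+1) _) => M; ring.
Qed.

Lemma cintegrable_neumann m j t : (1 <= j <= n)%N ->
  cintegrable setT (fun v : R => gk (nu j) (t - v) * neumann_term m v) /\
  cintegral setT (fun v : R => gk (nu j) (t - v) * neumann_term m v) =
  \sum_(k < m.+1) 'C(m, k)%:R *
    cintegral setT (fun v : R => gk (nu j) (t - v) * mixed_term (m - k) k v).
Proof.
move=> jn.
have E : (fun v : R => gk (nu j) (t - v) * neumann_term m v) = (fun v : R =>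
   \sum_(k < m.+1) 'C(m, k)%:R * (gk (nu j) (t - v) * mixed_term (m - k) k v)).
  by apply/funext => v; rewrite mulr_sumr; apply: eq_bigr => k _; rewrite mulrCA.
have ik (k : 'I_m.+1) : cintegrable setT (fun v : R =>
    'C(m, k)%:R * (gk (nu j) (t - v) * mixed_term (m - k) k v)).
  by apply: cintegrableZ => //; have [] := mixed_term_semigroup (m - k) k t jn.
rewrite E; split; first by apply: cintegrable_sum.
rewrite cintegral_sum//; apply: eq_bigr => k _.
by apply: (cintegralZ _ measurableT); have [] := mixed_term_semigroup (m - k) k t jn.
Qed.

(** With binomial weights, the pairs x(l, k+1) + x(l+1, k) arising from diagonal m regroup by
    Pascal's rule into diagonal m + 1. *)
Lemma neumann_step m t :
  \sum_(1 <= j < n.+1) (a j)%:C *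
     cintegral setT (fun v : R => gk (nu j) (t - v) * neumann_term m v) =
  - neumann_term m.+1 t.
Proof.
transitivity (\sum_(k < m.+1) 'C(m, k)%:R * \sum_(1 <= j < n.+1) (a j)%:C *
     cintegral setT (fun v : R => gk (nu j) (t - v) * mixed_term (m - k) k v)).
  under [RHS]eq_bigr do rewrite mulr_sumr.
  rewrite exchange_big /= big_nat_cond [RHS]big_nat_cond.
  apply: eq_bigr => j /andP[/andP[j1 jn] _].
  have [|_ ->] := @cintegrable_neumann m j t; first by rewrite j1.
  by rewrite mulr_sumr; apply: eq_bigr => k _; rewrite mulrCA.
under eq_bigr do rewrite mixed_term_step mulrN.
rewrite sumrN; congr (- _).
rewrite /neumann_term -(pascal_sum (fun k => mixed_term (m.+1 - k) k t)).
by apply: eq_bigr => k _; rewrite subSS subSn// -ltnS.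
Qed.

Definition neumann_sum t : R[i] := clim (series (neumann_term ^~ t)).

Lemma neumann_cto t : cto (series (neumann_term ^~ t)) (neumann_sum t).
Proof.
have T0 : 0 < `|t| + 1 by rewrite ltr_wpDl.
have [C C0 h] := neumann_term_bound T0.
apply: ccvg_cto; apply: (@geometric_ccvg _ _ (C * env t) 4^-1).
- by rewrite invr_ge0.
- by rewrite lef_pV2 ?posrE// ler_nat.
- by move=> k; apply: h; rewrite (le_trans (ler_norm t))// lerDl.
Qed.

Lemma neumann_sum_neg t : t < 0 -> neumann_sum t = 0.
Proof.
move=> t0; apply: cto_clim; apply: (cto_ext _ (cto_cst 0)) => m.
rewrite /series/= big1// => k _; rewrite /neumann_term big1// => i _.
by rewrite mixed_term_neg// mulr0.
Qed.

(** Dominated convergence: the partial sums are at most 2 C [env], which [integrable_envelope] makes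
    integrable against the kernel. *)
Lemma neumann_sum_integral j t : (1 <= j <= n)%N ->
  cintegrable setT (fun v : R => gk (nu j) (t - v) * neumann_sum v) /\
  cto (fun L => cintegral setT (fun v : R => gk (nu j) (t - v) * series (neumann_term ^~ v) L))
    (cintegral setT (fun v : R => gk (nu j) (t - v) * neumann_sum v)).
Proof.
move=> jn; have T0 : 0 < `|t| + 1 by rewrite ltr_wpDl.
have [C C0 h] := neumann_term_bound T0.
pose c := normc (crGamma (nu j)) * (2 * C).
have ih : mu.-integrable setT (EFin \o (fun v : R =>
    c * (pwr (complex.Re (nu j)) (t - v) * env v))).
  by apply: (@integrableZl _ _ _ _ _ _ c _ (integrable_envelope nu_gt0 mf0 f0_neg f0_frac t jn)).
apply: (cdominated measurableT _ _ ih).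
- move=> L; have i : cintegrable setT (fun v : R =>
      \sum_(0 <= k < L) gk (nu j) (t - v) * neumann_term k v).
    by apply: cintegrable_sum => // k _; have [] := cintegrable_neumann k t jn.
  have [m _] := (cintegrableP _ measurableT).1 i.
  by apply: (cmeas_eq _ m) => v _; rewrite /series/= mulr_sumr.
- by move=> v _; exact: ctoZ (neumann_cto v).
move=> L v _; rewrite normcM normc_gk /c.
(* The bound on the partial sums is uniform only up to time |t| + 1; from t on the kernel
   vanishes. *)
have [vt|tv] := ltP v t; last first.
  by rewrite {1 2}/pwr subr_gt0 ltNge tv/= !(mulr0, mul0r).
have vT : v <= `|t| + 1 by rewrite (le_trans (ltW vt))// (le_trans (ler_norm t))// lerDl.
have b : normc (series (neumann_term ^~ v) L) <= 2 * C * env v.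
  apply: le_trans (normc_sum _ _ _) _.
  apply: le_trans (_ : \sum_(0 <= k < L) (C * env v) * 4^-1 ^+ k <= _).
    by apply: ler_sum => k _; exact: h.
  apply: le_trans (geometric_sum_le 0 L _ _ _) _.
  - by rewrite mulr_ge0 ?(ltW C0)//; exact: envelope_ge0.
  - by rewrite invr_ge0.
  - by rewrite lef_pV2 ?posrE// ler_nat.
  - by rewrite expr0 mulr1 mulrA.
move: (envelope_ge0 n nu f0 v) b; rewrite -/env; move: (normc (series _ _)) (env v) => S e e0 b.
have P0 := pwr_ge0 (complex.Re (nu j)) (t - v); have N0 := normc_ge0 (crGamma (nu j)).
move: (pwr _ _) (normc _) P0 N0 => P N P0 N0.
rewrite [leRHS](_ : _ = N * P * (2 * C * e)); last by ring.
by rewrite ler_wpM2l// mulr_ge0.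
Qed.

(** The partial sum of L + 1 terms minus its first term f0 is the operator - sum_j a_j I^(nu_j)
    applied to the partial sum of L terms; both sides pass to the limit. *)
Lemma neumann_sum_eq t : neumann_sum t - f0 t =
  - \sum_(1 <= j < n.+1) (a j)%:C *
     cintegral setT (fun v : R => gk (nu j) (t - v) * neumann_sum v).
Proof.
have c1 : cto (fun L => - \sum_(1 <= j < n.+1) (a j)%:C * cintegral setT
      (fun v : R => gk (nu j) (t - v) * series (neumann_term ^~ v) L))
    (- \sum_(1 <= j < n.+1) (a j)%:C *
      cintegral setT (fun v : R => gk (nu j) (t - v) * neumann_sum v)).
  have : cto (fun L => \sum_(1 <= j < n.+1 | (1 <= j < n.+1)%N && true) (a j)%:C * cintegral setT
      (fun v : R => gk (nu j) (t - v) * series (neumann_term ^~ v) L))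
    (\sum_(1 <= j < n.+1 | (1 <= j < n.+1)%N && true) (a j)%:C *
      cintegral setT (fun v : R => gk (nu j) (t - v) * neumann_sum v)).
    apply: cto_sum => j; rewrite andbT => jn; apply: ctoZ.
    by have [] := neumann_sum_integral t jn.
  move=> /(ctoZ (-1)); rewrite mulN1r -big_nat_cond; apply: cto_ext => L.
  by rewrite mulN1r -big_nat_cond.
apply: (cto_unique _ c1); apply: (cto_ext _ (ctoB ((cto_shiftS _ _).2 (neumann_cto t)) (cto_cst (f0 t)))).
move=> L.
transitivity (- \sum_(0 <= k < L) \sum_(1 <= j < n.+1) (a j)%:C *
    cintegral setT (fun v : R => gk (nu j) (t - v) * neumann_term k v)).
  rewrite /series/= big_nat_recl//= neumann_term0 addrAC subrr add0r -sumrN.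
  by apply: eq_bigr => k _; rewrite neumann_step opprK.
rewrite exchange_big /=; congr (- _).
rewrite big_nat_cond [RHS]big_nat_cond; apply: eq_bigr => j /andP[/andP[j1 jn] _].
have jn' : (1 <= j <= n)%N by rewrite j1.
rewrite -mulr_sumr; congr (_ * _).
transitivity (cintegral setT (fun v : R =>
    \sum_(0 <= k < L) gk (nu j) (t - v) * neumann_term k v)).
  by rewrite cintegral_sum// => k _; have [] := cintegrable_neumann k t jn'.
by apply: eq_cintegral => v _; rewrite /series/= mulr_sumr.
Qed.

Lemma mixed_term_cto l t :
  cto (series (fun k => 'C(l + k, k)%:R * mixed_term l k t))
    ((-1) ^+ l * msum l (fun c => (if c == 0 then f0 t else 0) + mlconv a nu f0 l c t)).
Proof.
have h : cto (fun m => msum l (fun c =>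
      series (fun k => mlcoef a l k * fracint f0 (nu 1%N * k%:R + c) t) m))
    (msum l (fun c => (if c == 0 then f0 t else 0) + mlconv a nu f0 l c t)).
  by apply: multinomial_sum_cto => c lc; exact: (ml_expansion n_gt0 nu_gt0 a_gt0 mf0 f0_neg f0_frac).
have := ctoZ ((-1) ^+ l) h; apply: cto_ext => m.
rewrite /series/= /msum multinomial_sum_sum mulr_sumr; apply: eq_bigr => k _.
rewrite multinomial_sumZ /mixed_term /mlcoef /msum.
by move: (multinomial_sum _ _ _ _ _) => M; rewrite -!mulrA mulrCA.
Qed.

Lemma neumann_rearranged t : cto (series (fun l =>
    (-1) ^+ l * msum l (fun c => (if c == 0 then f0 t else 0) + mlconv a nu f0 l c t)))
  (neumann_sum t).
Proof.
have T0 : 0 < `|t| + 1 by rewrite ltr_wpDl.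
have [C C0 h] := mixed_term_bound T0.
have tT : t <= `|t| + 1 by rewrite (le_trans (ler_norm t))// lerDl.
have e0 : 0 <= env t := envelope_ge0 n nu f0 t.
apply: (diagonal_cto (x := fun l k => 'C(l + k, k)%:R * mixed_term l k t)
  (C := C * env t)) => [|l k|l|].
- by rewrite mulr_ge0// ltW.
- rewrite normcM normc_nat.
  apply: le_trans (_ : 2 ^+ (l + k) * (C * 8^-1 ^+ (l + k) * env t) <= _).
    apply: ler_pM => //; [exact: normc_ge0| |exact: h].
    by rewrite -natrX ler_nat bin_le_exp.
  rewrite le_eqVlt; apply/orP; left; apply/eqP.
  have -> : 4^-1 = 2 * 8^-1 :> R by field.
  by rewrite exprMn; ring.
- exact: mixed_term_cto.
apply: (cto_ext _ (neumann_cto t)) => L; apply: eq_bigr => m _.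
by apply: eq_bigr => k _; rewrite subnK// -ltnS.
Qed.

End IteratedKinetic.

(** * Regularity of the source from the convergence of the integrals *)

Section SourceRegularity.
Context {R : realType}.
Local Notation mu := (@lebesgue_measure R).
Variables (n : nat) (a : nat -> R) (nu : nat -> R[i]) (f : R -> R[i]).
Hypothesis n_gt0 : (0 < n)%N.
Hypothesis nu_gt0 : forall j : nat, (1 <= j <= n)%N -> 0 < complex.Re (nu j).
Hypothesis a_gt0 : forall j : nat, (1 <= j <= n)%N -> 0 < a j.
Hypothesis integrals_cvg : solution_integrals_converge n a nu f.

Let ML l c := ML_integrand (l.+1)%:R (nu 1%N) c (- (a 1%N)%:C) f.

Let MLE l c (t u : R) : u \in `[0, t[%classic -> ML l c t u = f u * mlk a nu l c (t - u).
Proof.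
rewrite mem_setE in_itv/= => /andP[_ ut].
by rewrite /ML /ML_integrand /mlk subr_gt0 ut -mulrA.
Qed.

Let ML_co l (r : multi_exponent n l) t : 0 <= t -> weight r = l ->
  cintegrable `[0, t[ (ML l (order_sum nu r) t).
Proof.
move=> t0 wr; apply: (cintegrableS _ _ _ (integrals_cvg t0 wr)) => // u /=.
by rewrite !in_itv/= => /andP[-> /ltW].
Qed.

Let integrable_mlk l (r : multi_exponent n l) t : 0 <= t -> weight r = l ->
  cintegrable `[0, t[ (fun u : R => f u * mlk a nu l (order_sum nu r) (t - u)).
Proof.
by move=> t0 wr; move: (ML_co t0 wr); apply: eq_cintegrable => // u; exact: MLE.
Qed.

(** The integrand and its truncated form agree on [0, t); the endpoint u = t, where the truncated
    kernel is set to 0, is a null set. *)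
Lemma ML_integralE l (r : multi_exponent n l) t : 0 <= t -> weight r = l ->
  ML_integral (l.+1)%:R (nu 1%N) (order_sum nu r) (- (a 1%N)%:C) f t =
  (if order_sum nu r == 0 then posext f t else 0) +
  mlconv a nu (posext f) l (order_sum nu r) t.
Proof.
move=> t0 wr; rewrite /ML_integral {1}/posext t0; congr (_ + _).
have [_ e] := cint_itv_co_cc (ML_co t0 wr).
apply: etrans e _; rewrite cintegral_mkcond /mlconv; apply: eq_cintegral => u _.
case: ifPn => [ut|]; first by rewrite MLE// mulrC /posext; move: ut; rewrite mem_setE in_itv/= => /andP[-> _].
rewrite mem_setE in_itv/= negb_and /posext /mlk subr_gt0.
by case: (0 <= u) => /= [/negbTE ->|_]; rewrite ?mul0r ?mulr0.
Qed.

(* A multi-index whose kernel has the leading exponent Re (nu_j) - 1: the zero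
   index for j = 1 (the coefficient of its first term is 1 / Gamma(0) = 0) and
   a unit index for j >= 2. *)
Lemma source_regular j : (1 <= j <= n)%N -> cmeas setT (posext f) /\
  forall t, (\int[mu]_u (pwr (complex.Re (nu j)) (t - u) * normc (posext f u))%:E < +oo)%E.
Proof.
move=> jn; suff [l [r [k0 [wr z0 kt0]]]] : exists l (r : multi_exponent n l) k0,
    [/\ weight r = l, nu 1%N * k0%:R + order_sum nu r = nu j &
     forall k s, (k < k0)%N -> kt a nu l (order_sum nu r) k s = 0].
  have lc : ladder n nu l (order_sum nu r) := order_sum_ladder nu wr.
  have zj : 0 < complex.Re (nu 1%N * k0%:R + order_sum nu r) by rewrite z0 nu_gt0.
  have [e [d [e0 d0 low]]] := mlk_lower n_gt0 nu_gt0 a_gt0 lc zj kt0.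
  have mk := cmeas_mlk n_gt0 nu_gt0 a_gt0 lc.
  have fk t (t0 : 0 <= t) := integrable_mlk t0 wr.
  rewrite z0 in low; split; first exact: (deconv_cmeas mk fk e0 d0 low).
  exact: (deconv_frac_lty mk fk e0 d0 low).
case: j jn => [|[|j]]// jn.
  pose r0 : multi_exponent n 0 := [ffun=> ord0].
  have r0E m : r0 m = 0%N :> nat by rewrite ffunE.
  have o0 : order_sum nu r0 = 0 by rewrite /order_sum big1// => m _; rewrite r0E mul0r.
  exists 0%N, r0, 1%N; rewrite o0 addr0 mulr1; split => //.
    by rewrite /weight big1// => m _; rewrite r0E.
  by case=> // s _; rewrite /kt mulr0 addr0 gk0 mulr0.
have jn1 : (j < n.-1)%N by rewrite ltn_predRL.
pose m0 := Ordinal jn1.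
pose r1 : multi_exponent n 1 := [ffun m => inord (m == m0)].
have r1E m : r1 m = (m == m0) :> nat by rewrite ffunE inordK//; case: (m == m0).
exists 1%N, r1, 0%N; rewrite mulr0 add0r; split => //.
  by rewrite /weight (bigD1 m0)//= r1E eqxx big1// => m /negbTE mm; rewrite r1E mm.
rewrite /order_sum (bigD1 m0)//= r1E eqxx mul1r big1 ?addr0// => m /negbTE mm.
by rewrite r1E mm mul0r.
Qed.

End SourceRegularity.

Theorem theorem1 (R : realType) (n : nat) (a : nat -> R) (nu : nat -> R[i])
    (N0 : R[i]) (f : R -> R[i])
    (n_gt0 : (0 < n)%N)
    (nu_gt0 : forall j : nat, (1 <= j <= n)%N -> 0 < complex.Re (nu j))
    (a_gt0 : forall j : nat, (1 <= j <= n)%N -> 0 < a j)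
    (integrals_cvg : solution_integrals_converge n a nu f)
    (series_cvg : solution_series_converges n a nu f) :
  exists N : R -> R[i],
    kinetic_solution n a nu N0 f N /\
    forall t : R, 0 <= t -> N t = N0 * clim (series (solution_term n a nu f t)).
Proof.
pose f0 := posext f.
have one_n : (1 <= 1 <= n)%N by rewrite leqnn.
(* The measurability of f0 can be read off any order; n > 0 makes j = 1 available. *)
have [mf0 _] := source_regular n_gt0 nu_gt0 a_gt0 integrals_cvg one_n.
have f0_neg u : u < 0 -> f0 u = 0 by rewrite /f0 /posext leNgt => ->.
have f0_frac j t (jn : (1 <= j <= n)%N) :=
  (source_regular n_gt0 nu_gt0 a_gt0 integrals_cvg jn).2 t.
pose S := neumann_sum n a nu f0.
exists (fun t => N0 * S t); split=> [t t0|t t0]; last first.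
  congr (_ * _); apply/esym/cto_clim.
  have := neumann_rearranged n_gt0 nu_gt0 a_gt0 mf0 f0_neg f0_frac t.
  apply: cto_ext => L; apply: eq_bigr => l _; congr (_ * _).
  apply: eq_bigr => r /eqP wr; congr (_ * _); apply/esym.
  exact: (ML_integralE integrals_cvg t0 wr).
(* The solution vanishes at negative times, so extending it by zero changes nothing, and [RL_posext]
   identifies its fractional integrals with convolutions over the whole line. *)
have SN : posext (fun u => N0 * S u) = (fun u => N0 * S u).
  apply/funext => u; rewrite /posext; case: leP => // u0.
  by rewrite /S (@neumann_sum_neg _ n a nu f0 n_gt0 f0_neg u u0) mulr0.
have RL j : (1 <= j <= n)%N -> RL_defined (nu j) (fun u => N0 * S u) t /\
    RL_integral (nu j) (fun u => N0 * S u) t =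
    N0 * cintegral setT (fun v : R => gk (nu j) (t - v) * S v).
  move=> jn.
  have [iS _] := neumann_sum_integral n_gt0 nu_gt0 a_gt0 mf0 f0_neg f0_frac t jn.
  have E : (fun v : R => N0 * (gk (nu j) (t - v) * S v)) =
      (fun v : R => gk (nu j) (t - v) * posext (fun u => N0 * S u) v).
    by apply/funext => v; rewrite SN mulrCA.
  have iN := cintegrableZ N0 measurableT iS; rewrite E in iN.
  have [h1 h2] := RL_posext (nu_gt0 j jn) iN; split => //.
  by rewrite h2 -E; exact: (cintegralZ N0 measurableT iS).
split=> [j jn|]; first by have [] := RL j jn.
transitivity (N0 * (S t - f0 t)); first by rewrite mulrBr /f0 /posext t0.
rewrite (neumann_sum_eq n_gt0 nu_gt0 a_gt0 mf0 f0_neg f0_frac t) mulrN mulr_sumr.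
congr (- _); rewrite big_nat_cond [RHS]big_nat_cond.
apply: eq_bigr => j /andP[/andP[j1 jn] _].
have [|_ ->] := RL j; first by rewrite j1.
by rewrite mulrCA.
Qed.
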